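(* Fix a family of homeomorphisms $\tau_A:P(\chi_A)\to\Delta^A$ ($A\subset\mathbb{Z}_+$ finite) compatible with faces, and the resulting homeomorphisms $\tau(\chi_{A,B},\chi_{C,D})$, as specified in the context. Then there is a family of homeomorphisms $$\Phi(\bar r):P(\bar r)\xrightarrow{\ \cong\ }P(\chi(\bar r)),$$ one for every round counter $\bar r$, such that for every round counter $\bar r$: (1) for all proper subsets $V\subsetneq\operatorname{supp}\bar r$, as maps $B_V(\bar r)\to P(\chi(\bar r))$, $$\Phi(\bar r)\circ\beta_V(\bar r)=\beta_V(\chi(\bar r))\circ\delta_V(\chi(\bar r))^{-1}\circ\Phi(\bar r\setminus V)\circ\delta_V(\bar r)$$ (here $\chi(\bar r\setminus V)=\chi(\bar r)\setminus V$); (2) for all $S\subseteq\operatorname{act}\bar r$, as maps $X_S(\bar r)\to P(\chi(\bar r))$, $$\Phi(\bar r)\circ\alpha_S(\bar r)=\alpha_S(\chi(\bar r))\circ\gamma_S(\chi(\bar r))^{-1}\circ\tau(\chi(\bar r_S),\chi(\bar r)_S)\circ\Phi(\bar r_S)\circ\gamma_S(\bar r).$$ In particular, for every round counter $\bar r$ the simplicial complex $P(\bar r)$ is simplicially homeomorphic to the simplex $\Delta^{\operatorname{supp}\bar r}$, i.e. there is a homeomorphism $\varphi:\Delta^{\operatorname{supp}\bar r}\to P(\bar r)$ such that $\varphi(\sigma)$ is a subcomplex of $P(\bar r)$ for every simplex $\sigma$ of $\Delta^{\operatorname{supp}\bar r}$.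
   Context: **Witness structures.** $\mathbb{Z}_+=\{0,1,2,\dots\}$. A witness prestructure is a sequence $\sigma=((W_0,G_0),\dots,(W_t,G_t))$, $t\ge 0$, of pairs of finite subsets of $\mathbb{Z}_+$ such that (P1) $W_i,G_i\subseteq W_0$ for $1\le i\le t$; (P2) $G_i\cap G_j=\emptyset$ for $0\le i<j\le t$; (P3) $G_i\cap W_j=\emptyset$ for $0\le i\le j\le t$. It is stable if $t=0$ or $W_t\ne\emptyset$; it is a witness structure if $W_1,\dots,W_t$ are all nonempty. Put $\operatorname{supp}\sigma=W_0\cup G_0$, $G(\sigma)=G_0\cup\dots\cup G_t$, $A(\sigma)=\operatorname{supp}\sigma\setminus G(\sigma)$, $\dim\sigma=|A(\sigma)|-1$, $R_i=W_i\cup G_i$, $\operatorname{Tr}(p,\sigma)=\{0\le i\le t: p\in R_i\}$ and $M(p,\sigma)=|\operatorname{Tr}(p,\sigma)|$ for $p\in\operatorname{supp}\sigma$. **Ghosting.** For $S\subseteq A(\sigma)$ let $q=\max\{0\le i\le t: R_i\not\subseteq S\cup G(\sigma)\}$ ($q=0$ if there is no such $i$), $\operatorname{Tr}'(p)=\operatorname{Tr}(p,\sigma)\cap\{0,\dots,q\}$, and $\operatorname{st}_S(\sigma)=((W'_0,G'_0),\dots,(W'_q,G'_q))$ with $G'_k=\{p\in G(\sigma)\cup S:\max\operatorname{Tr}'(p)=k\}$, $W'_k=\{p\in\operatorname{supp}\sigma: k\in\operatorname{Tr}'(p)\}\setminus G'_k$; this is a stable witness prestructure. The canonical form of a stable prestructure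 $\sigma$: let $i_1<\dots<i_m$ be the indices $i\ge1$ with $W_i\neq\emptyset$, $i_0=0$; then $C(\sigma)=((W_0,G_0),(\widetilde W_1,\widetilde G_1),\dots,(\widetilde W_m,\widetilde G_m))$ with $\widetilde W_k=W_{i_k}$, $\widetilde G_k=G_{i_{k-1}+1}\cup\dots\cup G_{i_k}$. Put $\Gamma_S(\sigma)=C(\operatorname{st}_S(\sigma))$. **Round counters.** A round counter is a function $\bar r:\mathbb{Z}_+\to\mathbb{Z}_+\cup\{\bot\}$ with $\operatorname{supp}\bar r=\{i:\bar r(i)\ne\bot\}$ finite; $\operatorname{act}\bar r=\{i\in\operatorname{supp}\bar r:\bar r(i)\ge1\}$, $\operatorname{pass}\bar r=\{i\in\operatorname{supp}\bar r:\bar r(i)=0\}$. For disjoint finite $A,B$, $\chi_{A,B}$ equals $1$ on $A$, $0$ on $B$, $\bot$ elsewhere; $\chi_A=\chi_{A,\emptyset}$; $\chi(\bar r)=\chi_{\operatorname{act}\bar r,\operatorname{pass}\bar r}$. $\bar r\setminus A$ is $\bar r$ with the values on $A$ replaced by $\bot$. For $S\subseteq\operatorname{act}\bar r$, $\bar r_S=\bar r\downarrow S$ is $\bar r$ with the values on $S$ decreased by $1$. **The complex $P(\bar r)$.** Its simplices are (indexed by) the witness structures $\sigma$ with $\operatorname{supp}\sigma=\operatorname{supp}\bar r$, $M(p,\sigma)=\bar r(p)+1$ for $p\in A(\sigma)$, and $M(p,\sigma)\le\bar r(p)+1$ for $p\in G(\sigma)$. The simplex $\sigma$ has dimension $\dim\sigma$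 and vertices $\Gamma_{A(\sigma)\setminus\{a\}}(\sigma)$, $a\in A(\sigma)$; the faces of $\sigma$ are the $\Gamma_S(\sigma)$, $S\subseteq A(\sigma)$. The empty simplex $((\emptyset,\operatorname{supp}\bar r))$ is included. We use the same notation for a complex and its geometric realization, and for a simplicial map and the induced map of realizations. **Subcomplexes and maps.** For $V\subseteq\operatorname{supp}\bar r$, $B_V(\bar r)$ is the subcomplex of simplices with $V\subseteq G_0$; $\beta_V(\bar r):B_V(\bar r)\hookrightarrow P(\bar r)$ is the inclusion; $\delta_V(\bar r):B_V(\bar r)\to P(\bar r\setminus V)$ is the simplicial isomorphism replacing $G_0$ by $G_0\setminus V$. For $S\subseteq\operatorname{act}\bar r$, $X_S(\bar r)$ is the subcomplex of simplices $\sigma=((W_0,G_0),\dots,(W_t,G_t))$ with $t=0$, or with $t\ge1$ and ($R_1=S$ or $S\subseteq G_1$); $\alpha_S(\bar r):X_S(\bar r)\hookrightarrow P(\bar r)$ is the inclusion; $\gamma_S(\bar r):X_S(\bar r)\to P(\bar r_S)$ is the simplicial isomorphism sending $\sigma$ to itself if $t=0$, to $((W_0\setminus G_1,G_0\cup G_1),(W_2,G_2),\dots,(W_t,G_t))$ if $R_1=S$, and to $((W_0\setminus S,G_0\cup S),(W_1,G_1\setminus S),(W_2,G_2),\dots,(W_t,G_t))$ if $t\ge 1$ and $S\subseteq G_1$. **The maps $\tau$.** $\Delta^A$ is the simplex with vertex set $A$. It is known (earlier work; $P(\chi_A)$ is the standard chromatic subdivision of $\Delta^A$) that there are homeomorphisms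 $\tau_A:P(\chi_A)\to\Delta^A$, for all finite $A\subset\mathbb{Z}_+$, such that for all $C\subseteq A$ one has $\tau_A\circ\beta_{A\setminus C}(\chi_A)=i\circ\tau_C\circ\delta_{A\setminus C}(\chi_A)$, with $i:\Delta^C\hookrightarrow\Delta^A$ the standard inclusion. Fix such a family. For disjoint finite $A,B$, $P(\chi_{A,B})$ is identified with the join (iterated cone) $P(\chi_A)*\Delta^B$ by letting the simplex $((W_0,G_0),(W_1,G_1),\dots,(W_t,G_t))$ correspond to the join of $((W_0\setminus B,G_0\setminus B),(W_1,G_1),\dots,(W_t,G_t))$ and the face $W_0\cap B$ of $\Delta^B$; let $\tau_{A,B}=\tau_A*\mathrm{id}_{\Delta^B}:P(\chi_{A,B})\to\Delta^A*\Delta^B=\Delta^{A\cup B}$. When $A\cup B=C\cup D$, set $\tau(\chi_{A,B},\chi_{C,D})=\tau_{C,D}^{-1}\circ\tau_{A,B}:P(\chi_{A,B})\to P(\chi_{C,D})$.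
   Formalization: In the definition of ghosting, G'_k is taken as the set of p in G(σ)∪S with max Tr'(p)=k; the printed G(σ)∩S is always empty (S lies in A(σ)), so the listed vertices would not be vertices of P(r̄). *)

(* Defs.v *)
From HB Require Import structures.
From mathcomp Require Import all_boot all_order all_algebra.
From mathcomp Require Import finmap.
From mathcomp Require Import all_classical all_reals all_analysis.

Set Implicit Arguments.
Unset Strict Implicit.
Unset Printing Implicit Defensive.

Import Order.TTheory GRing.Theory Num.Theory.
Import numFieldNormedType.Exports.

Local Open Scope classical_set_scope.
Local Open Scope fset_scope.

(** * Witness structures *)

(* The sequence ((W_0,G_0),...,(W_t,G_t)); such a sequence has size t.+1.
   Out-of-range indices give (fset0, fset0). *)
Definition wseq := seq ({fset nat} * {fset nat}).

Definition Wof (s : wseq) (i : nat) : {fset nat} := (nth (fset0, fset0) s i).1.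
Definition Gof (s : wseq) (i : nat) : {fset nat} := (nth (fset0, fset0) s i).2.
Definition Rof (s : wseq) (i : nat) : {fset nat} := Wof s i `|` Gof s i.

Definition witness_prestructure (s : wseq) : Prop :=
  [/\ (0 < size s)%N,
      forall i, (1 <= i < size s)%N ->
        Wof s i `<=` Wof s 0 /\ Gof s i `<=` Wof s 0,
      forall i j, (i < j < size s)%N -> Gof s i `&` Gof s j = fset0
    & forall i j, (i <= j < size s)%N -> Gof s i `&` Wof s j = fset0].

Definition witness_structure (s : wseq) : Prop :=
  witness_prestructure s /\
  forall i, (1 <= i < size s)%N -> Wof s i != fset0.

Definition wsupp (s : wseq) : {fset nat} := Wof s 0 `|` Gof s 0.
Definition ghosts (s : wseq) : {fset nat} :=
  \bigcup_(i <- iota 0 (size s)) Gof s i.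
Definition active (s : wseq) : {fset nat} := wsupp s `\` ghosts s.

(* Tr(p, s), listed in increasing order, and M(p, s). *)
Definition trace (p : nat) (s : wseq) : seq nat :=
  [seq i <- iota 0 (size s) | p \in Rof s i].
Definition mult (p : nat) (s : wseq) : nat := size (trace p s).

(** * Ghosting *)

(* The empty maximum is 0, as required for q. *)
Definition st_last (S : {fset nat}) (s : wseq) : nat :=
  \max_(i <- [seq i <- iota 0 (size s) | ~~ (Rof s i `<=` S `|` ghosts s)]) i.

Definition st_trace (S : {fset nat}) (s : wseq) (p : nat) : seq nat :=
  [seq i <- trace p s | (i <= st_last S s)%N].

Definition st_G (S : {fset nat}) (s : wseq) (k : nat) : {fset nat} :=
  [fset p in ghosts s `|` S | \max_(i <- st_trace S s p) i == k].

Definition st_W (S : {fset nat}) (s : wseq) (k : nat) : {fset nat} :=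
  [fset p in wsupp s | k \in st_trace S s p] `\` st_G S s k.

Definition st (S : {fset nat}) (s : wseq) : wseq :=
  mkseq (fun k => (st_W S s k, st_G S s k)) (st_last S s).+1.

(* canon_idx s lists 0 = i_0 < i_1 < ... < i_m. *)
Definition canon_idx (s : wseq) : seq nat :=
  0%N :: [seq i <- iota 1 (size s).-1 | Wof s i != fset0].

Definition canonical_form (s : wseq) : wseq :=
  (Wof s 0, Gof s 0) ::
  mkseq (fun k => let i := nth 0%N (canon_idx s) k in
                  let j := nth 0%N (canon_idx s) k.+1 in
                  (Wof s j, \bigcup_(l <- iota i.+1 (j - i)) Gof s l))
        (size (canon_idx s)).-1.

Definition Gamma (S : {fset nat}) (s : wseq) : wseq := canonical_form (st S s).

(** * Round counters *)

(* None plays the role of the undefined value. *)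
Definition round_counter := {fsfun nat -> option nat with None}.

Definition rval (r : round_counter) (p : nat) : nat := odflt 0%N (r p).

Definition act (r : round_counter) : {fset nat} :=
  [fset p in finsupp r | (1 <= rval r p)%N].
Definition pass (r : round_counter) : {fset nat} :=
  [fset p in finsupp r | rval r p == 0%N].

(* Meant for disjoint A and B. *)
Definition chi2 (A B : {fset nat}) : round_counter :=
  [fsfun p in A `|` B => (if p \in A then Some 1%N else Some 0%N) | None].
Definition chi1 (A : {fset nat}) : round_counter := chi2 A fset0.
Definition chi (r : round_counter) : round_counter := chi2 (act r) (pass r).

Definition rc_del (r : round_counter) (V : {fset nat}) : round_counter :=
  [fsfun p in finsupp r `\` V => r p | None].

(* Meant for S contained in act r. *)
Definition rc_dec (r : round_counter) (S : {fset nat}) : round_counter :=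
  [fsfun p in finsupp r => (if p \in S then omap predn (r p) else r p) | None].

(** * The complex P(r) and its subcomplexes *)

(* Simplices are represented by the witness structures that index them. *)
Definition Pcx (r : round_counter) : set wseq :=
  [set s | [/\ witness_structure s,
               wsupp s = finsupp r,
               forall p, p \in active s -> mult p s = (rval r p).+1
             & forall p, p \in ghosts s -> (mult p s <= (rval r p).+1)%N]].

Definition vertices (s : wseq) : {fset wseq} :=
  [fset Gamma (active s `\ a) s | a in active s].

Definition subcomplex (L : set wseq) (r : round_counter) : Prop :=
  (L `<=` Pcx r)%classic /\
  forall s S, L s -> S `<=` active s -> L (Gamma S s).

Definition Bcx (V : {fset nat}) (r : round_counter) : set wseq :=
  [set s | Pcx r s /\ V `<=` Gof s 0].

Definition delta (V : {fset nat}) (s : wseq) : wseq :=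
  (Wof s 0, Gof s 0 `\` V) :: behead s.

Definition Xcx (S : {fset nat}) (r : round_counter) : set wseq :=
  [set s | Pcx r s /\
    (size s = 1%N \/
     ((1 < size s)%N /\ (Rof s 1 = S \/ S `<=` Gof s 1)))].

Definition gamma (S : {fset nat}) (s : wseq) : wseq :=
  if (size s <= 1)%N then s
  else if Rof s 1 == S then
    (Wof s 0 `\` Gof s 1, Gof s 0 `|` Gof s 1) :: drop 2 s
  else
    (Wof s 0 `\` S, Gof s 0 `|` S) :: (Wof s 1, Gof s 1 `\` S) :: drop 2 s.

(** * Geometric realizations *)

Local Open Scope ring_scope.

(* Points of realizations are given by their barycentric coordinates: they are
   functions from the vertex type to R, with the topology of pointwise
   convergence. On the realization of a finite complex this induces the usual
   topology. The realization of a subcomplex is a subset of the realization of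
   the complex, so inclusions of subcomplexes act as the identity. *)
Notation pt R V := {ptws V -> R}.

Definition realization (R : realType) (V : choiceType) (K : set {fset V}) :
    set (pt R V) :=
  [set x : pt R V | (forall v, 0 <= x v) /\
     exists2 s : {fset V}, K s &
       (forall v, v \notin s -> x v = 0) /\ \sum_(v <- s) x v = 1].
Arguments realization R {V} K.

(* The map induced by a vertex map f. *)
Definition simp_map (R : realType) (V U : choiceType) (f : V -> U)
    (x : pt R V) : pt R U :=
  fun u => \sum_(v \in f @^-1` [set u]) x v.

Definition geom (R : realType) (L : set wseq) : set (pt R wseq) :=
  realization R [set vertices s | s in L]%classic.
Arguments geom R L : clear implicits.

Definition simplex (R : realType) (A : {fset nat}) : set (pt R nat) :=
  realization R [set B : {fset nat} | B `<=` A].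
Arguments simplex R A : clear implicits.

(* The inverse of f : X -> f @` X, when f is injective on X. *)
Definition inv_on (R : realType) (V U : choiceType) (X : set (pt R V))
    (f : pt R V -> pt R U) : pt R U -> pt R V :=
  'pinv_(fun=> (fun=> 0) : pt R V) X f.

Definition homeo (R : realType) (V U : choiceType)
    (X : set (pt R V)) (Y : set (pt R U)) (f : pt R V -> pt R U) : Prop :=
  [/\ set_bij X Y f,
      {within X, continuous f}
    & {within Y, continuous (inv_on X f)}].

(** * Joins *)

Definition massl (R : realType) (V V' : choiceType)
    (z : pt R (V + V')%type) : R :=
  \sum_(v \in [set: V]) z (inl v).
Definition massr (R : realType) (V V' : choiceType)
    (z : pt R (V + V')%type) : R :=
  \sum_(v \in [set: V']) z (inr v).

(* The join f * g sends (1 - t) x + t y to (1 - t) f x + t g y; here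
   1 - t = massl z and t = massr z. If one of the masses vanishes, so does the
   corresponding term, whatever the value of f or g at the zero function. *)
Definition join_map (R : realType) (V V' U U' : choiceType)
    (f : pt R V -> pt R U) (g : pt R V' -> pt R U')
    (z : pt R (V + V')%type) : pt R (U + U')%type :=
  fun w => match w with
  | inl u => massl z * f (fun v => (massl z)^-1 * z (inl v)) u
  | inr u => massr z * g (fun v => (massr z)^-1 * z (inr v)) u
  end.

(* The identification of P(chi2 A B) with P(chi1 A) * simplex B, on vertices:
   a vertex is either some b in B (then W_0 meets B in b and the first factor
   is the empty simplex) or a vertex of P(chi1 A) (then W_0 misses B). *)
Definition join_vertex (B : {fset nat}) (s : wseq) : (wseq + nat)%type :=
  match enum_fset (Wof s 0 `&` B) with
  | b :: _ => inr b
  | [::] => inl ((Wof s 0 `\` B, Gof s 0 `\` B) :: behead s)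
  end.

(* The identification of simplex A * simplex B with simplex (A `|` B). *)
Definition join_fold (w : (nat + nat)%type) : nat :=
  match w with inl p => p | inr p => p end.

(** * The maps tau *)

Definition tau_family (R : realType)
    (tau : {fset nat} -> pt R wseq -> pt R nat) : Prop :=
  (forall A, homeo (geom R (Pcx (chi1 A))) (simplex R A) (tau A)) /\
  (forall A C : {fset nat}, C `<=` A ->
     forall x, geom R (Bcx (A `\` C) (chi1 A)) x ->
       tau A x = tau C (simp_map (delta (A `\` C)) x)).

Definition tau_join (R : realType)
    (tau : {fset nat} -> pt R wseq -> pt R nat) (A B : {fset nat}) :
    pt R wseq -> pt R nat :=
  fun x => simp_map join_fold
             (join_map (tau A) id (simp_map (join_vertex B) x)).

(* tau(c, d) for c = chi2 A B and d = chi2 C D: then A = act c, B = pass c,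
   C = act d and D = pass d. *)
Definition tau_change (R : realType)
    (tau : {fset nat} -> pt R wseq -> pt R nat) (c d : round_counter) :
    pt R wseq -> pt R wseq :=
  fun x => inv_on (geom R (Pcx d)) (tau_join tau (act d) (pass d))
             (tau_join tau (act c) (pass c) x).

(* Main.v *)
(** Composing the wanted [Phi r] with the homeomorphism [tau] from [P(chi r)] to
    the simplex gives a map [Psi r] to the simplex on the support of [r].
    Condition (2) prescribes [Psi r] on [X_S(r)] in terms of [Psi (r_S)], and for
    [act r] nonempty the [X_S(r)] with [S] nonempty cover [P(r)], so [Psi r] is
    defined by induction on the sum of the values of [r]. The prescriptions agree
    on [X_S(r)] and [X_T(r)] for [T] included in [S], because [gamma_S] maps the
    intersection onto [B_T(r_S)], where (1) applies, and because the family [tau]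
    is itself compatible with faces; the general case goes through [X_{S + T}(r)],
    which contains the intersection. Bijectivity is proved along the same
    induction, and a continuous bijection between these compact Hausdorff spaces
    is a homeomorphism.

    The combinatorics becomes short once a witness structure is encoded by its
    support, its active set and the list of the sets [R_1, ..., R_t]: ghosting is
    a right fold, [delta_V] does not change the code except for the support, and
    [gamma_S] strips [S] from the first round. *)

Require Import Defs.
From mathcomp Require Import all_boot all_order all_algebra.
From mathcomp Require Import finmap.
From mathcomp Require Import all_classical all_reals all_analysis.

Set Implicit Arguments.
Unset Strict Implicit.
Unset Printing Implicit Defensive.

(** * Witness structures as lists of rounds *)

Section Combinatorics.

Local Open Scope fset_scope.

Implicit Types (A B S T Q U V : {fset nat}) (L : seq {fset nat}) (p a : nat).
Implicit Types (s v : wseq) (r : round_counter).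

(** The gain of [Psi] over [Phi] is that (1) becomes plain restriction to faces, while the
    correction [tau_change] in (2) becomes part of a self-map of one fixed simplex ([transfer]). The
    delicate point is injectivity: points [x] of [X_S(r)] and [y] of [X_T(r)] with the same image
    are not known to share a piece. They are compared through [P(chi r)], where the join of [tau] is
    already bijective. The point [z] of [P(chi r)] over the common image lies in [X_S(chi r)] and in
    [X_T(chi r)], hence in the piece of the union of [S] and [T]. Following that piece back to [r]
    gives a point [w] of the same piece of [P(r)] with the same image. Faces are recognized by their
    image at smaller weight, which puts [w] in [X_S(r)] and in [X_T(r)]. There [Psi] is injective,
    so [x = w = y]. *)

Fixpoint union L : {fset nat} := if L is R :: L' then R `|` union L' else fset0.

Fixpoint occ p L : nat := if L is R :: L' then (p \in R) + occ p L' else 0.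

Lemma occ_eq0 p L : (occ p L == 0) = (p \notin union L).
Proof. by elim: L => //= R L IH; rewrite addn_eq0 IH inE negb_or; case: (p \in R). Qed.

(* Here [L] lists the sets [R_1, ..., R_t] of a prestructure with active set [A].
   A round with [W_i] empty is merged with the next one; at the end of the list
   there is no active element left, and the round is dropped. *)
Definition absorb R L := if L is R' :: L' then (R `|` R') :: L' else [::].

Definition push A R L :=
  if (fdisjoint R (A `|` union L)) then absorb R L else R :: L.

Fixpoint norm A L := if L is R :: L' then push A R (norm A L') else [::].

(** An element of a round is in [W_i] when it is active or occurs again later, so the test says that
    [W_i] is nonempty: this is what distinguishes witness structures among prestructures. *)
Fixpoint normal A L :=
  if L is R :: L' then ~~ (fdisjoint R (A `|` union L')) && normal A L' else true.

Lemma disjNP (X Y : {fset nat}) :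
  reflect (exists2 p, p \in X & p \in Y) (~~ (fdisjoint X Y)).
Proof.
apply: (iffP idP) => [/fset0Pn[p]|[p pX pY]].
  by rewrite inE => /andP[? ?]; exists p.
by apply/fset0Pn; exists p; rewrite inE pX.
Qed.

Lemma disjP (X Y : {fset nat}) :
  reflect (forall p, p \in X -> p \in Y -> False) (fdisjoint X Y).
Proof.
apply: (iffP idP) => [/eqP h p pX pY|h].
  by have: p \in X `&` Y by [rewrite inE pX]; rewrite h.
by apply/negPn/negP => /disjNP[p /h].
Qed.

Lemma normal_absorb A R L :
  normal A L -> normal A (absorb R L).
Proof.
case: L => [|R1 L] //= /andP[/disjNP[p p1 p2] ->]; rewrite andbT.
by apply/disjNP; exists p => //; rewrite inE p1 orbT.
Qed.

Lemma normal_push A R L : normal A L -> normal A (push A R L).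
Proof. by rewrite /push; case: ifP => [_ /normal_absorb//|/= -> ->]. Qed.

Lemma normal_norm A L : normal A (norm A L).
Proof. by elim: L => //= R L IH; apply: normal_push. Qed.

(** The exceptional case is a final round without active elements: there is no later round to merge
    it into, and it is dropped. *)
Lemma union_push A R L :
  union (push A R L) = if (fdisjoint R A) && (L == [::]) then fset0
                       else R `|` union L.
Proof.
rewrite /push; case: L => [|R1 L] //=.
  by rewrite fsetU0 eqxx andbT; case: ifP => //=; rewrite fsetU0.
by rewrite andbF; case: ifP => //= _; rewrite fsetUA.
Qed.

Lemma union_norm_sub A L : union (norm A L) `<=` union L.
Proof.
elim: L => [|R L IH] /=; first exact: fsubset_refl.
rewrite union_push; case: ifP => _; first exact: fsub0set.
exact: fsetUS.
Qed.

(* This gives both ghosting in two steps ([norm_norm]) and the compatibility of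
   ghosting with the removal of the first round ([peel_norm]). *)
Lemma norm_push A A' R L : A' `<=` A -> normal A L ->
  norm A' (push A R L) = push A' R (norm A' L).
Proof.
move=> sA nL; rewrite {1}/push; case: ifP => // /disjP dR.
case: L nL dR => [|R1 L] /=.
  move=> _ dR; rewrite /push fsetU0; case: ifP => // /disjNP[p pR /(fsubsetP sA) pA].
  by case: (dR p pR); rewrite inE pA.
move=> /andP[_ nL] dR.
have sN : union (norm A' L) `<=` union L by exact: union_norm_sub.
set N := norm A' L in sN *.
(* [R] is disjoint from [A] and from all later rounds, so merging it into a round does not change
   whether that round must be merged in turn. Hence the two orders of merging agree. *)
have E X : (fdisjoint (R `|` X) (A' `|` union N)) = fdisjoint X (A' `|` union N).
  apply/disjP/disjP => h p pX; first by apply: h; rewrite inE pX orbT.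
  move: pX; rewrite inE => /orP[pR|]; last exact: h.
  rewrite !inE => /orP[/(fsubsetP sA) pA|/(fsubsetP sN) pN].
    by apply: (dR p pR); rewrite !inE pA.
  by apply: (dR p pR); rewrite !inE pN !orbT.
have D : (fdisjoint R (A' `|` union (push A' R1 N))).
  apply/disjP => p pR; rewrite !inE => /orP[/(fsubsetP sA) pA|].
    by apply: (dR p pR); rewrite !inE pA.
  rewrite union_push; case: ifP => // _; rewrite inE => /orP[pR1|/(fsubsetP sN) pN].
    by apply: (dR p pR); rewrite !inE pR1 !orbT.
  by apply: (dR p pR); rewrite !inE pN !orbT.
rewrite /= [in RHS]/push D /push E; case: ifP => // _.
by case: (N) => [|R2 N'] //=; rewrite fsetUA.
Qed.

Lemma norm_norm A A' L : A' `<=` A -> norm A' (norm A L) = norm A' L.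
Proof.
move=> sA; elim: L => //= R L IH.
by rewrite norm_push ?IH //; apply: normal_norm.
Qed.

(** Merging loses no multiplicity: a round is merged only when it is disjoint from every later one,
    so it shares no point with the head of [L]. *)
Lemma occ_push p A R L : occ p (push A R L) =
  (if (fdisjoint R A) && (L == [::]) then 0 else (p \in R) + occ p L)%N.
Proof.
rewrite /push; case: L => [|R1 L] //=.
  by rewrite fsetU0 eqxx andbT; case: ifP.
rewrite andbF; case: ifP => //= /disjP dR; rewrite addnA inE; congr (_ + _)%N.
case pR : (p \in R) => //=; case pR1 : (p \in R1) => //.
by case: (dR p pR); rewrite !inE pR1 !orbT.
Qed.

Lemma occ_norm_le p A L : (occ p (norm A L) <= occ p L)%N.
Proof.
by elim: L => //= R L IH; rewrite occ_push; case: ifP => // _; rewrite leq_add2l.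
Qed.

(** Only rounds without elements of [A] are ever dropped. *)
Lemma occ_norm p A L : p \in A -> occ p (norm A L) = occ p L.
Proof.
move=> pA; elim: L => //= R L IH; rewrite occ_push; case: ifP; last by rewrite IH.
move=> /andP[/disjP/(_ p) dR /eqP h]; rewrite -IH h /= addn0.
by case pR: (p \in R) dR => // /(_ isT pA).
Qed.

(** * Removing the first round *)

(* [gamma S] and its inverse in terms of the sets [R_i]: the inverse is [push A S]. *)
Definition peel S L :=
  if L is R :: L' then if R == S then L' else (R `\` S) :: L' else [::].

(** The condition defining [X_S]. As [G_1] consists of the elements of [R_1] that are neither active
    nor in a later round, the inclusion of [S] in [G_1] becomes the second alternative. The empty
    list is the case [t = 0]. *)
Definition peelable S A L :=
  if L is R :: L' then (R == S) || (S `<=` R) && (fdisjoint S (A `|` union L'))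
  else true.

Lemma normal_neq0 A R L : normal A (R :: L) -> R != fset0.
Proof. by move=> /= /andP[/disjNP[p pR _] _]; apply/fset0Pn; exists p. Qed.

Lemma peelable_push S A L : peelable S A (push A S L).
Proof.
rewrite /push; case: ifP => [|_ /=]; last by rewrite eqxx.
case: L => //= R L /disjP dS; rewrite fsubsetUl /=.
apply/orP; right; apply/disjP => p pS pL; apply: (dS p pS).
by move: pL; rewrite !inE => /orP[->|->]; rewrite ?orbT.
Qed.

Lemma peel_push S A L : normal A L -> peel S (push A S L) = L.
Proof.
rewrite /push; case: ifP => [|_ _ /=]; last by rewrite eqxx.
case: L => //= R L /disjP dS /(@normal_neq0 A R)/fset0Pn[q qR].
have dSR p : p \in R -> p \notin S.
  by move=> pR; apply/negP => pS; apply: (dS p pS); rewrite !inE pR orbT.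
case: eqP => [e|_].
  by move: (dSR q qR); rewrite -e inE qR orbT.
congr (_ :: _); apply/fsetP => p; rewrite !inE.
by case pR: (p \in R); rewrite ?orbT ?orbF ?andbT ?(dSR p pR) // andNb.
Qed.

(** The side condition concerns the empty list, which [push A S] returns unchanged only if [S]
    misses [A]. For [S] in [act r] it is supplied by [nil_disjoint]: in a simplex without rounds
    every active element has value [0]. *)
Lemma push_peel S A L : normal A L -> peelable S A L ->
  (L = [::] -> fdisjoint S A) -> push A S (peel S L) = L.
Proof.
case: L => [|R L] /= nL; first by move=> _ /(_ erefl) h; rewrite /push fsetU0 h.
move=> hX _; move: hX; case: eqP => [<- _|nRS /= /andP[sSR dS]].
  by move: nL => /andP[/negbTE dR _]; rewrite /push dR.
have E : fdisjoint S (A `|` union ((R `\` S) :: L)).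
  apply/disjP => p pS; rewrite /= !inE pS /= => h.
  by case/disjP/(_ p pS): dS; rewrite !inE.
rewrite /push E /=; congr (_ :: _); apply/fsetP => p; rewrite !inE.
by case pS : (p \in S) => //=; rewrite (fsubsetP sSR).
Qed.

Lemma normal_peel S A L : normal A L -> peelable S A L ->
  normal A (peel S L).
Proof.
case: L => [|R L] //= /andP[nR nL]; case: eqP => //= _ /andP[sSR dS].
rewrite nL andbT; case/disjNP: nR => p pR pA; apply/disjNP; exists p => //.
rewrite inE pR andbT; apply/negP => pS.
by case/disjP/(_ p pS): dS.
Qed.

(** [push A S] undoes [peel S] and commutes with ghosting by [norm_push]; therefore so does
    [peel S]. *)
Lemma peel_norm S A A' L : A' `<=` A -> normal A L -> peelable S A L ->
  (L = [::] -> fdisjoint S A) ->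
  peelable S A' (norm A' L) /\ peel S (norm A' L) = norm A' (peel S L).
Proof.
move=> sA nL hX h0; rewrite -{1 2}(push_peel nL hX h0) norm_push ?normal_peel //.
by rewrite peelable_push peel_push ?normal_norm.
Qed.

Lemma peel0 A L : normal A L -> peel fset0 L = L.
Proof.
case: L => [|R L] // /normal_neq0/negbTE /= ->.
by rewrite fsetD0.
Qed.

Lemma peelable0 A L : peelable fset0 A L.
Proof.
by case: L => //= R L; rewrite fsub0set (_ : fdisjoint _ _) ?orbT //; apply/disjP.
Qed.

(** If [R_1 = S], then [T] is not the first round and must lie in [G_1], which is a condition on the
    remaining rounds. If [S] lies in [G_1], both sides hold. *)
Lemma peelable_sub S T A L : T `<=` S -> T != S -> peelable S A L ->
  (L = [::] -> fdisjoint T A) ->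
  peelable T A L = fdisjoint T (A `|` union (peel S L)).
Proof.
move=> sTS nTS; case: L => [|R L] /=; first by move=> _ /(_ erefl); rewrite fsetU0 => ->.
case: eqP => [-> _ _|nRS /= /andP[sSR /disjP dS] _].
  by rewrite eq_sym (negbTE nTS) sTS.
have dT : fdisjoint T (A `|` union L).
  by apply/disjP => p /(fsubsetP sTS)/dS.
rewrite dT (fsubset_trans sTS) ?orbT //; apply/esym/disjP => p pT /=.
rewrite !inE (fsubsetP sTS p pT) /= => pL.
by apply: (dS p (fsubsetP sTS p pT)); rewrite inE.
Qed.

(** If one of the two sets is the first round, it contains the other and equals the union; otherwise
    both lie in [G_1]. *)
Lemma peelable_union S T A L : peelable S A L -> peelable T A L -> peelable (S `|` T) A L.
Proof.
case: L => //= R L.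
case: eqP => [-> _|_ /= /andP[sSR dS]].
  case: eqP => [->|_ /= /andP[/fsetUidPl -> _]]; first by rewrite fsetUid eqxx.
  by rewrite eqxx.
case: eqP => [<-|_ /= /andP[sTR dT]].
  by move/fsetUidPr: sSR => ->; rewrite eqxx.
apply/orP; right; rewrite fsubUset sSR sTR /=.
apply/disjP => p; rewrite inE => /orP[/(disjP _ _ dS)|/(disjP _ _ dT)]; exact.
Qed.

Lemma peel_peel S T A L : T `<=` S -> normal A L -> peelable S A L -> peelable T A L ->
  peel (S `\` T) (peel T L) = peel S L.
Proof.
move=> sTS; case: (eqVneq T S) => [-> nL hS _|nTS].
  by rewrite fsetDv (@peel0 A) // normal_peel.
case: L => [|R L] //= nL; case: eqP => [->|nRS] /=.
  by rewrite eq_sym (negbTE nTS) /= eqxx.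
move=> /andP[sSR dS]; case: eqP => [eR|nRT] /=.
  by case/eqP: nTS; apply/eqP; rewrite eqEfsubset sTS -eR.
move=> _; case: eqP => [e|_].
  case: nRS; apply/fsetP => p; move/fsetP/(_ p): e; rewrite !inE.
  case pT: (p \in T) => //= _.
  by rewrite (fsubsetP sTS) // (fsubsetP sSR) // (fsubsetP sTS).
congr (_ :: _); apply/fsetP => p; rewrite !inE.
by case pT: (p \in T) => //=; rewrite (fsubsetP sTS) ?andbF.
Qed.

(** Together with [peel_peel] this compares two ways of treating a simplex of both [X_S] and [X_T]:
    strip [S] at once, or strip [T], delete [T] from the support and strip the rest of [S]. *)
Lemma peel_cap S T A L : T `<=` S -> T != S -> peelable S A L -> peelable T A L ->
  (L = [::] -> fdisjoint T A) ->
  fdisjoint T (A `|` union (peel T L)) /\ peelable (S `\` T) A (peel T L).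
Proof.
move=> sTS nTS; case: L => [|R L] /=; first by move=> _ _ /(_ erefl); rewrite fsetU0.
have [-> _|nRS /= /andP[sSR /disjP dS] _ _] := eqVneq R S.
  rewrite [S == T]eq_sym (negbTE nTS) /= eqxx => /andP[_ /disjP dT] _; split=> //.
  by apply/disjP => p pT /=; move: (dT p pT); rewrite !inE pT.
have -> : (R == T) = false.
  apply/negbTE/eqP => eR; case/eqP: nTS; apply/eqP.
  by rewrite eqEfsubset sTS -eR.
split; first (apply/disjP => p pT /=; rewrite !inE pT /= => pA).
  by apply: (dS p); rewrite ?(fsubsetP sTS) // inE.
rewrite /= fsetSD //=; apply/orP; right; apply/disjP => p.
by rewrite inE => /andP[_ /dS].
Qed.

(** * Vertices determine membership *)

(** The last round of a normal list meets [A]. If all active elements except one of that round are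
    ghosted, rounds may be merged but none is dropped. *)
Lemma normal_last A L : normal A L -> L != [::] ->
  exists2 a, a \in A & union (norm [fset a] L) = union L.
Proof.
elim: L => //= R [|R1 L] IH /andP[nR nL] _.
  move: nR; rewrite fsetU0 => /disjNP[a aR aA]; exists a => //=.
  rewrite union_push (_ : fdisjoint _ _ = false) //.
  by apply/negbTE/disjNP; exists a; rewrite ?inE.
have [a aA ea] := IH nL isT; exists a => //.
rewrite union_push ea; case: eqP => [e|_]; last by rewrite andbF.
move: nL => /normal_neq0/fset0Pn[q qR1].
have: q \in union (R1 :: L) by rewrite /= inE qR1.
by rewrite -ea e.
Qed.

(** Here [p] is an element of [W_1], and the vertex [a] keeps both [R_1] and the membership of [p]
    in [W_1]. If [p] occurs in a later round, [a] comes from [normal_last]; otherwise [p] is active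
    and [a = p]. *)
Lemma norm_head A R L p : normal A (R :: L) ->
  p \in R -> p \in A `|` union L ->
  exists a, [/\ a \in A, norm [fset a] (R :: L) = R :: norm [fset a] L
    & p \in a |` union (norm [fset a] L)].
Proof.
move=> /= /andP[_ nL] pR; rewrite inE orbC; case pL : (p \in union L).
  move=> _.
  have L0 : L != [::] by case: (L) pL.
  have [a aA ea] := normal_last nL L0; exists a; split=> //=.
    rewrite /push (_ : fdisjoint _ _ = false) //.
    by apply/negbTE/disjNP; exists p; rewrite // !inE ea pL orbT.
  by rewrite !inE ea pL orbT.
move=> /= pA; exists p; rewrite !inE eqxx; split => //.
rewrite /push (_ : fdisjoint _ _ = false) //.
by apply/negbTE/disjNP; exists p; rewrite // !inE eqxx.
Qed.

(* [X_S] is a full subcomplex: some vertex of the simplex has the same first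
   round [R_1], and it also sees any given element of [W_1]. *)
Lemma peelable_vertices S A L : normal A L ->
  (forall a, a \in A -> peelable S [fset a] (norm [fset a] L)) -> peelable S A L.
Proof.
case: L => // R L nL hA.
have H p : p \in R -> p \in A `|` union L -> 
    R = S \/ S `<=` R /\ p \notin S.
  move=> pR pA; have [a [aA ea pa]] := norm_head nL pR pA.
  move: (hA a aA); rewrite ea => /= /orP[/eqP->|/andP[sSR /disjP dS]]; [by left|right].
  by split=> //; apply/negP => pS; apply: (dS p pS).
case/andP: (nL) => /disjNP[q qR qA] _.
rewrite /=; case: eqP => //= nRS.
have [//|[sSR _]] := H q qR qA; rewrite sSR /=; apply/disjP => p pS pA.
by have [//|[_ /negP]] := H p (fsubsetP sSR _ pS) pA; apply.
Qed.

(** The analogue for [B_V]: elements of rounds are seen by the vertex of [normal_last], an active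
    element by its own vertex. *)
Lemma disjoint_vertices V A L : normal A L -> 
  (forall a, a \in A -> fdisjoint V (a |` union (norm [fset a] L))) ->
  fdisjoint V (A `|` union L).
Proof.
move=> nL hA; apply/disjP => p pV; rewrite inE.
case pL : (p \in union L); last first.
  by rewrite orbF => pA; case/disjP/(_ p pV): (hA p pA); rewrite !inE eqxx.
have L0 : L != [::] by case: (L) pL.
have [a aA ea] := normal_last nL L0; case/disjP/(_ p pV): (hA a aA).
by rewrite inE ea pL orbT.
Qed.

(** * Codes as witness structures; canonical forms and ghosting in terms of codes *)

Fixpoint rounds A L : wseq :=
  if L is R :: L' then
    (R `&` (A `|` union L'), R `\` (A `|` union L')) :: rounds A L'
  else [::].

(* The witness structure with support [U], active set [A] and [R_i = nth L (i - 1)]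
   for [i >= 1]: all of [W_i] and [G_i] can be recovered, since a ghost leaves in
   the last round in which it takes part. *)
Definition of_rounds U A L : wseq := rounds A (U :: L).

Lemma size_rounds A L : size (rounds A L) = size L.
Proof. by elim: L => //= R L ->. Qed.

Lemma WG_rounds A L i : nth (fset0, fset0) (rounds A L) i =
  (nth fset0 L i `&` (A `|` union (drop i.+1 L)),
   nth fset0 L i `\` (A `|` union (drop i.+1 L))).
Proof.
by elim: L i => [|R L IH] [|i] //=; rewrite ?fset0I ?fset0D // drop0.
Qed.

Lemma Wof_rounds A L i :
  Wof (rounds A L) i = nth fset0 L i `&` (A `|` union (drop i.+1 L)).
Proof. by rewrite /Wof WG_rounds. Qed.

Lemma Gof_rounds A L i :
  Gof (rounds A L) i = nth fset0 L i `\` (A `|` union (drop i.+1 L)).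
Proof. by rewrite /Gof WG_rounds. Qed.

Lemma Rof_rounds A L i : Rof (rounds A L) i = nth fset0 L i.
Proof.
rewrite /Rof Wof_rounds Gof_rounds; apply/fsetP => p; rewrite !inE.
by case: (p \in nth _ _ _) => //=; rewrite ?andbF ?andbT // orbN.
Qed.

Lemma bigcup_iota1 (F : nat -> {fset nat}) m :
  \bigcup_(i <- iota 1 m) F i = \bigcup_(i <- iota 0 m) F i.+1.
Proof. by rewrite (iotaDl 1 0) big_map. Qed.

Lemma ghosts_cons c s : ghosts (c :: s) = c.2 `|` ghosts s.
Proof. by rewrite /ghosts /= big_cons bigcup_iota1. Qed.

Lemma ghosts_rounds A L : ghosts (rounds A L) = union L `\` A.
Proof.
elim: L => [|R L IH]; first by rewrite /ghosts big_nil fset0D.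
rewrite /= ghosts_cons IH /=; apply/fsetP => p; rewrite !inE.
by case: (p \in A); case: (p \in union L); rewrite ?andbF ?andbT ?orbT ?orbF.
Qed.

Lemma ghostsP s p :
  reflect (exists2 i, (i < size s)%N & p \in Gof s i) (p \in ghosts s).
Proof.
apply: (iffP (bigfcupP _ _ _ _)) => [[i]|[i hi pi]].
  by rewrite mem_iota andbT => hi pi; exists i.
by exists i; rewrite // mem_iota andbT.
Qed.

Lemma mult_cons p c s : mult p (c :: s) = ((p \in c.1 `|` c.2) + mult p s)%N.
Proof.
rewrite /mult /trace /= (iotaDl 1 0) filter_map {1}/Rof {1}/Wof {1}/Gof /=.
by case: (p \in _ `|` _); rewrite /= size_map.
Qed.

Lemma mult_rounds p A L : mult p (rounds A L) = occ p L.
Proof.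
elim: L => //= R L IH; rewrite mult_cons IH /=; congr (_ + _)%N.
by rewrite !inE; case: (p \in R); rewrite ?andbF ?andbT //= orbN.
Qed.

Lemma wsupp_of_rounds U A L : wsupp (of_rounds U A L) = U.
Proof. exact: (Rof_rounds _ _ 0). Qed.

Lemma ghosts_of_rounds U A L : union L `<=` U -> ghosts (of_rounds U A L) = U `\` A.
Proof. by move=> sL; rewrite ghosts_rounds /= (fsetUidPl _ _ sL). Qed.

Lemma active_of_rounds U A L : A `<=` U -> union L `<=` U -> active (of_rounds U A L) = A.
Proof.
move=> sA sL; rewrite /active wsupp_of_rounds ghosts_of_rounds //.
by rewrite fsetDDr fsetDv fset0U; apply/fsetIidPr.
Qed.

Lemma nth_union R L i : (i < size L)%N -> R = nth fset0 L i -> R `<=` union L.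
Proof.
move=> + ->; elim: L i => // R' L IH [|i] hi /=; first exact: fsubsetUl.
by rewrite fsubsetU // IH ?orbT.
Qed.

Lemma in_union_drop p L i : reflect (exists2 j, (i <= j < size L)%N & p \in nth fset0 L j)
  (p \in union (drop i L)).
Proof.
apply: (iffP idP) => [|[j /andP[hij hj] pj]].
  elim: L i => [|R L IH] [|i] //=.
    rewrite inE => /orP[pR|]; first by exists 0%N.
    by rewrite -{1}(drop0 L) => /IH[j hj pj]; exists j.+1.
  by move=> /IH[j hj pj]; exists j.+1.
apply: (fsubsetP (@nth_union _ (drop i L) (j - i) _ (erefl _))).
  by rewrite size_drop ltn_sub2r // (leq_ltn_trans hij).
by rewrite nth_drop subnKC.
Qed.

(** An element of [W_i] that is not active becomes a ghost in some round, which by (P3) comes after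
    [i]. Conversely, an element of [G_i] is not active, and (P2) and (P3) keep it out of all later
    rounds. *)
Lemma prestructure_rounds s : witness_prestructure s ->
  s = rounds (active s) (map (fun c => c.1 `|` c.2) s).
Proof.
case=> s0 P1 P2 P3.
have eR i : nth fset0 (map (fun c => c.1 `|` c.2) s) i = Rof s i.
  case: (ltnP i (size s)) => hi; first by rewrite (nth_map (fset0,fset0)).
  rewrite nth_default ?size_map // /Rof /Wof /Gof nth_default //.
  by rewrite fsetU0.
have inW i p : (i < size s)%N -> p \in Wof s i -> p \in wsupp s.
  case: i => [|i] hi pi; rewrite inE; first by rewrite pi.
  by have [/fsubsetP/(_ p pi)->] := P1 i.+1 hi.
have dW i j p : (i <= j)%N -> (j < size s)%N -> p \in Gof s i -> p \in Wof s j -> False.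
  move=> hij hj pi pj; have : p \in Gof s i `&` Wof s j by rewrite inE pi.
  by rewrite P3 // hij.
have dG i j p : (i < j)%N -> (j < size s)%N -> p \in Gof s i -> p \in Gof s j -> False.
  move=> hij hj pi pj; have : p \in Gof s i `&` Gof s j by rewrite inE pi.
  by rewrite P2 // hij.
apply: (@eq_from_nth _ (fset0, fset0)); first by rewrite size_rounds size_map.
move=> i hi; rewrite WG_rounds eR.
have eW p : p \in Rof s i -> (p \in Wof s i) =
    (p \in active s `|` union (drop i.+1 (map (fun c => c.1 `|` c.2) s))).
  move=> pR; apply/idP/idP => [pW|].
    rewrite in_fsetU in_fsetD (inW i p hi pW) andbT; case pg: (p \in ghosts s) => //=.
    case/ghostsP: pg => j hj pj; apply/in_union_drop; exists j.
      rewrite size_map hj andbT ltnNge; apply/negP => hji.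
      exact: (dW j i p).
    by rewrite eR inE pj orbT.
  move: pR; rewrite /Rof !in_fsetU in_fsetD => /orP[//|pG] /orP[/andP[/ghostsP[]]|].
    by exists i.
  case/in_union_drop => j; rewrite size_map => /andP[hij hj].
  rewrite eR inE => /orP[pj|pj]; [case: (dW i j p)|case: (dG i j p)] => //.
  exact: ltnW.
rewrite [LHS](surjective_pairing); congr pair; apply/fsetP => p;
  rewrite ?in_fsetI ?in_fsetD.
  case pR : (p \in Rof s i); first by rewrite -eW.
  by apply/negP => pW; move: pR; rewrite inE pW.
rewrite andbC; case pR : (p \in Rof s i); last first.
  by apply/negP => pG; move: pR; rewrite inE pG orbT.
rewrite -eW //=; case pW : (p \in Wof s i).
  by apply/negP => pG; apply: (dW i i p).
by move: pR; rewrite inE pW.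
Qed.

(* [canonical_form] as a left-to-right scan carrying the ghosts of the rounds
   dropped so far. *)
Fixpoint scan (acc : {fset nat}) s : wseq :=
  if s is c :: s' then
    if c.1 == fset0 then scan (acc `|` c.2) s'
    else (c.1, acc `|` c.2) :: scan fset0 s'
  else [::].

Lemma canonical_formE c s : canonical_form (c :: s) = c :: scan fset0 s.
Proof.
set F := c :: s.
(* The scan stands at index [n], with [m] entries left, and [i] is the last index kept. The
   accumulator is then the union of the [G_l] with [l] strictly between [i] and [n]. *)
have E : forall m n i, (i < n)%N -> (n + m = size F)%N ->
    pairmap (fun i j => (Wof F j, \bigcup_(l <- iota i.+1 (j - i)) Gof F l)) i
      [seq i <- iota n m | Wof F i != fset0]
    = scan (\bigcup_(l <- iota i.+1 (n - i.+1)) Gof F l) (drop n F).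
  elim=> [|m IH] n i hin hnm.
    by rewrite addn0 in hnm; rewrite hnm drop_size.
  have hn : (n < size F)%N by rewrite -hnm addnS ltnS leq_addr.
  rewrite (drop_nth (fset0, fset0) hn) /= -/(Wof F n) -/(Gof F n).
  have eU : \bigcup_(l <- iota i.+1 (n - i)) Gof F l =
      \bigcup_(l <- iota i.+1 (n - i.+1)) Gof F l `|` Gof F n.
    have -> : (n - i = n - i.+1 + 1)%N by rewrite addn1 subnSK.
    by rewrite iotaD big_cat /= big_seq1 subnKC.
  case: eqP => /= [w0|_].
    by rewrite -eU (IH n.+1) ?addSnnS ?subSS // ltnW.
  rewrite -eU; congr (_ :: _).
  by rewrite IH ?addSnnS // subnn big_nil.
have -> : s = drop 1 F by rewrite /F /= drop0.
have := E (size s) 1%N 0%N isT (erefl _).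
rewrite subnn big_nil => <-.
rewrite /canonical_form /= -/F.
rewrite {1}/Wof {1}/Gof /= -surjective_pairing; congr (_ :: _).
set I := [seq i <- _ | _].
apply: (@eq_from_nth _ (fset0, fset0)); rewrite size_mkseq ?size_pairmap //.
by move=> i hi; rewrite nth_mkseq // (nth_pairmap 0%N).
Qed.

(** The shape of the list after truncation at [st_last]: there are no rounds, or the last one still
    has an active element. On such lists [norm] merges rounds but drops none. *)
Definition tight A L := (L == [::]) || ~~ (fdisjoint (last fset0 L) A).

Lemma tight_cons A R L : tight A (R :: L) -> tight A L.
Proof. by case: L. Qed.

Lemma tight_norm A L : tight A L -> L != [::] ->
  norm A L != [::] /\ union (norm A L) = union L.
Proof.
elim: L => // R [|R1 L] IH t _.
  move: t; rewrite /tight /= => /disjNP[a aR aA].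
  rewrite /push /= !fsetU0; case: ifP => [/disjP/(_ a aR aA)//|_].
  by rewrite /= fsetU0.
have [n0 eU] := IH (tight_cons t) isT.
have -> : norm A [:: R, R1 & L] = push A R (norm A (R1 :: L)) by [].
split; last by rewrite union_push (negbTE n0) andbF eU.
by rewrite /push; case: ifP => // _; case: (norm A (R1 :: L)) n0.
Qed.

(** [scan] goes from the left and [norm] folds from the right; what connects them is that the
    pending ghosts [acc] are absorbed by the next round that is kept. Being neither active nor
    present later, they end up among its ghosts. *)
Lemma scan_rounds A acc L : tight A L -> fdisjoint acc (A `|` union L) ->
  scan acc (rounds A L) = rounds A (absorb acc (norm A L)).
Proof.
elim: L acc => //= R L IH acc t dacc.
have tL := tight_cons t.
have eU : union (norm A L) = union L.
  by case: (eqVneq L [::]) => [->//|/(tight_norm tL)[]].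
rewrite /push eU /fdisjoint; case: eqP => h.
  have L0 : L != [::].
    by move: t h; case: (L) => //=; rewrite /tight /= fsetU0 => /negP + /eqP.
  have eG : R `\` (A `|` union L) = R.
    by apply/fsetDidPl; apply/eqP.
  rewrite eG IH //; last first.
    apply/disjP => p; rewrite inE => /orP[pa|pR] pL.
      case/disjP/(_ p pa): dacc; move: pL; rewrite !inE => /orP[->//|->].
      by rewrite !orbT.
    by move/eqP/disjP/(_ p pR): h; apply.
  by case: (norm A L) => //= R1 M; rewrite fsetUA.
rewrite IH //; last by apply/disjP => p; rewrite inE.
rewrite /= eU; have -> : absorb fset0 (norm A L) = norm A L.
  by case: (norm A L) => //= R1 M; rewrite fset0U.
congr ((_, _) :: _); apply/fsetP => p; rewrite !inE.
  case pa : (p \in acc) => //=; move/disjP/(_ p pa): dacc; rewrite !inE.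
  by case: (p \in A); case: (p \in union L); rewrite ?orbT ?andbF // => /(_ isT).
case pa : (p \in acc) => //=; move/disjP/(_ p pa): dacc; rewrite !inE.
by case: (p \in A); case: (p \in union L); rewrite ?orbT // => /(_ isT).
Qed.

Lemma norm_nil A L : fdisjoint (union L) A -> norm A L = [::].
Proof.
elim: L => //= R L IH /disjP dA.
rewrite IH; last by apply/disjP => p pL; apply: dA; rewrite inE pL orbT.
rewrite /push /= fsetU0 (_ : fdisjoint R A) //.
by apply/disjP => p pR; apply: dA; rewrite inE pR.
Qed.

(** [norm] performs the truncation by itself, since a tail without active elements normalizes to the
    empty list. *)
Lemma norm_take A L q : fdisjoint (union (drop q L)) A ->
  norm A (take q L) = norm A L.
Proof.
elim: L q => [|R L IH] [|q] //= dA; last by rewrite IH.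
exact/esym/(@norm_nil A (R :: L)).
Qed.

Lemma max_iotaP (P : pred nat) n (m := \max_(i <- [seq i <- iota 0 n | P i]) i) :
  (forall i, (i < n)%N -> P i -> (i <= m)%N) /\
  (m = 0%N \/ (m < n)%N /\ P m).
Proof.
split => [i hi Pi|].
  rewrite /m; apply: (@leq_bigmax_seq _ _ xpredT id) => //.
  by rewrite mem_filter Pi mem_iota.
have : forall r : seq nat, \max_(i <- r) i = 0%N \/ \max_(i <- r) i \in r.
  elim=> [|a r IH]; first by left; rewrite big_nil.
  rewrite big_cons inE; case: (leqP a (\max_(i <- r) i)) => h.
    case: IH => [->|h']; last by right; rewrite h' orbT.
    by left.
  by right; rewrite eqxx.
case/(_ [seq i <- iota 0 n | P i]); first by left.
by rewrite mem_filter mem_iota => /andP[? /andP[_ ?]]; right.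
Qed.

(** The index [q] counts from [R_0], whereas [L] starts with [R_1], so [take q L] keeps the rounds
    up to [R_q]. The last two clauses express the choice of [q]: for [q > 0] the round [R_q]
    contains an element that stays active, and no later round does. *)
Lemma st_of_rounds S U A L : S `<=` A -> A `<=` U -> union L `<=` U ->
  exists q, [/\ st S (of_rounds U A L) = of_rounds U (A `\` S) (take q L),
    tight (A `\` S) (take q L) & fdisjoint (union (drop q L)) (A `\` S)].
Proof.
move=> sS sA sL; set s := of_rounds U A L; set A' := A `\` S; set q := st_last S s.
have szs : size s = (size L).+1 by rewrite size_rounds.
have eG : ghosts s `|` S = U `\` A'.
  rewrite ghosts_of_rounds //; apply/fsetP => p; rewrite !inE.
  case pS: (p \in S) => /=; last by rewrite orbF.
  by rewrite orbT (fsubsetP sA) // (fsubsetP sS).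
have Rs i : Rof s i = nth fset0 (U :: L) i by rewrite Rof_rounds.
have RU i : Rof s i `<=` U.
  rewrite Rs; case: i => [|i] /=; first exact: fsubset_refl.
  case: (ltnP i (size L)) => hi; last by rewrite nth_default ?fsub0set.
  by apply: fsubset_trans sL; apply: nth_union hi _.
have eP i : ~~ (Rof s i `<=` S `|` ghosts s) = ~~ fdisjoint (Rof s i) A'.
  rewrite fsetUC eG; congr (~~ _); apply/fsubsetP/disjP => h p pR.
    by move=> pA; move: (h p pR); rewrite inE pA.
  by rewrite inE (fsubsetP (RU i)) // andbT; apply/negP => /(h p pR).
have [qmax qP] := @max_iotaP (fun i => ~~ (Rof s i `<=` S `|` ghosts s)) (size s).
rewrite -/(st_last S s) -/q in qmax qP.
have qL : (q <= size L)%N.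
  by case: qP => [->//|[]]; rewrite szs ltnS.
exists q; split.
- have szt : size (take q.+1 (U :: L)) = q.+1.
    by rewrite size_take /= ltnS; case: ltngtP qL => // ->.
  (* The last round up to [q] in which [p] takes part is the [k] with [p] in [R_k] and in no kept
     round after it. *)
  have eM p k : (p \in U) -> (k <= q)%N ->
    (\max_(i <- st_trace S s p) i == k) =
    (p \in nth fset0 (U :: L) k) && (p \notin union (drop k.+1 (take q.+1 (U :: L)))).
    move=> pU hk.
    have -> : st_trace S s p = [seq i <- iota 0 (size s) | (i <= q)%N && (p \in Rof s i)].
      by rewrite /st_trace /trace -filter_predI.
    have [mmax mP] := @max_iotaP (fun i => (i <= q)%N && (p \in Rof s i)) (size s).
    set m := \max_(i <- _) i in mmax mP *.
    (* The default value [0] of the maximum is harmless: [R_0 = U] contains [p]. *)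
    have {mP} [m1 m2 m3] : [/\ (m < size s)%N, (m <= q)%N & p \in Rof s m].
      case: mP => [->|[-> /andP[-> ->]]//]; split=> //.
      by rewrite Rs.
    apply/eqP/andP => [<-|[pk /negP pn]].
      split; first by rewrite -Rs.
      apply/negP => /in_union_drop[j /andP[hmj]].
      rewrite szt ltnS => hj.
      rewrite nth_take ?ltnS // -Rs => pj.
      move: (mmax j); rewrite szs ltnS (leq_trans hj qL) hj pj => /(_ isT isT).
      by rewrite leqNgt hmj.
    apply/eqP; rewrite eqn_leq mmax ?Rs ?hk ?pk ?szs ?ltnS ?(leq_trans hk) // andbT.
    rewrite leqNgt; apply/negP => hkm; apply: pn; apply/in_union_drop; exists m.
      by rewrite hkm szt ltnS.
    by rewrite nth_take ?ltnS // -Rs.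
  rewrite /of_rounds -[U :: take q L]/(take q.+1 (U :: L)).
  apply: (@eq_from_nth _ (fset0, fset0)); rewrite size_mkseq ?size_rounds //.
  move=> k hk; rewrite nth_mkseq // WG_rounds nth_take // -Rs.
  have EG : st_G S s k = Rof s k `\` (A' `|` union (drop k.+1 (take q.+1 (U :: L)))).
    apply/fsetP => p; rewrite in_fsetD in_fsetU.
    have -> : (p \in st_G S s k) =
        (p \in U `\` A') && (\max_(i <- st_trace S s p) i == k).
      by rewrite /st_G eG !inE.
    rewrite in_fsetD; case pU : (p \in U); last first.
      rewrite !andbF /=; case pR: (p \in Rof s k); rewrite ?andbF //.
      by rewrite (fsubsetP (RU k) p pR) in pU.
    by rewrite eM // -Rs andbT negb_or; case: (p \in A'); rewrite //= andbC.
  congr pair => //; rewrite /st_W EG wsupp_of_rounds; apply/fsetP => p.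
  rewrite !in_fsetD in_fsetI.
  have -> : (p \in [fset p0 in U | k \in st_trace S s p0]) =
      (p \in U) && (k \in st_trace S s p) by rewrite !inE.
  rewrite mem_filter mem_filter mem_iota szs /= add0n ltnS.
  rewrite -[(k < _.+1)%N]/(k <= q)%N in hk.
  rewrite hk (leq_trans hk qL) andbT /=.
  case pR: (p \in Rof s k); rewrite ?andbF //= ?andbT.
  by rewrite (fsubsetP (RU k) p pR) andbT negbK.
- case: qP => [->|[hq]]; first by rewrite /tight take0.
  rewrite eP Rs; case: (q) hq qL => [|q'] hq qL h; first by rewrite /tight take0.
  apply/orP; right; rewrite (_ : last _ _ = nth fset0 (U :: L) q'.+1) //=.
  by rewrite -nth_last size_takel //= nth_take.
- apply/disjP => p /in_union_drop[j /andP[hqj hj] pj] pA.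
  have := qmax j.+1; rewrite szs ltnS hj eP => /(_ isT); rewrite ltnNge hqj.
  move=> h; suff: false by []; apply: h; apply/disjNP; by exists p; rewrite ?Rs.
Qed.

Lemma Gamma_of_rounds S U A L : S `<=` A -> A `<=` U -> union L `<=` U ->
  Gamma S (of_rounds U A L) = of_rounds U (A `\` S) (norm (A `\` S) L).
Proof.
move=> sS sA sL; have [q [e t d]] := st_of_rounds sS sA sL.
have eU : union (take q L) = union (norm (A `\` S) L).
  rewrite -(norm_take d).
  by case: (eqVneq (take q L) [::]) => [->//|/(tight_norm t)[]].
rewrite /Gamma e /of_rounds /= canonical_formE scan_rounds //; last first.
  by apply/disjP => p; rewrite inE.
rewrite (norm_take d) eU; congr (_ :: _).
by case: (norm _ _) => //= R1 M; rewrite fset0U.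
Qed.

(** * Round counters *)

Lemma rval_out r p : p \notin finsupp r -> rval r p = 0%N.
Proof. by move=> h; rewrite /rval fsfun_dflt. Qed.

Lemma in_act r p : (p \in act r) = (0 < rval r p)%N.
Proof.
rewrite !inE; case h : (p \in finsupp r) => //=.
by rewrite rval_out ?h.
Qed.

Lemma in_pass r p : (p \in pass r) = (p \in finsupp r) && (rval r p == 0%N).
Proof. by rewrite !inE. Qed.

Lemma act_sub r : act r `<=` finsupp r.
Proof. by apply/fsubsetP => p; rewrite !inE => /andP[]. Qed.

(** [rval] sends both the undefined value and [0] to [0], so the supports are compared
    separately. *)
Lemma rc_eqP r r' : finsupp r = finsupp r' -> rval r =1 rval r' -> r = r'.
Proof.
move=> e h; apply/fsfunP => p; case pr : (p \in finsupp r); last first.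
  by rewrite !fsfun_dflt // -?e pr.
have pr' : p \in finsupp r' by rewrite -e.
move: (h p) pr pr'; rewrite /rval !mem_finsupp.
by case: (r p) (r' p) => [x|] [y|] //= ->.
Qed.

Lemma finsupp_dec r S : finsupp (rc_dec r S) = finsupp r.
Proof.
apply/fsetP => p; rewrite mem_finsupp fsfunE; case: ifP => // pr.
move: pr; rewrite mem_finsupp; case: (r p) => //= x _.
by case: ifP.
Qed.

Lemma rval_dec r S p : rval (rc_dec r S) p = (rval r p - (p \in S))%N.
Proof.
rewrite /rval fsfunE; case: ifP => [_|h]; last by rewrite fsfun_dflt ?h.
case: (p \in S); last by rewrite subn0.
by case: (r p) => //= x; rewrite subn1.
Qed.

Lemma finsupp_del r V : finsupp (rc_del r V) = finsupp r `\` V.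
Proof.
apply/fsetP => p; rewrite mem_finsupp fsfunE; case: ifP => // pr.
by move: pr; rewrite inE mem_finsupp => /andP[].
Qed.

Lemma rval_del r V p : rval (rc_del r V) p = if p \in V then 0%N else rval r p.
Proof.
rewrite /rval fsfunE inE; case: (p \in V) => //=; case: ifP => // h.
by rewrite fsfun_dflt ?h.
Qed.

Lemma finsupp_chi2 A B : finsupp (chi2 A B) = A `|` B.
Proof.
apply/fsetP => p; rewrite mem_finsupp fsfunE; case: ifP => //.
by case: ifP.
Qed.

Lemma rval_chi2 A B p : rval (chi2 A B) p = (p \in A).
Proof.
rewrite /rval fsfunE inE; case: (p \in A) => //=.
by case: ifP.
Qed.

Lemma act_chi2 A B : act (chi2 A B) = A.
Proof. by apply/fsetP => p; rewrite in_act rval_chi2; case: (p \in A). Qed.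

Lemma pass_chi2 A B : pass (chi2 A B) = B `\` A.
Proof.
apply/fsetP => p; rewrite in_pass rval_chi2 finsupp_chi2 !inE.
by case: (p \in A); rewrite //= andbT.
Qed.

Lemma act_pass r : act r `|` pass r = finsupp r.
Proof.
apply/fsetP => p; rewrite inE in_act in_pass; case h: (p \in finsupp r) => /=.
  by case: (rval r p).
by rewrite rval_out ?h.
Qed.

Lemma pass_act_dis r : fdisjoint (act r) (pass r).
Proof. by apply/disjP => p; rewrite in_act in_pass lt0n => /negbTE->; rewrite andbF. Qed.

Lemma passD_act r : pass r `\` act r = pass r.
Proof.
apply/fsetP => p; rewrite inE in_act in_pass.
by case: (rval r p) => [|n] //=; rewrite andbF.
Qed.

Lemma act_chi r : act (chi r) = act r. Proof. exact: act_chi2. Qed.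

Lemma pass_chi r : pass (chi r) = pass r.
Proof. by rewrite /chi pass_chi2 passD_act. Qed.

Lemma finsupp_chi r : finsupp (chi r) = finsupp r.
Proof. by rewrite finsupp_chi2 act_pass. Qed.

Lemma act_del r V : act (rc_del r V) = act r `\` V.
Proof. by apply/fsetP => p; rewrite inE !in_act rval_del; case: (p \in V). Qed.

Lemma pass_del r V : pass (rc_del r V) = pass r `\` V.
Proof.
apply/fsetP => p; rewrite inE !in_pass rval_del finsupp_del inE.
by case: (p \in V).
Qed.

Lemma del_chi2 A B V : rc_del (chi2 A B) V = chi2 (A `\` V) (B `\` V).
Proof.
apply: rc_eqP => [|p]; first by rewrite finsupp_del !finsupp_chi2 fsetDUl.
by rewrite rval_del !rval_chi2 inE; case: (p \in V).
Qed.

Lemma del_chi r V : rc_del (chi r) V = chi (rc_del r V).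
Proof. by rewrite del_chi2 /chi act_del pass_del. Qed.

Lemma dec_chi2 A B S : S `<=` A ->
  rc_dec (chi2 A B) S = chi2 (A `\` S) (B `|` S).
Proof.
move=> sS; apply: rc_eqP => [|p].
  rewrite finsupp_dec !finsupp_chi2; apply/fsetP => p; rewrite !inE.
  by case pS: (p \in S); rewrite ?orbF ?orbT //= (fsubsetP sS).
rewrite rval_dec !rval_chi2 inE; case pS: (p \in S); last by rewrite subn0.
by rewrite (fsubsetP sS).
Qed.

Lemma del_dec r T : rc_del (rc_dec r T) T = rc_del r T.
Proof.
apply: rc_eqP => [|p]; first by rewrite !finsupp_del finsupp_dec.
by rewrite !rval_del rval_dec; case: (p \in T); rewrite ?subn0.
Qed.

Lemma dec_del r S V : rc_dec (rc_del r V) S = rc_del (rc_dec r S) V.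
Proof.
apply: rc_eqP => [|p]; first by rewrite !(finsupp_del, finsupp_dec).
by rewrite !(rval_del, rval_dec); case: (p \in V).
Qed.

Lemma dec_delD r S V : rc_dec (rc_del r V) (S `\` V) = rc_del (rc_dec r S) V.
Proof.
apply: rc_eqP => [|p]; first by rewrite !(finsupp_del, finsupp_dec).
by rewrite !(rval_del, rval_dec) inE; case: (p \in V).
Qed.

Lemma dec0 r : rc_dec r fset0 = r.
Proof.
apply: rc_eqP => [|p]; first by rewrite finsupp_dec.
by rewrite rval_dec inE subn0.
Qed.

(** * Simplices *)

(** The conditions on a simplex of [P(r)]. The shift by one in the multiplicities disappears because
    [occ] does not count [R_0], which contains the whole support. *)
Definition valid r A L :=
  [/\ A `<=` finsupp r, normal A L, forall p, (occ p L <= rval r p)%N &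
      forall p, p \in A -> occ p L = rval r p].

Lemma valid_union r A L : valid r A L -> union L `<=` act r.
Proof.
case=> _ _ h _; apply/fsubsetP => p; rewrite in_act.
by case: posnP (h p) => // ->; rewrite leqn0 occ_eq0 => /negP.
Qed.

Lemma valid_unionU r A L : valid r A L -> union L `<=` finsupp r.
Proof. by move/valid_union/fsubset_trans; apply; apply: act_sub. Qed.

Lemma valid_nil r A : valid r A [::] -> fdisjoint (act r) A.
Proof.
case=> _ _ _ h; apply/disjP => p + pA.
by rewrite in_act -(h p pA).
Qed.

Lemma normalP A L :
  (forall i, (i < size L)%N ->
    nth fset0 L i `&` (A `|` union (drop i.+1 L)) != fset0) <-> normal A L.
Proof.
elim: L => [|R L IH] //=; split=> [h|/andP[h /IH h'] [|i]] //=.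
- apply/andP; split; first by have := h 0%N isT; rewrite /= drop0.
  by apply/IH => i /(h i.+1).
- by rewrite drop0.
- exact: h'.
Qed.

Lemma PcxP r s :
  Pcx r s <-> exists A L, valid r A L /\ s = of_rounds (finsupp r) A L.
Proof.
split=> [[[ws hW] hs hA hG]|[A [L [hv ->]]]].
  have E := prestructure_rounds ws; case: ws => s0 P1 _ _.
  case: s s0 hs E hW hA hG P1 => // c s _ hs.
  set A := active _ => E; rewrite [map _ _]/= in E; set L := map _ s in E.
  move=> hW hA hG P1.
  have eU : c.1 `|` c.2 = finsupp r by [].
  rewrite eU -/(of_rounds (finsupp r) A L) in E.
  have sA : A `<=` finsupp r by rewrite -hs fsubsetDl.
  have sL : union L `<=` finsupp r.
    apply/fsubsetP => p; rewrite -[L]drop0 => /in_union_drop[j /= hj].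
    rewrite /L size_map in hj.
    have [h1 h2] : Wof (c :: s) j.+1 `<=` Wof (c :: s) 0 /\
        Gof (c :: s) j.+1 `<=` Wof (c :: s) 0 by apply: P1; rewrite /= ltnS.
    rewrite (nth_map (fset0, fset0)) // -hs !in_fsetU => h; apply/orP; left.
    by move: h => /orP[/(fsubsetP h1)|/(fsubsetP h2)].
  exists A, L; split=> //; rewrite E in hA hG hW.
  have hm p : mult p (of_rounds (finsupp r) A L) = ((p \in finsupp r) + occ p L)%N.
    by rewrite mult_rounds.
  split=> //.
  - apply/normalP => i hi; have := hW i.+1.
    by rewrite /of_rounds size_rounds Wof_rounds /= ltnS hi; apply.
  - move=> p; case pU : (p \in finsupp r); last first.
      rewrite rval_out ?pU // leqn0 occ_eq0; apply/negP => /(fsubsetP sL).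
      by rewrite pU.
    case pA : (p \in A).
      by have := hA p pA; rewrite hm pU add1n => -[->].
    have := hG p; rewrite ghosts_of_rounds // hm pU add1n ltnS; apply.
    by rewrite inE pA.
  - move=> p pA; have := hA p pA; rewrite hm (fsubsetP sA) // add1n.
    by case.
have sL := valid_unionU hv; case: hv => sA nL oL aL.
have hm p : mult p (of_rounds (finsupp r) A L) = ((p \in finsupp r) + occ p L)%N.
  by rewrite mult_rounds.
split.
- split; first split=> [//|i|i j|i j]; rewrite /of_rounds ?size_rounds;
    try set L0 := _ :: L.
  + case: i => // i hi; have {}hi : (i < size L)%N by [].
    rewrite !Wof_rounds Gof_rounds /= drop0.
    have sR : nth fset0 L i `<=` union L by apply: (nth_union hi).
    split; apply/fsubsetP => p; rewrite inE => /andP[h1 h2].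
      by rewrite !inE (fsubsetP sL) ?(fsubsetP sR) ?orbT.
    by rewrite !inE (fsubsetP sL) ?(fsubsetP sR) ?orbT.
  + move=> /andP[hij hj]; rewrite !Gof_rounds; apply/eqP/disjP => p.
    rewrite !inE => /andP[+ _] /andP[_ pj].
    rewrite negb_or => /andP[_ /negP]; apply; apply/in_union_drop.
    by exists j => //; rewrite hij.
  + move=> /andP[hij hj]; rewrite Gof_rounds Wof_rounds; apply/eqP/disjP => p.
    rewrite !inE => /andP[+ _] /andP[pj].
    rewrite negb_or => /andP[/negbTE -> /negP h]; rewrite orFb => h'; apply: h.
    case/in_union_drop: h' => k /andP[hk1 hk2] pk; apply/in_union_drop.
    by exists k => //; rewrite (leq_ltn_trans hij) // hk2.
  + move=> i; case: i => // i hi; have {}hi : (i < size L)%N by [].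
    by rewrite Wof_rounds; move/normalP: nL; apply.
- by rewrite wsupp_of_rounds.
- by move=> p; rewrite active_of_rounds // hm => pA; rewrite (fsubsetP sA) // aL.
- move=> p; rewrite ghosts_of_rounds // hm inE => /andP[_ ->].
  by rewrite add1n ltnS.
Qed.

Lemma of_rounds_inj r A A' L L' : valid r A L -> valid r A' L' ->
  of_rounds (finsupp r) A L = of_rounds (finsupp r) A' L' -> A = A' /\ L = L'.
Proof.
move=> h h' e; have sL := valid_unionU h; have sL' := valid_unionU h'.
case: h h' => sA _ _ _ [sA' _ _ _]; split.
  by rewrite -(active_of_rounds sA sL) e active_of_rounds.
apply: (@eq_from_nth _ fset0).
  by move/(congr1 size): e; rewrite !size_rounds => -[].
move=> i _; move/(congr1 (fun s => Rof s i.+1)): e.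
by rewrite !Rof_rounds.
Qed.

Lemma valid_norm r A A' L : A' `<=` A -> valid r A L -> valid r A' (norm A' L).
Proof.
move=> sA [h1 h2 h3 h4]; split.
- exact: fsubset_trans h1.
- exact: normal_norm.
- by move=> p; apply: leq_trans (h3 p); apply: occ_norm_le.
- by move=> p pA; rewrite occ_norm // h4 // (fsubsetP sA).
Qed.

Lemma Gamma_valid r A S L : S `<=` A -> valid r A L ->
  Gamma S (of_rounds (finsupp r) A L) =
    of_rounds (finsupp r) (A `\` S) (norm (A `\` S) L).
Proof. by move=> sS h; rewrite Gamma_of_rounds ?(valid_unionU h) //; case: h. Qed.

Lemma verticesP r A L v : valid r A L ->
  reflect (exists2 a, a \in A & v = of_rounds (finsupp r) [fset a] (norm [fset a] L))
    (v \in vertices (of_rounds (finsupp r) A L)).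
Proof.
move=> h; have sL := valid_unionU h; have sA : A `<=` finsupp r by case: h.
have E a : a \in A -> Gamma (A `\ a) (of_rounds (finsupp r) A L) =
    of_rounds (finsupp r) [fset a] (norm [fset a] L).
  move=> aA; rewrite (Gamma_valid _ h) ?fsubD1set ?fsubsetUr //.
  by rewrite fsetDDr fsetDv fset0U (fsetIidPr _) // fsub1set.
apply: (iffP idP) => [/imfsetP[a /=]|[a aA ->]].
  by rewrite active_of_rounds // => aA ->; exists a => //; rewrite E.
by apply/imfsetP; exists a; rewrite /= active_of_rounds // E.
Qed.

(** * The subcomplexes [B_V] and [X_S] and their isomorphisms in terms of codes *)

Lemma Bcx_of_rounds V r A L : valid r A L ->
  Bcx V r (of_rounds (finsupp r) A L) <->
  V `<=` finsupp r /\ fdisjoint V (A `|` union L).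
Proof.
move=> h; have e : Gof (of_rounds (finsupp r) A L) 0 = finsupp r `\` (A `|` union L).
  by rewrite Gof_rounds /= drop0.
have hP : Pcx r (of_rounds (finsupp r) A L) by apply/PcxP; exists A, L.
split=> [[_]|[sV /disjP dV]]; rewrite /Bcx /= e.
  move=> /fsubsetP sV; split; first by apply/fsubsetP => p /sV; rewrite inE => /andP[].
  by apply/disjP => p /sV; rewrite !inE => /andP[/negbTE->].
by split=> //; apply/fsubsetP => p pV; rewrite inE (fsubsetP sV) // andbT; apply/negP/dV.
Qed.

Lemma Xcx_of_rounds S r A L : valid r A L ->
  Xcx S r (of_rounds (finsupp r) A L) <-> peelable S A L.
Proof.
move=> h; have hP : Pcx r (of_rounds (finsupp r) A L) by apply/PcxP; exists A, L.
rewrite /Xcx /= -/(of_rounds (finsupp r) A L) /of_rounds size_rounds.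
case: L h hP => [|R L] h hP; first by split=> // _; split=> //; left.
rewrite Rof_rounds Gof_rounds [nth _ _ _]/= [drop _ _]/= drop0 /peelable; split.
  case=> _ [//|[_ [->|sS]]]; first by rewrite eqxx.
  apply/orP; right; apply/andP; split.
    by apply/fsubsetP => p /(fsubsetP sS); rewrite inE => /andP[].
  by apply/disjP => p /(fsubsetP sS); rewrite !inE => /andP[/negbTE->].
move=> hX; split=> //; right; split=> //.
case/orP: hX => [/eqP->|/andP[sS /disjP dS]]; [by left|right].
by apply/fsubsetP => p pS; rewrite inE (fsubsetP sS) // andbT; apply/negP/dS.
Qed.

Lemma valid_del V r A L : valid r A L -> fdisjoint V (A `|` union L) ->
  valid (rc_del r V) A L.
Proof.
case=> h1 h2 h3 h4 /disjP dV; split=> //.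
- rewrite finsupp_del; apply/fsubsetP => p pA; rewrite inE (fsubsetP h1) // andbT.
  by apply/negP => /dV; apply; rewrite inE pA.
- move=> p; rewrite rval_del; case: ifP => // pV.
  by rewrite leqn0 occ_eq0; apply/negP => pL; apply: (dV p pV); rewrite inE pL orbT.
- move=> p pA; rewrite rval_del; case: ifP => [pV|_]; last exact: h4.
  by case: (dV p pV); rewrite inE pA.
Qed.

Lemma valid_undel V r A L : valid (rc_del r V) A L ->
  valid r A L /\ fdisjoint V (A `|` union L).
Proof.
move=> h; have sL := valid_unionU h; case: h => sA h2 h3 h4.
rewrite finsupp_del in sA sL; split; first split=> //.
- by apply: (fsubset_trans sA); apply: fsubsetDl.
- by move=> p; apply: (leq_trans (h3 p)); rewrite rval_del; case: ifP.
- move=> p pA; rewrite h4 // rval_del; case: ifP => // pV.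
  by move: (fsubsetP sA p pA); rewrite inE pV.
apply/disjP => p pV; rewrite inE => /orP[/(fsubsetP sA)|/(fsubsetP sL)];
  by rewrite inE pV.
Qed.

Lemma delta_of_rounds V U A L : fdisjoint V (A `|` union L) ->
  delta V (of_rounds U A L) = of_rounds (U `\` V) A L.
Proof.
move=> /disjP dV; rewrite /delta /of_rounds Wof_rounds Gof_rounds /= drop0.
congr ((_, _) :: _); apply/fsetP => p; rewrite !inE.
  case pV : (p \in V) => //=; apply/negP => /andP[_ h].
  by apply: (dV p pV); rewrite inE.
by rewrite andbCA.
Qed.

Lemma nil_disjoint S r A L : S `<=` act r -> valid r A L ->
  L = [::] -> fdisjoint S A.
Proof.
move=> sS h e; rewrite e in h; move/disjP: (valid_nil h) => d.
by apply/disjP => p /(fsubsetP sS)/d.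
Qed.

Lemma gamma_of_rounds S U A L : S `<=` U -> normal A L -> peelable S A L ->
  gamma S (of_rounds U A L) = of_rounds U A (peel S L).
Proof.
move=> sS nL; rewrite /gamma {1}/of_rounds size_rounds; case: L nL => [//|R L] nL.
rewrite [peelable _ _ _]/= [(_ <= _)%N]/= {1}/of_rounds Rof_rounds [nth _ _ _]/= [peel _ _]/=.
rewrite /of_rounds !Wof_rounds !Gof_rounds /= !drop0.
case: eqP => [-> _|_ /= /andP[sSR /disjP dS]].
  congr ((_, _) :: _); apply/fsetP => p; rewrite !inE;
    have := fsubsetP sS p; case: (p \in S) => [/(_ isT) eU|_];
    by case: (p \in A); case: (p \in union L); rewrite ?eU ?andbF ?andbT ?orbF ?orbT.
have dS' p : p \in S -> (p \in A = false) * (p \in union L = false).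
  by move=> pS; split; apply/negP => h; apply: (dS p pS); rewrite inE h ?orbT.
congr [:: (_, _), (_, _) & _]; apply/fsetP => p; rewrite !inE;
  have := fsubsetP sS p; have := dS' p; case: (p \in S) => [/(_ isT) e /(_ isT) eU|_ _];
  by rewrite ?e ?eU ?andbF ?andbT ?orbF ?orbT.
Qed.

Lemma valid_peel S r A L : S `<=` act r -> valid r A L -> peelable S A L ->
  valid (rc_dec r S) A (peel S L).
Proof.
move=> sS h hX; have h0 := nil_disjoint sS h; case: h => h1 h2 h3 h4.
have E p : occ p (peel S L) = (occ p L - (p \in S))%N \/ (L = [::]).
  case: L h2 hX h0 {h3 h4} => [|R L]; first by right.
  move=> nL hX h0; left; rewrite -{2}(push_peel nL hX h0) occ_push.
  case: ifP => [/andP[_ /eqP->]//|_].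
  by rewrite addKn.
split.
- by rewrite finsupp_dec.
- exact: normal_peel.
- move=> p; rewrite rval_dec; case: (E p) => [->|->] //.
  by rewrite leq_sub2r.
- move=> p pA; rewrite rval_dec; case: (E p) => [->|e]; first by rewrite h4.
  rewrite -(h4 p pA) e /= sub0n; exact.
Qed.

Lemma valid_push S r A L : S `<=` act r -> valid (rc_dec r S) A L ->
  valid r A (push A S L).
Proof.
move=> sS [h1 h2 h3 h4]; rewrite finsupp_dec in h1.
have rS p : ((p \in S) + rval (rc_dec r S) p)%N = rval r p.
  rewrite rval_dec; case pS: (p \in S); last by rewrite subn0.
  by rewrite subnKC //; move: (fsubsetP sS p pS); rewrite in_act.
split=> //; first exact: normal_push.
- move=> p; rewrite occ_push; case: ifP => // _.
  by rewrite -rS leq_add2l.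
- move=> p pA; rewrite occ_push; case: ifP => [/andP[/disjP dS /eqP e]|_].
    rewrite -rS -h4 // e /= addn0; case pS: (p \in S) => //.
    by case: (dS p pS).
  by rewrite -rS h4.
Qed.

Lemma gamma_valid S r A L : S `<=` act r -> valid r A L -> peelable S A L ->
  gamma S (of_rounds (finsupp r) A L) = of_rounds (finsupp (rc_dec r S)) A (peel S L).
Proof.
move=> sS [_ nL _ _] hX; rewrite finsupp_dec; apply: gamma_of_rounds => //.
exact: fsubset_trans sS (act_sub r).
Qed.

Lemma delta_valid V r A L : fdisjoint V (A `|` union L) ->
  delta V (of_rounds (finsupp r) A L) = of_rounds (finsupp (rc_del r V)) A L.
Proof. by move=> dV; rewrite finsupp_del delta_of_rounds. Qed.

Lemma Pcx_of_rounds r A L : valid r A L -> Pcx r (of_rounds (finsupp r) A L).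
Proof. by move=> h; apply/PcxP; exists A, L. Qed.

Lemma valid_vertex r A L a : valid r A L -> a \in A ->
  valid r [fset a] (norm [fset a] L).
Proof. by move=> h aA; apply: (valid_norm _ h); rewrite fsub1set. Qed.

Lemma Pcx_vertex r s v : Pcx r s -> v \in vertices s -> Pcx r v.
Proof.
case/PcxP => A [L [h ->]] /(verticesP _ h)[a aA ->].
exact: Pcx_of_rounds (valid_vertex h aA).
Qed.

Lemma active_valid r A L : valid r A L -> active (of_rounds (finsupp r) A L) = A.
Proof. by move=> h; rewrite active_of_rounds ?(valid_unionU h) //; case: h. Qed.

(** The face is obtained by keeping those active elements whose vertices lie in [D]. By [norm_norm],
    its vertices are the corresponding vertices of [s]. *)
Lemma Pcx_face r s (D : {fset wseq}) : Pcx r s -> D `<=` vertices s ->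
  exists2 s', Pcx r s' & vertices s' = D.
Proof.
case/PcxP => A [L [h ->]] sD.
pose A' := [fset a in A | of_rounds (finsupp r) [fset a] (norm [fset a] L) \in D].
have sA : A' `<=` A by apply/fsubsetP => a; rewrite !inE => /andP[].
have h' := valid_norm sA h.
exists (of_rounds (finsupp r) A' (norm A' L)); first exact: Pcx_of_rounds.
have e a : a \in A' -> norm [fset a] (norm A' L) = norm [fset a] L.
  by move=> aA; apply: norm_norm; rewrite fsub1set.
apply/fsetP => v; apply/(verticesP _ h')/idP => [[a aA ->]|vD].
  by rewrite e //; move: aA; rewrite !inE => /andP[].
have /(verticesP _ h)[a aA ev] := fsubsetP sD v vD.
by exists a; rewrite ?e ?inE ?aA -?ev.
Qed.

Lemma fsubset1_in A a : a \in A -> [fset a] `<=` A.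
Proof. by rewrite fsub1set. Qed.

Lemma Xcx_vertices S r s : S `<=` act r -> Pcx r s ->
  Xcx S r s <-> forall v, v \in vertices s -> Xcx S r v.
Proof.
move=> sS /PcxP[A [L [h ->]]].
have h0 := nil_disjoint sS h.
have nL : normal A L by case: h.
split=> [/(Xcx_of_rounds _ h) hX v /(verticesP _ h)[a aA ->]|hv].
  apply/(Xcx_of_rounds _ (valid_vertex h aA)).
  by have [] := peel_norm (fsubset1_in aA) nL hX h0.
apply/(Xcx_of_rounds _ h); apply: (peelable_vertices nL) => a aA.
apply/(Xcx_of_rounds _ (valid_vertex h aA)); apply: hv; apply/(verticesP _ h).
by exists a.
Qed.

Lemma Bcx_vertices V r s : V `<=` finsupp r -> Pcx r s ->
  Bcx V r s <-> forall v, v \in vertices s -> Bcx V r v.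
Proof.
move=> sV /PcxP[A [L [h ->]]].
have nL : normal A L by case: h.
split=> [/(Bcx_of_rounds _ h) [_ /disjP dV] v /(verticesP _ h)[a aA ->]|hv].
  apply/(Bcx_of_rounds _ (valid_vertex h aA)); split=> //; apply/disjP => p pV pa.
  apply: (dV p pV); move: pa; rewrite !inE => /orP[/eqP->|]; first by rewrite aA.
  by move=> /(fsubsetP (union_norm_sub _ _))->; rewrite orbT.
apply/(Bcx_of_rounds _ h); split=> //; apply: (disjoint_vertices nL) => a aA.
have /(Bcx_of_rounds _ (valid_vertex h aA))[] // :
    Bcx V r (of_rounds (finsupp r) [fset a] (norm [fset a] L)).
by apply: hv; apply/(verticesP _ h); exists a.
Qed.

Lemma delta_iso V r s : Bcx V r s ->
  Pcx (rc_del r V) (delta V s) /\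
  vertices (delta V s) = [fset delta V v | v in vertices s].
Proof.
move=> hB; have /PcxP[A [L [h e]]] : Pcx r s by case: hB.
move: hB; rewrite e => /(Bcx_of_rounds _ h)[sV dV].
have h' := valid_del h dV; rewrite delta_valid //.
split; first exact: Pcx_of_rounds.
have E a : a \in A -> delta V (of_rounds (finsupp r) [fset a] (norm [fset a] L)) =
    of_rounds (finsupp (rc_del r V)) [fset a] (norm [fset a] L).
  move=> aA; rewrite delta_of_rounds ?finsupp_del //; apply/disjP => p pV pa.
  case/disjP/(_ p pV): dV; move: pa; rewrite !inE => /orP[/eqP->|].
    by rewrite aA.
  by move=> /(fsubsetP (union_norm_sub _ _))->; rewrite orbT.
apply/fsetP => v; apply/(verticesP _ h')/imfsetP =>
  [[a aA ->]|[w /= /(verticesP _ h)[a aA ->] ->]].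
  exists (of_rounds (finsupp r) [fset a] (norm [fset a] L)); last by rewrite E.
  by apply/(verticesP _ h); exists a.
by exists a => //; rewrite E.
Qed.

Lemma delta_inj V r s s' : Bcx V r s -> Bcx V r s' -> delta V s = delta V s' -> s = s'.
Proof.
move=> hB hB'; have /PcxP[A [L [h e]]] : Pcx r s by case: hB.
have /PcxP[A' [L' [h' e']]] : Pcx r s' by case: hB'.
move: hB hB'; rewrite e e' => /(Bcx_of_rounds _ h)[sV dV] /(Bcx_of_rounds _ h')[_ dV'].
rewrite !delta_valid // => /of_rounds_inj.
by case/(_ (valid_del h dV) (valid_del h' dV')) => -> ->.
Qed.

Lemma delta_surj V r s : V `<=` finsupp r -> Pcx (rc_del r V) s ->
  exists2 s', Bcx V r s' & delta V s' = s.
Proof.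
move=> sV /PcxP[A [L [/valid_undel[h dV] ->]]].
exists (of_rounds (finsupp r) A L); first exact/(Bcx_of_rounds _ h).
by rewrite delta_of_rounds // finsupp_del.
Qed.

Lemma gamma_iso S r s : S `<=` act r -> Xcx S r s ->
  Pcx (rc_dec r S) (gamma S s) /\
  vertices (gamma S s) = [fset gamma S v | v in vertices s].
Proof.
move=> sS hX; have /PcxP[A [L [h e]]] : Pcx r s by case: hX.
have h0 := nil_disjoint sS h.
have nL : normal A L by case: h.
have sU : S `<=` finsupp r by apply: fsubset_trans sS (act_sub r).
move: hX; rewrite e => /(Xcx_of_rounds _ h) hX.
have h' := valid_peel sS h hX.
rewrite gamma_valid //; split; first exact: Pcx_of_rounds.
have E a : a \in A -> gamma S (of_rounds (finsupp r) [fset a] (norm [fset a] L)) =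
    of_rounds (finsupp (rc_dec r S)) [fset a] (norm [fset a] (peel S L)).
  move=> aA; have [h1 <-] := peel_norm (fsubset1_in aA) nL hX h0.
  by rewrite gamma_of_rounds ?finsupp_dec //; apply: normal_norm.
apply/fsetP => v; apply/(verticesP _ h')/imfsetP =>
  [[a aA ->]|[w /= /(verticesP _ h)[a aA ->] ->]].
  exists (of_rounds (finsupp r) [fset a] (norm [fset a] L)); last by rewrite E.
  by apply/(verticesP _ h); exists a.
by exists a => //; rewrite E.
Qed.

Lemma gamma_inj S r s s' : S `<=` act r -> Xcx S r s -> Xcx S r s' ->
  gamma S s = gamma S s' -> s = s'.
Proof.
move=> sS hX hX'; have /PcxP[A [L [h e]]] : Pcx r s by case: hX.
have /PcxP[A' [L' [h' e']]] : Pcx r s' by case: hX'.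
have sU : S `<=` finsupp r by apply: fsubset_trans sS (act_sub r).
move: hX hX'; rewrite e e' => /(Xcx_of_rounds _ h) hX /(Xcx_of_rounds _ h') hX'.
have [nL nL'] : normal A L /\ normal A' L' by case: h; case: h'.
rewrite !gamma_valid // => /of_rounds_inj.
case/(_ (valid_peel sS h hX) (valid_peel sS h' hX')) => eA eL.
rewrite eA -(push_peel nL hX (nil_disjoint sS h)) -(push_peel nL' hX' (nil_disjoint sS h')).
by rewrite eL eA.
Qed.

Lemma gamma_surj S r s : S `<=` act r -> Pcx (rc_dec r S) s ->
  exists2 s', Xcx S r s' & gamma S s' = s.
Proof.
move=> sS /PcxP[A [L [h ->]]].
have h' := valid_push sS h.
have sU : S `<=` finsupp r by apply: fsubset_trans sS (act_sub r).
exists (of_rounds (finsupp r) A (push A S L)); first exact/(Xcx_of_rounds _ h')/peelable_push.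
have [_ nL _ _] := h.
rewrite gamma_of_rounds ?peel_push ?finsupp_dec //; last exact: peelable_push.
exact: normal_push.
Qed.

Lemma Xcx0 r s : Pcx r s -> Xcx fset0 r s /\ gamma fset0 s = s.
Proof.
move=> /PcxP[A [L [h ->]]]; split; first exact/(Xcx_of_rounds _ h)/peelable0.
have [_ nL _ _] := h.
by rewrite gamma_of_rounds ?peelable0 // (peel0 nL).
Qed.

Lemma Xcx_sub S T r s : S `<=` act r -> T `<=` S -> T != S -> Xcx S r s ->
  Xcx T r s <-> Bcx T (rc_dec r S) (gamma S s).
Proof.
move=> sS sT nT hX; have /PcxP[A [L [h e]]] : Pcx r s by case: hX.
have sU : S `<=` finsupp r by apply: fsubset_trans sS (act_sub r).
have [_ nL _ _] := h.
move: hX; rewrite e => /(Xcx_of_rounds _ h) hX; rewrite gamma_valid //.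
split=> [/(Xcx_of_rounds _ h) hT|/(Bcx_of_rounds _ (valid_peel sS h hX))[_ dT]].
  apply/(Bcx_of_rounds _ (valid_peel sS h hX)); split.
    by rewrite finsupp_dec (fsubset_trans sT).
  rewrite -(peelable_sub sT nT hX) //; exact: nil_disjoint (fsubset_trans sT sS) h.
apply/(Xcx_of_rounds _ h); rewrite (peelable_sub sT nT hX) //.
exact: nil_disjoint (fsubset_trans sT sS) h.
Qed.

Lemma Xcx_union S T r s : Xcx S r s -> Xcx T r s -> Xcx (S `|` T) r s.
Proof.
move=> hX; have /PcxP[A [L [h e]]] : Pcx r s by case: hX.
move: hX; rewrite e => /(Xcx_of_rounds _ h) hX /(Xcx_of_rounds _ h) hT.
exact/(Xcx_of_rounds _ h)/peelable_union.
Qed.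

Lemma Xcx_cap S T r s : S `<=` act r -> T `<=` S -> T != S ->
  Xcx S r s -> Xcx T r s ->
  [/\ Bcx T (rc_dec r T) (gamma T s),
      Xcx (S `\` T) (rc_del r T) (delta T (gamma T s)) &
      gamma (S `\` T) (delta T (gamma T s)) = delta T (gamma S s)].
Proof.
move=> sS sT nT hX hXT; have /PcxP[A [L [h e]]] : Pcx r s by case: hX.
have sU : S `<=` finsupp r by apply: fsubset_trans sS (act_sub r).
have sTU := fsubset_trans sT sU; have sTA := fsubset_trans sT sS.
have [_ nL _ _] := h.
have hB : Bcx T (rc_dec r S) (gamma S s) by apply/Xcx_sub.
move: hX hXT hB; rewrite e => /(Xcx_of_rounds _ h) hX /(Xcx_of_rounds _ h) hT.
have hS := valid_peel sS h hX; have hT' := valid_peel sTA h hT.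
rewrite !gamma_valid // => /(Bcx_of_rounds _ hS)[_ dS].
have [dT hST] := peel_cap sT nT hX hT (nil_disjoint sTA h).
have hV := valid_del hT' dT.
have sST : S `\` T `<=` act (rc_del (rc_dec r T) T).
  by rewrite del_dec act_del fsetSD.
rewrite !delta_valid // -(del_dec r T); split.
- by apply/(Bcx_of_rounds _ hT'); rewrite finsupp_dec.
- exact/(Xcx_of_rounds _ hV).
- rewrite gamma_valid // (peel_peel sT nL hX hT); congr of_rounds.
  by rewrite !(finsupp_del, finsupp_dec).
Qed.

Lemma gamma_delta S V r s : S `<=` act r -> fdisjoint S V ->
  Bcx V r s -> Xcx S r s ->
  [/\ Bcx V (rc_dec r S) (gamma S s), Xcx S (rc_del r V) (delta V s) &
      gamma S (delta V s) = delta V (gamma S s)].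
Proof.
move=> sS /disjP dSV hB; have /PcxP[A [L [h e]]] : Pcx r s by case: hB.
have [_ nL _ _] := h.
have sU : S `<=` finsupp r by apply: fsubset_trans sS (act_sub r).
move: hB; rewrite e => /(Bcx_of_rounds _ h)[sV dV] /(Xcx_of_rounds _ h) hX.
have hS := valid_peel sS h hX; have hV := valid_del h dV.
have dV' : fdisjoint V (A `|` union (peel S L)).
  apply/disjP => p pV pA; case/disjP/(_ p pV): dV; move: pA.
  rewrite !inE => /orP[->//|]; case: (L) => //= R L'.
  case: ifP => _ /=; rewrite !inE; first by move=> ->; rewrite !orbT.
  by case/orP => [/andP[_]|] ->; rewrite !orbT.
rewrite gamma_valid // delta_valid // delta_valid //; split.
- by apply/(Bcx_of_rounds _ hS); rewrite finsupp_dec.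
- exact/(Xcx_of_rounds _ hV).
- rewrite gamma_valid //; last by rewrite act_del; apply/fsubsetP => p pS;
    rewrite inE (fsubsetP sS) // andbT; apply/negP/dSV.
  by congr of_rounds; rewrite !(finsupp_del, finsupp_dec).
Qed.

(** Rounds are nonempty and consist of elements of [act r], so nothing is left for them outside [V].
    Hence [t = 0], where [gamma] acts as the identity. *)
Lemma Bcx_act r s S V : act r `<=` V -> S `<=` act r -> Bcx V r s ->
  [/\ Xcx S r s, gamma S s = s & Bcx V (rc_dec r S) s].
Proof.
move=> sV sS hB; have /PcxP[A [L [h e]]] : Pcx r s by case: hB.
move: hB; rewrite e => /(Bcx_of_rounds _ h)[sVU /disjP dV].
have L0 : L = [::].
  case: L h dV {e} => // R L h dV; have [_ nL _ _] := h.
  have /fset0Pn[p pR] := normal_neq0 nL.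
  have pU : p \in union (R :: L) by rewrite inE pR.
  case: (dV p); last by rewrite inE pU orbT.
  exact/(fsubsetP sV)/(fsubsetP (valid_union h)).
rewrite L0 in h dV *.
have hX : peelable S A [::] by [].
have hS := valid_peel sS h hX.
have E : gamma S (of_rounds (finsupp r) A [::]) = of_rounds (finsupp r) A [::] by [].
split=> //; first exact/(Xcx_of_rounds _ h).
rewrite -E gamma_valid //; apply/(Bcx_of_rounds _ hS); rewrite finsupp_dec.
by split=> //; apply/disjP.
Qed.

(** For [t >= 1] take [S = R_1], which is disjoint from [G_0] and so from [V]. For [t = 0] the
    simplex lies in every [X_S], and the elements of [act r] outside [V] form a nonempty choice. *)
Lemma Xcx_cover V r s : ~~ (act r `<=` V) -> Bcx V r s ->
  exists S, [/\ S != fset0, S `<=` act r, fdisjoint S V & Xcx S r s].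
Proof.
move=> nV hB; have /PcxP[A [L [h e]]] : Pcx r s by case: hB.
move: hB; rewrite e => /(Bcx_of_rounds _ h)[sVU /disjP dV].
case: L h {e} dV => [|R L] h dV.
  exists (act r `\` V); split; first by rewrite fsetD_eq0.
  - exact: fsubsetDl.
  - by apply/disjP => p; rewrite inE => /andP[/negP].
  - exact/(Xcx_of_rounds _ h).
have [_ nL _ _] := h; exists R; split.
- exact: normal_neq0 nL.
- apply: fsubset_trans (valid_union h); exact: fsubsetUl.
- by apply/disjP => p pR /dV; rewrite !inE pR orbT; apply.
- by apply/(Xcx_of_rounds _ h); rewrite /= eqxx.
Qed.

Lemma Bcx0 r s : Pcx r s -> Bcx fset0 r s.
Proof. by move=> h; split=> //; apply: fsub0set. Qed.

Lemma Bcx_subcomplex V r : V `<=` finsupp r -> subcomplex (Bcx V r) r.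
Proof.
move=> sV; split=> [s []//|s S hB sS].
have /PcxP[A [L [h e]]] : Pcx r s by case: hB.
move: hB sS; rewrite e (active_valid h) => /(Bcx_of_rounds _ h)[_ /disjP dV] sS.
have hG := valid_norm (fsubsetDl A S) h.
rewrite Gamma_valid //; apply/(Bcx_of_rounds _ hG); split=> //.
apply/disjP => p pV pA; apply: (dV p pV); move: pA; rewrite !inE.
case/orP => [/andP[_ ->]//|/(fsubsetP (union_norm_sub _ _))->].
by rewrite orbT.
Qed.

(** * The weight of a counter and the finiteness of the complexes *)

Definition weight r : nat := \sum_(p <- finsupp r) rval r p.

Lemma weight_dec r S : S `<=` act r -> S != fset0 ->
  (weight (rc_dec r S) < weight r)%N.
Proof.
move=> sS /fset0Pn[q qS]; rewrite /weight finsupp_dec.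
have qU : q \in finsupp r by rewrite (fsubsetP (act_sub r)) ?(fsubsetP sS).
rewrite !(big_fsetD1 q qU) /= -addSn leq_add //.
  rewrite rval_dec qS subn1 prednK //.
  by move: (fsubsetP sS q qS); rewrite in_act.
by apply: leq_sum => p _; rewrite rval_dec leq_subr.
Qed.

Lemma weight_del r V : (weight (rc_del r V) <= weight r)%N.
Proof.
rewrite /weight finsupp_del.
rewrite [X in (_ <= X)%N](big_fsetID _ (mem V)) /= addnC.
have -> : [fset x in finsupp r | x \notin V] = finsupp r `\` V.
  by apply/fsetP => p; rewrite !inE andbC.
apply: (leq_trans _ (leq_addr _ _)).
by apply: leq_sum => p _; rewrite rval_del; case: ifP.
Qed.

Lemma weight_del_act r T : T `<=` act r -> T != fset0 ->
  (weight (rc_del r T) < weight r)%N.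
Proof.
move=> sT nT; rewrite -(del_dec r T).
exact: leq_ltn_trans (weight_del _ _) (weight_dec sT nT).
Qed.

Fixpoint lists U n : {fset seq {fset nat}} :=
  if n is n'.+1 then
    [::] |` [fset R :: L | R in fpowerset U, L in lists U n']
  else [fset [::]].

Lemma in_lists U n L : (size L <= n)%N -> union L `<=` U -> L \in lists U n.
Proof.
elim: n L => [|n IH] [|R L] //=; rewrite ?inE ?eqxx //.
rewrite ltnS fsubUset => hL /andP[sR sL]; apply/orP; right.
by apply/imfset2P; exists R; rewrite ?fpowersetE //; exists L => //; apply: IH.
Qed.

(** All rounds are nonempty, so their number is at most the sum of the multiplicities, which are
    bounded by the values of [r]. *)
Lemma size_weight r A L : valid r A L -> (size L <= weight r)%N.
Proof.
move=> h; have sL := valid_unionU h; case: h => sA nL oL _.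
apply: (@leq_trans (\sum_(p <- finsupp r) occ p L)); last exact: leq_sum.
elim: L nL sL {oL} => // R L IH nL; have /fset0Pn[q qR] := normal_neq0 nL.
case/andP: nL => _ /IH{}IH /=; rewrite fsubUset => /andP[sR /IH{}IH].
rewrite big_split /= -add1n leq_add // (big_fsetD1 q) ?(fsubsetP sR) //=.
by rewrite qR.
Qed.

(** This finiteness makes the realizations closed and compact, and turns the sums over fibres into
    finite sums. *)
Lemma vertices_fset r : exists F : {fset wseq},
  forall s, Pcx r s -> vertices s `<=` F.
Proof.
pose U := finsupp r.
exists [fset of_rounds U [fset a] L | a in U, L in lists U (weight r)].
move=> _ /PcxP[A [L [h ->]]]; apply/fsubsetP => v /(verticesP _ h)[a aA ->].
have hv := valid_vertex h aA.
apply/imfset2P; exists a => /=.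
  by case: h => /fsubsetP/(_ a aA).
by exists (norm [fset a] L) => //; apply: in_lists (size_weight hv) (valid_unionU hv).
Qed.

(** All rounds lie in [A], so [W_0] meets [B] only in [a] if [a] is passive, and not at all
    otherwise. *)
Lemma join_vertex_of_rounds A B a L : fdisjoint A B -> valid (chi2 A B) [fset a] L ->
  join_vertex B (of_rounds (A `|` B) [fset a] L) =
    if a \in B then inr a else inl (of_rounds A [fset a] L).
Proof.
move=> /disjP dAB h.
have sL : union L `<=` A by rewrite -(act_chi2 A B); exact: valid_union h.
have eW : Wof (of_rounds (A `|` B) [fset a] L) 0 `&` B =
    if a \in B then [fset a] else fset0.
  rewrite Wof_rounds /= drop0; apply/fsetP => p.
  transitivity ((p \in B) && (p == a)).
    rewrite !inE andbC; case pB : (p \in B); rewrite ?orbT //=.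
    by case pL : (p \in union L); rewrite ?orbF //; case: (dAB p) => //; exact: (fsubsetP sL).
  case: ifP => aB; rewrite !inE; first by case: eqP => [->|]; rewrite ?aB ?andbF.
  by case: eqP => [->|]; rewrite ?aB ?andbF.
rewrite /join_vertex eW; case: ifP => aB.
  have hm b : (b \in enum_fset [fset a]) = (b == a) by exact: in_fset1.
  move: (hm a); rewrite eqxx; case E : (enum_fset _) => [//|b l] _.
  by move: (hm b); rewrite E mem_head => /esym/eqP->.
case E : (enum_fset _) => [|b l].
  congr inl.
  have eA : (A `|` B) `\` B = A.
    by apply/fsetP => p; rewrite !inE; case pB: (p \in B); rewrite ?orbF //=;
       apply/esym/negP => /dAB /(_ pB).
  rewrite -[in RHS]eA -delta_of_rounds; last first.
    apply/disjP => p pB; rewrite !inE => /orP[/eqP e|/(fsubsetP sL)/dAB/(_ pB)//].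
    by rewrite e aB in pB.
  rewrite /delta; congr ((_, _) :: _).
  have /fsetP e0 := eW; apply/fsetP => p; move: (e0 p); rewrite aB.
  by rewrite in_fsetI in_fset0 in_fsetD; case: (p \in B); case: (p \in Wof _ 0).
have hm b' : (b' \in enum_fset (fset0 : {fset nat})) = false by exact: in_fset0.
by move: (hm b); rewrite E mem_head.
Qed.

End Combinatorics.

Import Order.TTheory GRing.Theory Num.Theory.
Import numFieldNormedType.Exports.
Local Open Scope classical_set_scope.
Local Open Scope ring_scope.

(** * Pointwise topology and realizations *)

Section Geometry.


Variable R : realType.

Lemma within_ptws (T : topologicalType) (V : choiceType) (X : set T)
    (f : T -> pt R V) :
  (forall v, {within X, continuous (fun x => f x v : R)}) ->
  {within X, continuous f}.
Proof.
move=> h; apply/subspace_continuousP => x Xx.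
apply/cvg_sup => v U [W] [[Q] oQ <-] Qfv WU.
apply: (filterS WU); have /subspace_continuousP/(_ x Xx) := h v; apply.
exact: open_nbhs_nbhs.
Qed.

Lemma coord_continuous (V : choiceType) (v : V) :
  continuous (fun x : pt R V => x v : R).
Proof. exact: (@proj_continuous V (fun=> R) v). Qed.

Lemma within_coord (V : choiceType) (X : set (pt R V)) (v : V) :
  {within X, continuous (fun x : pt R V => x v : R)}.
Proof. exact/continuous_subspaceT/coord_continuous. Qed.

Lemma within_comp (T U W : topologicalType) (X : set T) (Y : set U)
    (f : T -> U) (g : U -> W) :
  {within X, continuous f} -> {within Y, continuous g} ->
  (forall x, X x -> Y (f x)) -> {within X, continuous (fun x => g (f x))}.
Proof.
move=> /subspace_continuousP cf /subspace_continuousP cg fXY.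
apply/subspace_continuousP => x Xx A nA.
have h1 : nbhs (f x) (fun y => Y y -> A (g y)) := cg _ (fXY x Xx) A nA.
have h2 : nbhs x (fun z => X z -> Y (f z) -> A (g (f z))) := cf x Xx _ h1.
suff : nbhs x (fun z => X z -> A (g (f z))) by [].
by apply: filterS h2 => z h Xz; apply: h => //; exact: fXY.
Qed.

Lemma within_eq (T U : topologicalType) (X : set T) (f g : T -> U) :
  (forall x, X x -> f x = g x) ->
  {within X, continuous f} -> {within X, continuous g}.
Proof.
move=> e /subspace_continuousP cf; apply/subspace_continuousP => x Xx A.
move=> nA; have {}nA : nbhs (f x) A by rewrite e.
have h : nbhs x (fun z => X z -> A (f z)) := cf x Xx A nA.
suff : nbhs x (fun z => X z -> A (g z)) by [].
by apply: filterS h => z h Xz; rewrite -e //; exact: h.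
Qed.

Lemma pt_hausdorff (V : choiceType) : hausdorff_space (pt R V).
Proof. by apply: hausdorff_product => v; exact: Rhausdorff. Qed.

Lemma inv_onK (V U : choiceType) (X : set (pt R V)) (f : pt R V -> pt R U) x :
  set_inj X f -> X x -> inv_on X f (f x) = x.
Proof. by move=> h Xx; apply: pinvKV => //; rewrite inE. Qed.

Lemma inv_on_in (V U : choiceType) (X : set (pt R V)) (Y : set (pt R U))
    (f : pt R V -> pt R U) y :
  set_bij X Y f -> Y y -> X (inv_on X f y) /\ f (inv_on X f y) = y.
Proof.
by case=> _ inj surj Yy; have [x Xx <-] := surj y Yy; rewrite inv_onK.
Qed.

Lemma homeo_compact (V U : choiceType) (X : set (pt R V)) (Y : set (pt R U))
    (f : pt R V -> pt R U) :
  compact X -> set_bij X Y f -> {within X, continuous f} -> homeo X Y f.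
Proof.
move=> cX bf cf; split=> //.
apply/continuous_closedP => C cC; apply/closed_subspaceP.
have [fun_f inj surj] := bf.
exists (f @` (X `&` C)).
  apply: compact_closed; first exact: pt_hausdorff.
  apply: continuous_compact; last exact: compact_closedI.
  by apply: continuous_subspaceW cf => x [].
rewrite predeqE => y; split=> [[[x [Xx Cx] <-] Yy]|[Cy Yy]].
  by split=> //; suff : C (inv_on X f (f x)) by []; rewrite inv_onK.
by split=> //; have [Xy fy] := inv_on_in bf Yy; exists (inv_on X f y).
Qed.

Section Realization.
Variables (V : choiceType) (K : set {fset V}) (F : {fset V}).
Hypothesis KF : forall s, K s -> (s `<=` F)%fset.

Lemma closed_coord (v : V) (C : set R) : closed C -> closed [set x : pt R V | C (x v)].
Proof. by move=> cC; have /continuous_closedP := @coord_continuous V v; apply. Qed.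

Lemma continuous_sum (I : Type) (r : seq I) (P : pred I) (f : I -> V) :
  continuous (fun x : pt R V => \sum_(i <- r | P i) (x (f i) : R)).
Proof.
elim: r => [|i r IH].
  have -> : (fun x : pt R V => \sum_(i <- [::] | P i) (x (f i) : R)) = (fun=> 0).
    by apply/funext => x; rewrite big_nil.
  exact: cst_continuous.
case Pi : (P i); last first.
  have -> // : (fun x : pt R V => \sum_(j <- i :: r | P j) (x (f j) : R)) =
      (fun x : pt R V => \sum_(j <- r | P j) (x (f j) : R)).
  by apply/funext => x; rewrite big_cons Pi.
have -> : (fun x : pt R V => \sum_(j <- i :: r | P j) (x (f j) : R)) =
    (fun x : pt R V => x (f i) + \sum_(j <- r | P j) (x (f j) : R)).
  by apply/funext => x; rewrite big_cons Pi.
move=> x; exact: (@cvgD R R _ (nbhs x) _ (fun y : pt R V => y (f i) : R)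
  (fun y : pt R V => \sum_(j <- r | P j) (y (f j) : R)) _ _
  (@coord_continuous _ (f i) x) (IH x)).
Qed.

Lemma realization_closed : closed (realization R K).
Proof.
have -> : realization R K =
    (\bigcap_(v in [set: V]) [set x : pt R V | 0 <= x v]) `&`
    \bigcup_(s in K) ((\bigcap_(v in [set v | v \notin s]) [set x : pt R V | x v = 0])
      `&` [set x : pt R V | \sum_(v <- s) x v = 1]).
  rewrite predeqE => x; split=> [[x0 [s Ks [xs x1]]]|[x0 [s Ks [xs x1]]]].
    by split=> [v _|] /=; [exact: x0|exists s].
  by split=> [v|]; [exact: x0|exists s].
apply: closedI.
  apply: closed_bigI => v _; apply: (@closed_coord v [set t | 0 <= t]).
  exact: closed_ge.
apply: closed_bigcup.
  apply: (@sub_finite_set _ _ [set` fpowerset F]); last exact: finite_fset.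
  by move=> s /KF; rewrite /= fpowersetE.
move=> s Ks; apply: closedI.
  apply: closed_bigI => v _; apply: (@closed_coord v [set t | t = 0]).
  exact: closed_eq.
apply: (iffLR (continuous_closedP _) (@continuous_sum V s xpredT id) [set t | t = 1]).
exact: closed_eq.
Qed.

(** A closed subset of a cube, which is compact for pointwise convergence by Tychonoff even when [V]
    is infinite. *)
Lemma realization_compact : compact (realization R K).
Proof.
pose box := [set x : pt R V | forall v, `[0, 1]%classic (x v : R)].
have cbox : compact (box : set (pt R V)).
  by apply: (@tychonoff V (fun=> R) (fun=> `[0, 1]%classic)) => v; exact: segment_compact.
have sbox : realization R K `<=` box.
  move=> x [x0 [s Ks [xs x1]]] v; rewrite /= in_itv /= x0 /=.
  case: (boolP (v \in s)) => [vs|/xs->//]; rewrite -x1.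
  by rewrite (big_fsetD1 v) //= lerDl sumr_ge0.
exact: (@subclosed_compact (pt R V) (realization R K) box realization_closed cbox sbox).
Qed.

Lemma realization_off x v : realization R K x -> v \notin F -> x v = 0.
Proof.
case=> _ [s /KF sF [xs _]] vF; apply: xs; apply: contra vF.
exact: (fsubsetP sF).
Qed.

End Realization.

Section SimplicialMap.
Variables (V U : choiceType).
Implicit Types (f : V -> U) (x : pt R V) (s : {fset V}).

(** The fibre may be infinite, and the sum over it is meaningful only for finite support; a finite
    bound [s] on the support of [x] makes it an ordinary sum. *)
Lemma simp_mapE f x s u : (forall v, v \notin s -> x v = 0) ->
  simp_map f x u = \sum_(v <- s | f v == u) x v.
Proof.
move=> xs; rewrite /simp_map (@fsbigE _ _ _ _ _ [seq v <- s | f v == u]).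
- rewrite big_filter_cond; apply: eq_bigl => v.
  by case: eqP => //= h; rewrite mem_set.
- exact: filter_uniq.
- by move=> v /=; rewrite mem_filter => /andP[/eqP].
- by move=> v /= fv; rewrite mem_filter fv eqxx /=; exact: xs.
Qed.

Lemma simp_map_eq f g x s : (forall v, v \notin s -> x v = 0) ->
  (forall v, x v != 0 -> f v = g v) -> simp_map f x = simp_map g x.
Proof.
move=> xs e; apply/funext => u; rewrite !(simp_mapE _ _ xs).
rewrite big_mkcond [RHS]big_mkcond; apply: eq_bigr => v _.
have [->|/e->//] := eqVneq (x v) 0; by rewrite !if_same.
Qed.

(** [gamma] and [delta] are injective on a subcomplex only. Injectivity is therefore taken relative
    to a set [D] that contains the support. *)
Lemma simp_map_inj f (D : set V) x v : set_inj D f ->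
  (forall w, x w != 0 -> D w) -> D v -> simp_map f x (f v) = x v.
Proof.
move=> inj xD Dv; rewrite /simp_map (@fsbigE _ _ _ _ _ [:: v]) //.
- by rewrite big_mkcond big_seq1 mem_set.
- by move=> w /=; rewrite inE => /eqP->.
- move=> w /= fw; rewrite inE; apply: contraNeq => /xD Dw.
  by apply/eqP; apply: inj; rewrite ?inE.
Qed.

Lemma simp_map_out f (D : set V) x u :
  (forall w, x w != 0 -> D w) -> ~ (f @` D) u -> simp_map f x u = 0.
Proof.
move=> xD uD; rewrite /simp_map (@fsbigE _ _ _ _ _ [::]) //; first by rewrite big_nil.
move=> w /= fw _; apply/eqP; apply: contra_notT uD => /xD Dw.
by exists w.
Qed.

Lemma simp_map_neq0 f (D : set V) x u : set_inj D f ->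
  (forall w, x w != 0 -> D w) -> simp_map f x u != 0 ->
  exists v, [/\ D v, x v != 0 & u = f v].
Proof.
move=> inj xD nu; have [v Dv e] : (f @` D) u.
  by apply: contrapT => /(simp_map_out xD) h; rewrite h eqxx in nu.
by exists v; split=> //; move: nu; rewrite -e (simp_map_inj inj xD Dv).
Qed.

Variables (f : V -> U) (D : set V) (K : set {fset V}).
Hypotheses (finj : set_inj D f) (KD : forall s v, K s -> v \in s -> D v).

Let fK : set {fset U} := [set [fset f v | v in s]%fset | s in K].

Lemma realization_supp x : realization R K x -> forall v, x v != 0 -> D v.
Proof.
case=> _ [s Ks [xs _]] v nv; apply: (KD Ks); apply: contraNT nv.
by move=> /xs->.
Qed.

Lemma simp_map_bij : set_bij (realization R K) (realization R fK) (simp_map f).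
Proof.
have finj' s : K s -> {in s &, injective f}.
  move=> Ks v w vs ws; apply: finj; rewrite inE; exact: KD Ks _.
split.
- move=> x hx; have xD := realization_supp hx.
  case: (hx) => x0 [s Ks [xs x1]]; split.
    move=> u; have [->//|/(simp_map_neq0 finj xD)[v [Dv _ ->]]] := eqVneq (simp_map f x u) 0.
    by rewrite (simp_map_inj finj xD Dv).
  exists [fset f v | v in s]%fset; first by exists s.
  split=> [u us|].
    apply/eqP; apply: contraNT us => /(simp_map_neq0 finj xD)[v [Dv xv ->]].
    by apply/imfsetP; exists v => //=; apply: contraNT xv => /xs->.
  rewrite big_imfset /=; last exact: finj'.
  rewrite -x1; apply: eq_big_seq => v vs; apply: (simp_map_inj finj xD).
  exact: KD Ks _.
- move=> x y; rewrite !inE => hx hy e; apply/funext => v.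
  have xD := realization_supp hx; have yD := realization_supp hy.
  have [Dv|nD] := pselect (D v).
    by rewrite -(simp_map_inj finj xD Dv) e (simp_map_inj finj yD Dv).
  have z (z : pt R V) : (forall v, z v != 0 -> D v) -> z v = 0.
    by move=> zD; apply/eqP; apply: contra_notT nD => /zD.
  by rewrite !z.
- move=> y [y0 [_ [s Ks <-] [ys y1]]].
  pose x : pt R V := fun v => if `[< D v >] then y (f v) else 0.
  have xs v : v \notin s -> x v = 0.
    move=> nv; rewrite /x; case: asboolP => // Dv; apply: ys; apply: contra nv.
    move=> /imfsetP[w /= ws e]; rewrite (finj _ _ e) ?inE //; exact: KD Ks _.
  have hx : realization R K x.
    split=> [v|]; first by rewrite /x; case: ifP.
    exists s => //; split=> //; move: y1; rewrite big_imfset /=; last exact: finj'.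
    move=> <-; apply: eq_big_seq => v vs; rewrite /x; case: asboolP => // -[].
    exact: KD Ks _.
  exists x => //; have xD := realization_supp hx.
  apply/funext => u; have [[v Dv <-]|nu] := pselect ((f @` D) u).
    by rewrite (simp_map_inj finj xD Dv) /x; case: asboolP.
  rewrite (simp_map_out xD nu) ys //; apply/negP => /imfsetP[v /= vs e].
  by apply: nu; exists v => //; exact: KD Ks _.
Qed.

Lemma simp_map_continuous (F : {fset V}) : (forall s, K s -> (s `<=` F)%fset) ->
  {within realization R K, continuous (simp_map f)}.
Proof.
move=> KF; apply: within_ptws => u.
apply: (@within_eq _ _ _ (fun x : pt R V => \sum_(v <- F | f v == u) x v)).
  move=> x hx; rewrite (@simp_mapE f x F) // => v; exact: (realization_off KF hx).
exact/continuous_subspaceT/continuous_sum.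
Qed.

End SimplicialMap.

Lemma simp_map_comp (V U W : choiceType) (f : V -> U) (g : U -> W)
    (x : pt R V) (s : {fset V}) : (forall v, v \notin s -> x v = 0) ->
  simp_map g (simp_map f x) = simp_map (fun v => g (f v)) x.
Proof.
move=> xs; apply/funext => w.
have ys u : u \notin [fset f v | v in s]%fset -> simp_map f x u = 0.
  move=> nu; rewrite (simp_mapE _ _ xs) big_seq_cond big1 // => v /andP[vs /eqP e].
  by case/negP: nu; apply/imfsetP; exists v.
rewrite (simp_mapE _ _ ys) (simp_mapE _ _ xs).
under eq_bigr do rewrite (simp_mapE _ _ xs).
rewrite (exchange_big_dep (fun v => g (f v) == w)) /=; last first.
  by move=> u v /eqP <- /eqP->.
rewrite big_seq_cond [RHS]big_seq_cond; apply: eq_bigr => v /andP[vs gv].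
rewrite (eq_bigl (pred1 (f v))); last first.
  move=> u /=; rewrite [RHS]eq_sym; case: (f v =P u) => [<-|_]; last by rewrite andbF.
  by rewrite gv.
rewrite (big_rem (f v)) /= ?eqxx; last by apply/imfsetP; exists v.
rewrite big_seq_cond big1 ?addr0 // => u /andP[+ /eqP e].
by rewrite mem_rem_uniq ?fset_uniq // inE e eqxx.
Qed.

End Geometry.

(** * Realizations of the subcomplexes *)

Section GeometricSubcomplexes.


Variable R : realType.
Implicit Types (r : round_counter) (S T V : {fset nat}) (L : set wseq).
Implicit Types (x y : pt R wseq) (s v : wseq).

Let P r := geom R (Pcx r).
Let X S r := geom R (Xcx S r).
Let B V r := geom R (Bcx V r).

Lemma geom_off r L x : L `<=` Pcx r -> geom R L x ->
  exists F : {fset wseq}, forall v, v \notin F -> x v = 0.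
Proof.
move=> LP hx; have [F hF] := vertices_fset r; exists F => v.
by apply: realization_off hx => _ [s /LP/hF h <-].
Qed.

Lemma geom_closed r L : L `<=` Pcx r -> closed (geom R L).
Proof.
move=> LP; have [F hF] := vertices_fset r.
by apply: (@realization_closed _ _ _ F) => _ [s /LP/hF h <-].
Qed.

Lemma geom_compact r L : L `<=` Pcx r -> compact (geom R L).
Proof.
move=> LP; have [F hF] := vertices_fset r.
by apply: (@realization_compact _ _ _ F) => _ [s /LP/hF h <-].
Qed.

Lemma geom_mono L L' x : L `<=` L' -> geom R L x -> geom R L' x.
Proof.
move=> LL [x0 [_ [s Ls <-] h]]; split=> //; exists (vertices s) => //.
by exists s => //; exact: LL.
Qed.

(* Full subcomplexes are recognized on the support of a point, so that identities
   between maps of realizations reduce to identities between vertex maps. *)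
Lemma geom_full r L : L `<=` Pcx r ->
  (forall s, Pcx r s -> L s <-> forall v, v \in vertices s -> L v) ->
  forall x, geom R L x <-> P r x /\ forall v, x v != 0 -> L v.
Proof.
move=> LP hL x; split=> [hx|[[x0 [_ [s Ps <-] [xs x1]]] xL]].
  split; first exact: geom_mono hx.
  apply: (realization_supp _ hx) => _ v [s Ls <-]; exact: (iffLR (hL s (LP s Ls)) Ls).
pose D := [fset v in vertices s | x v != 0]%fset.
have sD : (D `<=` vertices s)%fset by apply/fsubsetP => v; rewrite !inE => /andP[].
have [s' Ps' eD] := Pcx_face Ps sD.
have nD v : v \notin D -> x v = 0.
  by rewrite !inE negb_and => /orP[/xs//|]; rewrite negbK => /eqP.
split=> //; exists D; last first.
  split=> //; rewrite -x1; apply: big_fset_incl => // v _; exact: nD.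
exists s' => //; apply/hL => // v; rewrite eD => vD; apply: xL.
by move: vD; rewrite !inE => /andP[].
Qed.

Lemma X_le S r : Xcx S r `<=` Pcx r. Proof. by move=> s []. Qed.

Lemma B_le V r : Bcx V r `<=` Pcx r. Proof. by move=> s []. Qed.

Lemma X_full S r x : (S `<=` act r)%fset ->
  X S r x <-> P r x /\ forall v, x v != 0 -> Xcx S r v.
Proof. by move=> sS; apply: geom_full => [s []|s] //; exact: Xcx_vertices. Qed.

Lemma B_full V r x : (V `<=` finsupp r)%fset ->
  B V r x <-> P r x /\ forall v, x v != 0 -> Bcx V r v.
Proof. by move=> sV; apply: geom_full => [s []|s] //; exact: Bcx_vertices. Qed.

Lemma X_P S r x : X S r x -> P r x. Proof. by apply: geom_mono => s []. Qed.

Lemma B_P V r x : B V r x -> P r x. Proof. by apply: geom_mono => s []. Qed.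

Lemma P_supp r x v : P r x -> x v != 0 -> Pcx r v.
Proof.
by move=> hx; apply: (realization_supp _ hx) => _ w [s Ps <-]; exact: Pcx_vertex.
Qed.

Lemma X_supp S r x v : (S `<=` act r)%fset -> X S r x -> x v != 0 -> Xcx S r v.
Proof. by move=> sS /(X_full _ sS)[_]; apply. Qed.

Lemma B_supp V r x v : (V `<=` finsupp r)%fset -> B V r x -> x v != 0 -> Bcx V r v.
Proof. by move=> sS /(B_full _ sS)[_]; apply. Qed.

(** * Simplicial isomorphisms on realizations, for [gamma] and [delta] *)

Section Iso.
Variables (r : round_counter) (L L' : set wseq) (f : wseq -> wseq).
Hypotheses (LP : L `<=` Pcx r) (Lv : forall s v, L s -> v \in vertices s -> L v)
  (fL : forall s, L s -> L' (f s) /\ vertices (f s) = [fset f v | v in vertices s]%fset)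
  (fi : forall s s', L s -> L s' -> f s = f s' -> s = s')
  (fs : forall s, L' s -> exists2 s', L s' & f s' = s).

Let finj : set_inj L f.
Proof. by move=> s s'; rewrite !inE; exact: fi. Qed.

Let KD : forall (s : {fset wseq}) v, [set vertices s | s in L] s -> v \in s -> L v.
Proof. by move=> _ v [s Ls <-]; exact: Lv. Qed.

Lemma geom_iso_bij : set_bij (geom R L) (geom R L') (simp_map f).
Proof.
have := simp_map_bij R finj KD; rewrite /geom.
suff -> : [set [fset f v | v in s]%fset | s in [set vertices s | s in L]] =
    [set vertices s | s in L'] by [].
rewrite predeqE => D; split=> [[_ [s Ls <-] <-]|[s L's <-]].
  by have [L's <-] := fL Ls; exists (f s).
have [s' Ls' <-] := fs L's; have [_ ->] := fL Ls'.
by exists (vertices s') => //; exists s'.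
Qed.

Lemma geom_iso_continuous :
  {within geom R L, continuous (simp_map f : pt R wseq -> pt R wseq)}.
Proof.
have [F hF] := vertices_fset r.
by apply: (@simp_map_continuous _ _ _ _ _ F) => _ [s /LP/hF h <-].
Qed.

Lemma geom_iso_supp x u : geom R L x -> simp_map f x u != 0 ->
  exists v, [/\ L v, x v != 0 & u = f v].
Proof. by move=> hx; apply: (simp_map_neq0 finj); exact: (realization_supp KD hx). Qed.

Lemma geom_iso_val x v : geom R L x -> L v -> simp_map f x (f v) = x v.
Proof. by move=> hx; apply: (simp_map_inj finj); exact: (realization_supp KD hx). Qed.

End Iso.

Section Gamma.
Variables (S : {fset nat}) (r : round_counter).
Hypothesis sS : (S `<=` act r)%fset.

Let X_vert s v : Xcx S r s -> v \in vertices s -> Xcx S r v.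
Proof. by move=> h; have [P1 _] := h; move/(Xcx_vertices sS P1): h; apply. Qed.

Lemma gamma_bij : set_bij (X S r) (P (rc_dec r S)) (simp_map (gamma S)).
Proof.
apply: (geom_iso_bij X_vert) => [s|s s'|s].
- by move=> hs; apply: (gamma_iso sS hs).
- exact: gamma_inj.
- exact: gamma_surj.
Qed.

Lemma gamma_continuous :
  {within X S r, continuous (simp_map (gamma S) : pt R wseq -> pt R wseq)}.
Proof. exact: (geom_iso_continuous (@X_le S r)). Qed.

Lemma gamma_supp x u : X S r x -> simp_map (gamma S) x u != 0 ->
  exists v, [/\ Xcx S r v, x v != 0 & u = gamma S v].
Proof. by apply: (geom_iso_supp X_vert) => s s'; exact: gamma_inj. Qed.

Lemma gamma_val x v : X S r x -> Xcx S r v -> simp_map (gamma S) x (gamma S v) = x v.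
Proof. by apply: (geom_iso_val X_vert) => s s'; exact: gamma_inj. Qed.

Lemma gamma_P x : X S r x -> P (rc_dec r S) (simp_map (gamma S) x).
Proof. by have [h _ _] := gamma_bij; exact: h. Qed.

End Gamma.

Section Delta.
Variables (V : {fset nat}) (r : round_counter).
Hypothesis sV : (V `<=` finsupp r)%fset.

Let B_vert s v : Bcx V r s -> v \in vertices s -> Bcx V r v.
Proof. by move=> h; have [P1 _] := h; move/(Bcx_vertices sV P1): h; apply. Qed.

Lemma delta_bij : set_bij (B V r) (P (rc_del r V)) (simp_map (delta V)).
Proof.
apply: (geom_iso_bij B_vert) => [s|s s'|s].
- by move=> hs; apply: (delta_iso hs).
- exact: delta_inj.
- exact: delta_surj.
Qed.

Lemma delta_supp x u : B V r x -> simp_map (delta V) x u != 0 ->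
  exists v, [/\ Bcx V r v, x v != 0 & u = delta V v].
Proof. by apply: (geom_iso_supp B_vert) => s s'; exact: delta_inj. Qed.

Lemma delta_val x v : B V r x -> Bcx V r v -> simp_map (delta V) x (delta V v) = x v.
Proof. by apply: (geom_iso_val B_vert) => s s'; exact: delta_inj. Qed.

Lemma delta_P x : B V r x -> P (rc_del r V) (simp_map (delta V) x).
Proof. by have [h _ _] := delta_bij; exact: h. Qed.

End Delta.

Lemma simp_map_id x : simp_map id x = x.
Proof.
apply/funext => u; rewrite /simp_map (@fsbigE _ _ _ _ _ [:: u]) //.
- by rewrite big_mkcond big_seq1 mem_set.
- by move=> w /=; rewrite inE => /eqP->.
- by move=> w /= ->; rewrite inE eqxx.
Qed.

Lemma X_empty r x : P r x -> X fset0 r x /\ simp_map (gamma fset0) x = x.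
Proof.
move=> hx; have [F xF] := geom_off (@subset_refl _ _) hx; split.
  case: hx => x0 [_ [s Ps <-] h]; split=> //; exists (vertices s) => //.
  by exists s => //; case: (Xcx0 Ps).
rewrite -[RHS]simp_map_id; apply: (simp_map_eq xF) => v /(P_supp hx) Pv.
by case: (Xcx0 Pv).
Qed.

Lemma B_empty r x : P r x -> B fset0 r x.
Proof. by apply: geom_mono => s; exact: Bcx0. Qed.

Lemma X_cover V r x : ~~ (act r `<=` V)%fset -> B V r x ->
  exists S, [/\ S != fset0, (S `<=` act r)%fset, fdisjoint S V & X S r x].
Proof.
move=> nV [x0 [_ [s Bs <-] h]]; have [S [S0 sS dS Xs]] := Xcx_cover nV Bs.
by exists S; split=> //; split=> //; exists (vertices s) => //; exists s.
Qed.

Lemma X_union S T r x : (S `<=` act r)%fset -> (T `<=` act r)%fset ->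
  X S r x -> X T r x -> X (S `|` T)%fset r x.
Proof.
move=> sS sT hS hT; apply/X_full; first by rewrite fsubUset sS.
split; first exact: X_P hS.
by move=> v nv; apply: Xcx_union; [exact: X_supp hS nv|exact: X_supp hT nv].
Qed.

Lemma X_sub S T r x : (S `<=` act r)%fset -> (T `<=` S)%fset -> T != S ->
  X S r x -> X T r x <-> B T (rc_dec r S) (simp_map (gamma S) x).
Proof.
move=> sS sT nT hS; have sTA := fsubset_trans sT sS.
have sTU : (T `<=` finsupp (rc_dec r S))%fset.
  by rewrite finsupp_dec (fsubset_trans sTA) // act_sub.
split=> [hT|hB].
  apply/B_full => //; split; first exact: gamma_P.
  move=> u /(gamma_supp sS hS)[v [Sv nv ->]]; apply/(Xcx_sub sS sT nT Sv).
  exact: X_supp hT nv.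
apply/X_full => //; split; first exact: X_P hS.
move=> v nv; have Sv := X_supp sS hS nv.
apply/(Xcx_sub sS sT nT Sv); apply: (B_supp sTU hB).
by rewrite (gamma_val sS hS Sv).
Qed.

Lemma X_cap S T r x : (S `<=` act r)%fset -> (T `<=` S)%fset -> T != S ->
  X S r x -> X T r x ->
  [/\ B T (rc_dec r T) (simp_map (gamma T) x),
      X (S `\` T)%fset (rc_del r T) (simp_map (delta T) (simp_map (gamma T) x)) &
      simp_map (gamma (S `\` T)%fset) (simp_map (delta T) (simp_map (gamma T) x)) =
      simp_map (delta T) (simp_map (gamma S) x)].
Proof.
move=> sS sT nT hS hT; have sTA := fsubset_trans sT sS.
have sTU : (T `<=` finsupp (rc_dec r T))%fset.
  by rewrite finsupp_dec (fsubset_trans sTA) // act_sub.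
have H v : x v != 0 -> [/\ Bcx T (rc_dec r T) (gamma T v),
      Xcx (S `\` T)%fset (rc_del r T) (delta T (gamma T v)) &
      gamma (S `\` T)%fset (delta T (gamma T v)) = delta T (gamma S v)].
  by move=> nv; apply: (Xcx_cap sS sT nT); [exact: X_supp hS nv|exact: X_supp hT nv].
have hB : B T (rc_dec r T) (simp_map (gamma T) x).
  apply/B_full => //; split; first exact: gamma_P.
  by move=> u /(gamma_supp sTA hT)[v [_ nv ->]]; case: (H v nv).
split=> //.
  apply/X_full; first by rewrite act_del fsetSD.
  split; first by rewrite /P -(del_dec r T); exact: delta_P.
  move=> w /(delta_supp sTU hB)[u [_ + ->]] => /(gamma_supp sTA hT)[v [_ nv ->]].
  by case: (H v nv).
have [F xF] := geom_off (@X_le _ _) hS.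
have [G gG] := geom_off (@B_le _ _) hB.
rewrite (simp_map_comp _ _ gG) (simp_map_comp _ _ xF) (simp_map_comp _ _ xF).
by apply: (simp_map_eq xF) => v nv; case: (H v nv).
Qed.

Lemma X_delta S V r x : (S `<=` act r)%fset -> (V `<=` finsupp r)%fset ->
  fdisjoint S V -> B V r x -> X S r x ->
  [/\ B V (rc_dec r S) (simp_map (gamma S) x),
      X S (rc_del r V) (simp_map (delta V) x) &
      simp_map (gamma S) (simp_map (delta V) x) =
      simp_map (delta V) (simp_map (gamma S) x)].
Proof.
move=> sS sV dSV hB hX.
have H v : x v != 0 -> [/\ Bcx V (rc_dec r S) (gamma S v),
      Xcx S (rc_del r V) (delta V v) &
      gamma S (delta V v) = delta V (gamma S v)].
  by move=> nv; apply: (gamma_delta sS dSV); [exact: B_supp hB nv|exact: X_supp hX nv].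
split.
- apply/B_full; first by rewrite finsupp_dec.
  split; first exact: gamma_P.
  by move=> u /(gamma_supp sS hX)[v [_ nv ->]]; case: (H v nv).
- apply/X_full.
    rewrite act_del; apply/fsubsetP => p pS; rewrite inE (fsubsetP sS) // andbT.
    by apply/negP; move/disjP: dSV; apply.
  split; first exact: delta_P.
  by move=> u /(delta_supp sV hB)[v [_ nv ->]]; case: (H v nv).
have [F xF] := geom_off (@X_le _ _) hX.
rewrite !(simp_map_comp _ _ xF).
by apply: (simp_map_eq xF) => v nv; case: (H v nv).
Qed.

Lemma B_act S V r x : (act r `<=` V)%fset -> (V `<=` finsupp r)%fset ->
  (S `<=` act r)%fset -> B V r x ->
  [/\ X S r x, simp_map (gamma S) x = x & B V (rc_dec r S) x].
Proof.
move=> sV sVU sS hB.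
have H v : x v != 0 -> [/\ Xcx S r v, gamma S v = v & Bcx V (rc_dec r S) v].
  by move=> nv; apply: (Bcx_act sV sS); exact: B_supp hB nv.
have hX : X S r x.
  apply/X_full => //; split; first exact: B_P hB.
  by move=> v nv; case: (H v nv).
have e : simp_map (gamma S) x = x.
  have [F xF] := geom_off (@X_le _ _) hX.
  rewrite -[RHS]simp_map_id; apply: (simp_map_eq xF) => v nv.
  by case: (H v nv).
split=> //; apply/B_full; first by rewrite finsupp_dec.
split; first by rewrite -e; exact: gamma_P.
by move=> v nv; case: (H v nv).
Qed.

End GeometricSubcomplexes.

(** * Joins *)

Section Joins.


Variable R : realType.

Lemma simplexP (A : {fset nat}) (y : pt R nat) : simplex R A y <->
  [/\ forall p, 0 <= y p, forall p, p \notin A -> y p = 0 &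
      \sum_(p <- A) y p = 1].
Proof.
split=> [[y0 [s sA [ys y1]]]|[y0 yA y1]]; last by split=> //; exists A => /=.
split=> // [p pA|].
  by apply: ys; apply: contra pA; exact: (fsubsetP sA).
by rewrite -y1; apply/esym/big_fset_incl => // p _ /ys.
Qed.

Lemma simplex_compact (A : {fset nat}) : compact (simplex R A).
Proof. exact: (@realization_compact R _ _ A). Qed.

Lemma simplex_le1 (A : {fset nat}) (y : pt R nat) p : simplex R A y -> y p <= 1.
Proof.
move=> /simplexP[y0 yA <-]; have [pA|/yA->] := boolP (p \in A).
  by rewrite (big_fsetD1 p) //= lerDl sumr_ge0.
exact: sumr_ge0.
Qed.

Lemma simp_mapZ (V U : choiceType) (f : V -> U) (c : R) (x : pt R V) (s : {fset V}) :
  (forall v, v \notin s -> x v = 0) ->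
  simp_map f (fun v => c * x v) = (fun u => c * simp_map f x u) :> pt R U.
Proof.
move=> xs; apply/funext => u; rewrite (simp_mapE _ _ xs) mulr_sumr.
by apply: simp_mapE => v /xs->; rewrite mulr0.
Qed.

(** With a single active element [a], the last round of a nonempty normal list contains [a]. This
    shows that passive vertices have no rounds. *)
Lemma normal_fset1_nil a (L : seq {fset nat}) :
  normal [fset a]%fset L -> occ a L = 0%N -> L = [::].
Proof.
elim: L => // Q L IH /= /andP[nQ /IH{}IH] /eqP; rewrite addn_eq0 => /andP[aQ /eqP/IH e].
move: nQ; rewrite e fsetU0 => /disjNP[p pQ]; rewrite inE => /eqP e'.
by rewrite -e' pQ in aQ.
Qed.

Section ChiVertices.
Variables A B : {fset nat}.
Hypothesis dAB : fdisjoint A B.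

Let r := chi2 A B.
Let U := (A `|` B)%fset.

(* A point of [P(chi2 A B) = P(chi1 A) * simplex B] is
   [act_mass x . act_link x + pass_part x]. *)
Definition pass_vertex (b : nat) : wseq := of_rounds U [fset b]%fset [::].

Lemma BU : (B `<=` finsupp r)%fset.
Proof. by rewrite finsupp_chi2 fsubsetUr. Qed.

Lemma chi2_del : rc_del r B = chi1 A.
Proof.
rewrite /r del_chi2 /chi1 fsetDv; congr chi2; apply/fsetDidPl; exact: dAB.
Qed.

Lemma valid_pass_vertex b : b \in B -> valid r [fset b]%fset [::].
Proof.
move=> bB; split=> //=.
  by rewrite fsub1set finsupp_chi2 inE bB orbT.
move=> p; rewrite inE => /eqP->; rewrite rval_chi2.
by case bA : (b \in A) => //; move/disjP/(_ b bA): dAB.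
Qed.

Lemma pass_vertex_join b : b \in B -> join_vertex B (pass_vertex b) = inr b.
Proof. by move=> bB; rewrite join_vertex_of_rounds ?bB //; exact: valid_pass_vertex. Qed.

Lemma pass_vertex_B b : b \in B -> ~ Bcx B r (pass_vertex b).
Proof.
move=> bB; rewrite /pass_vertex /U -finsupp_chi2.
move=> /(Bcx_of_rounds _ (valid_pass_vertex bB))[_].
by move=> /disjP/(_ b bB); apply; rewrite !inE eqxx.
Qed.

(** The two kinds of vertices of the join: the vertices of the simplex on [B], and those of the
    other factor, which is realized inside [P(r)] as [B_B(r)]. *)
Variant chi_vertex (v : wseq) : Prop :=
| ChiB b of b \in B & v = pass_vertex b & join_vertex B v = inr b
| ChiA a L of a \in A & valid r [fset a]%fset L & v = of_rounds U [fset a]%fset L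
  & Bcx B r v & join_vertex B v = inl (delta B v).

Lemma vertexP s v : Pcx r s -> v \in vertices s -> chi_vertex v.
Proof.
case/PcxP => A' [L [h ->]] /(verticesP _ h)[a aA ->].
have h' := valid_vertex h aA; rewrite finsupp_chi2 -/U.
have [aB|aB] := boolP (a \in B).
  have e : norm [fset a]%fset L = [::].
    have [_ h2 _ h4] := h'; apply: (normal_fset1_nil h2).
    rewrite h4 ?inE // rval_chi2; case a1 : (a \in A) => //.
    by move/disjP/(_ a a1): dAB.
  rewrite e; apply: (ChiB aB) => //; exact: pass_vertex_join.
have aA' : a \in A.
  have [/fsubsetP/(_ a aA) + _ _ _] := h.
  by rewrite finsupp_chi2 inE (negbTE aB) orbF.
have d : fdisjoint B ([fset a] `|` union (norm [fset a] L))%fset.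
  have sL := valid_union h'; rewrite act_chi2 in sL.
  apply/disjP => p pB; rewrite !inE => /orP[/eqP e|/(fsubsetP sL) pA].
    by rewrite -e pB in aB.
  by move/disjP/(_ p pA): dAB.
apply: (ChiA aA' h') => //.
  by rewrite /U -finsupp_chi2; apply/(Bcx_of_rounds _ h'); rewrite BU.
rewrite join_vertex_of_rounds // (negbTE aB) delta_of_rounds //; congr (inl (of_rounds _ _ _)).
apply/fsetP => p; rewrite !inE; case pB : (p \in B); rewrite ?orbF //=.
by apply/negP => pA; move/disjP/(_ p pA): dAB.
Qed.

Lemma supp_vertexP (x : pt R wseq) v : geom R (Pcx r) x -> x v != 0 -> chi_vertex v.
Proof.
move=> [_ [_ [s Ps <-] [xs _]]] nv; apply: (vertexP Ps); apply: contraNT nv.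
by move=> /xs->.
Qed.

Definition act_part (x : pt R wseq) : pt R wseq :=
  fun v => if `[< Bcx B r v >] then x v else 0.

(** As the complement of finitely many coordinates it is visibly continuous; [sum_act_part]
    identifies it with the total weight of [act_part x]. *)
Definition act_mass (x : pt R wseq) : R := 1 - \sum_(b <- B) x (pass_vertex b).

(** For mass [0] this is the zero function rather than a point of [P(chi1 A)]; the formula for
    [tau_join] then multiplies the term by [0]. *)
Definition act_link (x : pt R wseq) : pt R wseq :=
  fun v => (act_mass x)^-1 * simp_map (delta B) (act_part x) v.

Definition pass_part (x : pt R wseq) : pt R nat :=
  fun p => if p \in B then x (pass_vertex p) else 0.

Lemma act_part_off x (F : {fset wseq}) : (forall v, v \notin F -> x v = 0) ->
  forall v, v \notin F -> act_part x v = 0.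
Proof. by move=> xF v /xF; rewrite /act_part => ->; rewrite if_same. Qed.

Section Point.
Variables (x : pt R wseq) (F : {fset wseq}).
Hypotheses (hx : geom R (Pcx r) x) (xF : forall v, v \notin F -> x v = 0).

Lemma join_inl w : simp_map (join_vertex B) x (inl w) = simp_map (delta B) (act_part x) w.
Proof.
rewrite (simp_mapE _ _ xF) (simp_mapE _ _ (act_part_off xF)).
rewrite big_mkcond [RHS]big_mkcond; apply: eq_bigr => v _.
have [x0|nv] := eqVneq (x v) 0; first by rewrite /act_part x0 !if_same.
case: (supp_vertexP hx nv) => [b bB ev ->|a L _ _ _ Bv ->].
  rewrite /act_part; case: asboolP => [|_]; last by rewrite if_same.
  by rewrite ev => /(pass_vertex_B bB).
by rewrite /act_part; case: asboolP.
Qed.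

Lemma join_inr p : simp_map (join_vertex B) x (inr p) = pass_part x p.
Proof.
rewrite /pass_part /simp_map; case: ifP => pB.
  rewrite (@fsbigE _ _ _ _ _ [:: pass_vertex p]) //.
  - by rewrite big_mkcond big_seq1 mem_set //; exact: pass_vertex_join.
  - by move=> w /=; rewrite inE => /eqP->; exact: pass_vertex_join.
  move=> v /= ev; rewrite inE; apply: contraNeq => nv; move: ev.
  by case: (supp_vertexP hx nv) => [b bB -> ->|a L _ _ _ _ ->] // [->].
rewrite (@fsbigE _ _ _ _ _ [::]) //; first by rewrite big_nil.
move=> v /= ev _; apply/eqP; apply: contraFT pB => nv; move: ev.
by case: (supp_vertexP hx nv) => [b bB _ ->|a L _ _ _ _ ->] // [<-].
Qed.

(** The coordinates of [x] add up to [1], and [x - act_part x] is supported on the passive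
    vertices. *)
Lemma sum_act_part : \sum_(v <- F) act_part x v = act_mass x.
Proof.
have [_ [_ [s Ps <-] [xs x1]]] := hx.
have binj : {in B &, injective pass_vertex}.
  by move=> b c bB cB e; move: (pass_vertex_join bB); rewrite e pass_vertex_join // => -[].
set G := [fset pass_vertex b | b in B]%fset.
have eB : \sum_(b <- B) x (pass_vertex b) = \sum_(v <- F) (x v - act_part x v).
  transitivity (\sum_(v <- G) (x v - act_part x v)).
    rewrite big_imfset //=; apply: eq_big_seq => b bB.
    by rewrite /act_part; case: asboolP => [/(pass_vertex_B bB)//|_]; rewrite subr0.
  transitivity (\sum_(v <- (G `|` F)%fset) (x v - act_part x v)).
    apply: big_fset_incl => [|v _ vG]; first exact: fsubsetUl.
    have [x0|nv] := eqVneq (x v) 0; first by rewrite /act_part x0 if_same subr0.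
    case: (supp_vertexP hx nv) => [b bB ev _|a L _ _ _ Bv _].
      by case/negP: vG; apply/imfsetP; exists b.
    by rewrite /act_part; case: asboolP => // _; rewrite subrr.
  apply/esym/big_fset_incl => [|v _ vF]; first exact: fsubsetUr.
  by rewrite (act_part_off xF) // xF // subr0.
rewrite /act_mass eB sumrB.
have -> : \sum_(v <- F) x v = 1.
  rewrite -x1; transitivity (\sum_(v <- (F `|` vertices s)%fset) x v).
    by apply: big_fset_incl => [|v _ /xF//]; exact: fsubsetUl.
  by apply/esym/big_fset_incl => [|v _ /xs//]; exact: fsubsetUr.
by rewrite opprB addrC subrK.
Qed.

End Point.

Section Point.
Variables (x : pt R wseq).
Hypotheses (hx : geom R (Pcx r) x).

Lemma act_part_ge0 v : 0 <= act_part x v.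
Proof. by have [x0 _] := hx; rewrite /act_part; case: ifP. Qed.

Lemma act_mass_ge0 : 0 <= act_mass x.
Proof.
have [F xF] := geom_off (@subset_refl _ _) hx.
by rewrite -(sum_act_part hx xF); apply: sumr_ge0 => v _; exact: act_part_ge0.
Qed.

Lemma act_part_B : act_mass x != 0 ->
  geom R (Bcx B r) (fun v => (act_mass x)^-1 * act_part x v).
Proof.
move=> m0; have [_ [_ [s Ps <-] [xs x1]]] := hx.
pose D := [fset v in vertices s | `[< Bcx B r v >]]%fset.
have sD : (D `<=` vertices s)%fset by apply/fsubsetP => v; rewrite !inE => /andP[].
have [s' Ps' eD] := Pcx_face Ps sD.
have nD v : v \notin D -> act_part x v = 0.
  rewrite !inE negb_and /act_part => /orP[/xs->|/negbTE->//]; exact: if_same.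
split=> [v|]; first by rewrite mulr_ge0 ?invr_ge0 ?act_mass_ge0 // act_part_ge0.
exists D.
  exists s' => //; apply/(Bcx_vertices BU Ps') => v; rewrite eD !inE.
  by move=> /andP[_ /asboolP].
split=> [v /nD->|]; first by rewrite mulr0.
rewrite -mulr_sumr (_ : \sum_(v <- D) _ = act_mass x) ?mulVf //.
rewrite -(sum_act_part hx xs); apply: big_fset_incl => // v _; exact: nD.
Qed.

Lemma act_link_delta : act_link x =
  simp_map (delta B) (fun v => (act_mass x)^-1 * act_part x v).
Proof.
have [F xF] := geom_off (@subset_refl _ _) hx.
by rewrite [RHS](simp_mapZ _ _ (act_part_off xF)).
Qed.

Lemma act_link_P : act_mass x != 0 ->
  geom R (Pcx (chi1 A)) (act_link x).
Proof.
by move=> /act_part_B h; rewrite act_link_delta -chi2_del; apply: delta_P h; exact: BU.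
Qed.

Variable tau : {fset nat} -> pt R wseq -> pt R nat.

Lemma massl_join : massl (simp_map (join_vertex B) x) = act_mass x.
Proof.
have [F xF] := geom_off (@subset_refl _ _) hx.
rewrite /massl -(sum_act_part hx xF).
have E w : simp_map (join_vertex B) x (inl w) = simp_map (delta B) (act_part x) w.
  exact: join_inl hx xF w.
under eq_fsbigr do rewrite E.
have xF' := act_part_off xF.
have off u : u \notin [fset delta B v | v in F]%fset ->
    simp_map (delta B) (act_part x) u = 0.
  move=> nu; rewrite (simp_mapE _ _ xF') big_seq_cond big1 // => v /andP[vF /eqP e].
  by case/negP: nu; apply/imfsetP; exists v.
rewrite (@fsbigE _ _ _ _ _ [fset delta B v | v in F]%fset _ (fset_uniq _)) //;
  last by move=> u _; exact: off.
under eq_bigr do rewrite (simp_mapE _ _ xF').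
rewrite (exchange_big_dep xpredT) //=; apply: eq_big_seq => v vF.
rewrite (big_rem (delta B v)) /=; last by apply/imfsetP; exists v.
rewrite mem_set // eqxx /= big_seq_cond big1 ?addr0 // => u /andP[+ /andP[_ /eqP e]].
by rewrite mem_rem_uniq ?fset_uniq // inE e eqxx.
Qed.

Lemma massr_join : massr (simp_map (join_vertex B) x) = \sum_(b <- B) x (pass_vertex b).
Proof.
rewrite /massr (@fsbigE _ _ _ _ _ B _ (fset_uniq _)) //;
  last by move=> p _ pB; have [F xF] := geom_off (@subset_refl _ _) hx;
    rewrite (join_inr hx) /pass_part (negbTE pB).
under eq_bigl do rewrite in_setT.
by apply: eq_big_seq => p pB; rewrite (join_inr hx) /pass_part pB.
Qed.

(** The form in which joins are used from here on: no disjoint sum of vertex sets appears any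
    more. *)
Lemma tau_joinE p : tau_join tau A B x p =
  act_mass x * tau A (act_link x) p + pass_part x p.
Proof.
have [F xF] := geom_off (@subset_refl _ _) hx.
rewrite /tau_join {1}/simp_map (@fsbigE _ _ _ _ _ [:: inl p; inr p]) //; last 2 first.
- by move=> w /=; rewrite !inE => /orP[] /eqP->.
- by move=> [q|q] /= ->; rewrite !inE eqxx ?orbT.
rewrite big_cons big_cons big_nil !mem_set //= addr0 massl_join massr_join.
have -> : (fun v => (act_mass x)^-1 * simp_map (join_vertex B) x (inl v)) =
    act_link x.
  by apply/funext => v; rewrite /act_link (join_inl hx xF).
congr (_ + _); rewrite (join_inr hx).
(* If the passive mass is [0], so are all passive coordinates, since they are nonnegative; the
   scalar factor makes the join term vanish too. *)
have [s0|s0] := eqVneq (\sum_(b <- B) x (pass_vertex b)) 0; last by rewrite mulVKf.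
rewrite s0 mul0r /pass_part; case: ifP => // pB; move/eqP: s0.
rewrite psumr_eq0; last by move=> b _; have [x0 _] := hx.
by move=> /allP/(_ p pB) /= /eqP->.
Qed.

End Point.

End ChiVertices.

End Joins.

(** * The homeomorphism from [P(chi2 A B)] to the simplex *)

Section TauJoin.


Variable R : realType.
Variable tau : {fset nat} -> pt R wseq -> pt R nat.
Hypothesis htau : tau_family tau.

Lemma normal_mono (A A' : {fset nat}) L : (A `<=` A')%fset -> normal A L -> normal A' L.
Proof.
move=> sA; elim: L => //= Q L IH /andP[/disjNP[p pQ pA] /IH->]; rewrite andbT.
apply/disjNP; exists p => //; move: pA; rewrite !inE => /orP[/(fsubsetP sA)->//|->].
by rewrite orbT.
Qed.

Section Fixed.
Variables A B : {fset nat}.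
Hypothesis dAB : fdisjoint A B.
Let r := chi2 A B.
Let U := (A `|` B)%fset.
Notation beta := (pass_vertex A B).
Notation coneA := (act_mass A B).
Notation partA := (act_part A B).
Notation link := (act_link A B).
Notation tail := (pass_part A B).
Let th : pt R wseq -> pt R nat := tau_join tau A B.

(** Elements of [B] take part in no round, so they can be added to the active set with the rounds
    unchanged. This provides a simplex to carry the preimage built in [tau_join_surj]. *)
Lemma join_simplex A' L : valid r A' L -> (A' `<=` A)%fset ->
  exists2 s, Pcx r s &
    vertices s = (vertices (of_rounds U A' L) `|` [fset beta b | b in B])%fset.
Proof.
move=> h sA'; have eU : U = finsupp r by rewrite finsupp_chi2.
have sL : (union L `<=` A)%fset by rewrite -(act_chi2 A B); exact: valid_union h.
have h' : valid r (A' `|` B)%fset L.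
  case: h => h1 h2 h3 h4; split=> //.
  - by rewrite fsubUset h1 finsupp_chi2 fsubsetUr.
  - by apply: normal_mono h2; exact: fsubsetUl.
  - move=> p; rewrite inE => /orP[/h4//|pB].
    rewrite rval_chi2; have pA : p \notin A.
      by apply/negP => pA; move/disjP/(_ p pA): dAB.
    rewrite (negbTE pA); apply/eqP; rewrite occ_eq0; apply: contra pA.
    exact: (fsubsetP sL).
have eB b : b \in B -> norm [fset b]%fset L = [::].
  move=> bB; apply: norm_nil; apply/disjP => p /(fsubsetP sL) pA.
  by rewrite inE => /eqP e; rewrite e in pA; move/disjP/(_ b pA): dAB.
exists (of_rounds U (A' `|` B)%fset L); first by rewrite eU; exact: Pcx_of_rounds.
rewrite eU; apply/fsetP => v; rewrite inE; apply/(verticesP _ h')/orP.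
  move=> [a]; rewrite inE => /orP[aA ->|aB ->].
    by left; apply/(verticesP _ h); exists a.
  by right; apply/imfsetP; exists a; rewrite //= eB // -eU.
move=> [/(verticesP _ h)[a aA ->]|/imfsetP[b /= bB ->]].
  by exists a; rewrite // inE aA.
by exists b; rewrite ?inE ?bB ?orbT // eB // /pass_vertex -/U eU.
Qed.

Lemma tau_join_val x p : geom R (Pcx r) x -> th x p = coneA x * tau A (link x) p + tail x p.
Proof. by move=> hx; apply: tau_joinE. Qed.

Lemma tau_act_link x : geom R (Pcx r) x -> coneA x != 0 -> simplex R A (tau A (link x)).
Proof.
by move=> hx m0; have [[h _ _] _ _] := htau.1 A; exact: (h _ (act_link_P dAB hx m0)).
Qed.

Lemma tau_join_simplex x : geom R (Pcx r) x -> simplex R U (th x).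
Proof.
move=> hx; have [x0 _] := hx; have m0 := act_mass_ge0 dAB hx; apply/simplexP.
have tau_p p : 0 <= coneA x * tau A (link x) p.
  have [->|m1] := eqVneq (coneA x) 0; first by rewrite mul0r.
  by rewrite mulr_ge0 //; case: (tau_act_link hx m1).
split=> [p|p pU|].
- by rewrite tau_join_val // addr_ge0 // /pass_part; case: ifP.
- rewrite tau_join_val // /pass_part; move: pU; rewrite inE negb_or => /andP[pA /negbTE->].
  have [->|m1] := eqVneq (coneA x) 0; first by rewrite mul0r addr0.
  by have /simplexP[_ ->] := tau_act_link hx m1; rewrite // mulr0 addr0.
- under eq_bigr do rewrite tau_join_val //.
  rewrite big_split /= -mulr_sumr.
  have -> : \sum_(p <- U) tail x p = \sum_(b <- B) x (beta b).
    rewrite [RHS](_ : _ = \sum_(b <- B) tail x b); last first.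
      by apply: eq_big_seq => b bB; rewrite /pass_part bB.
    apply/esym/big_fset_incl; first exact: fsubsetUr.
    by move=> p _ /negbTE pB; rewrite /pass_part pB.
  have [m1|m1] := eqVneq (coneA x) 0.
    rewrite m1 mul0r add0r; move/eqP: m1; rewrite /act_mass subr_eq0.
    by move/eqP->.
  have /simplexP[_ tA tau1] := tau_act_link hx m1.
  have -> : \sum_(p <- U) tau A (link x) p = 1.
    rewrite -tau1; apply/esym/big_fset_incl; first exact: fsubsetUl.
    by move=> p _ /tA.
  by rewrite mulr1 /act_mass subrK.
Qed.

(** [tau A] takes values in the simplex on [A], so the image shows the passive coordinates of [x]
    unaltered. *)
Lemma tau_join_tail x b : geom R (Pcx r) x -> b \in B -> th x b = x (beta b).
Proof.
move=> hx bB; rewrite tau_join_val // /pass_part bB.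
have [->|m1] := eqVneq (coneA x) 0; first by rewrite mul0r add0r.
have /simplexP[_ tA _] := tau_act_link hx m1.
have bA : b \notin A by apply/negP => bA; move/disjP/(_ b bA): dAB.
by rewrite tA // mulr0 add0r.
Qed.

Lemma act_part_eq x y : geom R (Pcx r) x -> geom R (Pcx r) y ->
  partA x = partA y -> (forall b, b \in B -> x (beta b) = y (beta b)) -> x = y.
Proof.
move=> hx hy e eb; apply/funext => v.
have H z : geom R (Pcx r) z -> ~ Bcx B r v -> z v != 0 ->
    exists2 b, b \in B & v = beta b.
  move=> hz nB nz; case: (supp_vertexP dAB hz nz) => [b bB -> _|a L _ _ _ Bv _].
    by exists b.
  by [].
have [Bv|nB] := pselect (Bcx B r v).
  move/(congr1 (fun z : pt R wseq => z v)): e; rewrite /act_part.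
  by case: asboolP.
have [x0|nx] := eqVneq (x v) 0; last by have [b bB ->] := H x hx nB nx; exact: eb.
have [y0|ny] := eqVneq (y v) 0; first by rewrite x0 y0.
by have [b bB ->] := H y hy nB ny; exact: eb.
Qed.

Lemma act_part0 x : geom R (Pcx r) x -> coneA x = 0 -> partA x = (fun=> 0) :> pt R wseq.
Proof.
move=> hx m0; have [F xF] := geom_off (@subset_refl _ _) hx.
have := sum_act_part dAB hx xF; rewrite m0 => /eqP.
rewrite psumr_eq0; last by move=> v _; exact: act_part_ge0.
move=> /allP h; apply/funext => v; have [vF|vF] := boolP (v \in F).
  by move/eqP: (h v vF).
by rewrite /act_part xF // if_same.
Qed.

(** The passive coordinates can be read off the image, and they determine [act_mass]. If it is
    nonzero, subtracting and rescaling leaves [tau A] of the link, and [tau A] and [delta B] are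
    injective. *)
Lemma tau_join_inj : set_inj (geom R (Pcx r)) th.
Proof.
move=> x y; rewrite !inE => hx hy e.
have eb b : b \in B -> x (beta b) = y (beta b).
  by move=> bB; rewrite -(tau_join_tail hx bB) e tau_join_tail.
have em : coneA x = coneA y.
  by rewrite /act_mass; congr (_ - _); apply: eq_big_seq => b /eb.
apply: act_part_eq => //; have [m0|m0] := eqVneq (coneA x) 0.
  by rewrite !act_part0 // -em.
have m0' : coneA y != 0 by rewrite -em.
have et : tail x = tail y.
  by apply/funext => p; rewrite /pass_part; case: ifP => // /eb.
have : tau A (link x) = tau A (link y).
  apply/funext => p; move/(congr1 (fun z : pt R nat => z p)): e.
  by rewrite !tau_join_val // et em => /addIr /(mulfI m0').
have [[_ tinj _] _ _] := htau.1 A.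
move=> /(tinj _ _ (mem_set (act_link_P dAB hx m0)) (mem_set (act_link_P dAB hy m0'))).
rewrite !act_link_delta //.
have [_ dinj _] := @delta_bij R _ _ (@BU A B).
move=> /(dinj _ _ (mem_set (act_part_B dAB hx m0)) (mem_set (act_part_B dAB hy m0'))).
rewrite -em => e'; apply/funext => v.
move/(congr1 (fun z : pt R wseq => z v)): e' => /=.
by move/(mulfI (invr_neq0 m0)).
Qed.

Lemma tau_join_surj : set_surj (geom R (Pcx r)) (simplex R U) th.
Proof.
move=> y /simplexP[y0 yU y1].
pose m : R := \sum_(p <- A) y p.
have mB : 1 - \sum_(b <- B) y b = m.
  apply/eqP; rewrite subr_eq /m -y1 (big_fsetID _ (mem A)) /=; apply/eqP.
  have -> : [fset p in U | p \in A]%fset = A.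
    by apply/fsetP => p; rewrite !inE /=; case: (p \in A); rewrite ?andbF.
  have -> // : [fset p in U | p \notin A]%fset = B.
  apply/fsetP => p; rewrite !inE /=; case pA : (p \in A); rewrite /= ?andbT ?andbF //.
  by apply/esym/negP; move/disjP: dAB; apply.
have m0 : 0 <= m by apply: sumr_ge0.
(* The clauses are arranged to cover [m = 0] as well: then there is nothing to lift, and the empty
   simplex with the zero function serves. *)
have [A' [L [x' [h sA' x'0 [x's x'1 x't]]]]] : exists A' L (x' : pt R wseq),
  [/\ valid r A' L, (A' `<=` A)%fset, forall v, 0 <= x' v &
   [/\ forall v, v \notin vertices (of_rounds U A' L) -> x' v = 0,
    m * \sum_(v <- vertices (of_rounds U A' L)) x' v = m &
    m != 0 -> geom R (Bcx B r) x' /\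
      tau A (simp_map (delta B) x') = (fun p => if p \in A then m^-1 * y p else 0)]].
  have [m1|m1] := eqVneq m 0.
    exists fset0, [::], (fun=> 0); split=> //.
    by split=> //; rewrite m1 ?mul0r ?eqxx.
  have [[_ _ tsurj] _ _] := htau.1 A.
  have yA : simplex R A (fun p => if p \in A then m^-1 * y p else 0).
    apply/simplexP; split=> [p|p /negbTE->//|].
      by case: ifP => // _; rewrite mulr_ge0 // invr_ge0.
    rewrite -[RHS](mulVf m1) /m mulr_sumr; apply: eq_big_seq => p pA.
    by rewrite pA.
  have [w hw ew] := tsurj _ yA.
  have [_ _ dsurj] := @delta_bij R _ _ (@BU A B).
  have [x' hx' ex'] : (simp_map (delta B) @` geom R (Bcx B r)) w.
    by apply: dsurj; rewrite (chi2_del dAB).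
  have [x'0 [_ [s Bs <-] [xs x1]]] := hx'.
  have [/PcxP[A' [L [h es]]] _] := Bs.
  move: Bs; rewrite es => /(Bcx_of_rounds _ h)[_ dB].
  have eU : U = finsupp r by rewrite finsupp_chi2.
  exists A', L, x'; rewrite eU -es; split=> //.
    case: h => [sA _ _ _]; apply/fsubsetP => p pA'.
    move: (fsubsetP sA p pA'); rewrite finsupp_chi2 inE => /orP[//|pB].
    by move/disjP/(_ p pB): dB; rewrite inE pA' => /(_ isT).
  by split=> //; [rewrite x1 mulr1|rewrite ex'].
have eU : U = finsupp r by rewrite finsupp_chi2.
(* The part of the preimage on the passive vertices, with the coordinates of [y] in [B] as
   weights. *)
pose e : pt R wseq := fun v => \sum_(b <- B) (if v == beta b then y b else 0).
have binj b c : b \in B -> c \in B -> beta b = beta c -> b = c.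
  move=> bB cB e'; move: (pass_vertex_join dAB bB).
  by rewrite e' pass_vertex_join // => -[].
have e_beta b : b \in B -> e (beta b) = y b.
  move=> bB; rewrite /e (big_fsetD1 b) //= eqxx big_seq big1 ?addr0 // => c.
  rewrite !inE => /andP[cb cB]; case: eqP => // /(binj _ _ bB cB) e'.
  by rewrite e' eqxx in cb.
have e_out v : (forall b, b \in B -> v <> beta b) -> e v = 0.
  move=> hv; rewrite /e big_seq big1 // => b bB; case: eqP => // ev.
  by case: (hv b bB).
have x'b b : b \in B -> x' (beta b) = 0.
  move=> bB; apply: x's; apply/negP; rewrite eU => /(verticesP _ h)[a aA].
  rewrite /pass_vertex -/U eU.
  move=> /(of_rounds_inj (valid_pass_vertex dAB bB) (valid_vertex h aA))[+ _].
  move=> /fsetP/(_ a); rewrite !inE eqxx => /eqP ab.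
  by move/disjP/(_ a (fsubsetP sA' a aA)): dAB; apply; rewrite ab.
have [s Ps es] := join_simplex h sA'.
pose x : pt R wseq := fun v => m * x' v + e v.
have hx : geom R (Pcx r) x.
  split=> [v|].
    by rewrite addr_ge0 ?mulr_ge0 // /e sumr_ge0 // => b _; case: ifP.
  exists (vertices s); first by exists s.
  split=> [v|].
    rewrite es inE negb_or => /andP[/x's vs /imfsetP vB].
    rewrite /x vs mulr0 add0r e_out // => b bB ev; apply: vB.
    by exists b.
  rewrite big_split /= -mulr_sumr.
  have -> : \sum_(v <- vertices s) x' v = \sum_(v <- vertices (of_rounds U A' L)) x' v.
    by apply/esym/big_fset_incl; [rewrite es fsubsetUl|move=> v _ /x's].
  rewrite x'1; have -> : \sum_(v <- vertices s) e v = \sum_(b <- B) y b.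
    transitivity (\sum_(v <- [fset beta b | b in B]%fset) e v); last first.
      by rewrite big_imfset //=; apply: eq_big_seq => b /e_beta.
    apply/esym/big_fset_incl; first by rewrite es fsubsetUr.
    by move=> v _ vB; apply: e_out => b bB ev; case/imfsetP: vB; exists b.
  by rewrite -mB subrK.
have xb b : b \in B -> x (beta b) = y b.
  by move=> bB; rewrite /x x'b // mulr0 add0r e_beta.
have em : coneA x = m.
  by rewrite /act_mass -mB; congr (_ - _); apply: eq_big_seq => b /xb.
have et p : tail x p = if p \in B then y p else 0.
  by rewrite /pass_part; case: ifP => // /xb.
exists x => //; apply/funext => p; rewrite tau_join_val // et em.
have [m1|m1] := eqVneq m 0.
  rewrite m1 mul0r add0r; case: ifP => // /negbT pB.
  have [pA|pA] := boolP (p \in A); last by rewrite yU // inE negb_or pA.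
  move: m1; rewrite /m => /eqP; rewrite psumr_eq0 // => /allP/(_ p pA)/=.
  by move/eqP.
have [hx' tx'] := x't m1.
have eA : partA x = (fun v => m * x' v) :> pt R wseq.
  apply/funext => v; rewrite /act_part; case: asboolP => Bv.
    rewrite /x e_out ?addr0 // => b bB ev; move: Bv; rewrite ev.
    exact: (pass_vertex_B dAB).
  have [->|nx] := eqVneq (x' v) 0; first by rewrite mulr0.
  by case: Bv; exact: (B_supp (@BU A B) hx' nx).
have el : link x = simp_map (delta B) x'.
  rewrite act_link_delta // em eA; congr simp_map.
  by apply/funext => v; rewrite mulKf.
rewrite el tx'; have [pA|pA] := boolP (p \in A).
  have -> : (p \in B) = false by apply/negP; move/disjP: dAB; apply.
  by rewrite addr0 mulVKf.
rewrite mulr0 add0r; case: ifP => // /negbT pB.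
by rewrite yU // inE negb_or pA.
Qed.

Lemma act_mass_continuous : continuous (coneA : pt R wseq -> R).
Proof.
have h := @continuous_sum R _ _ (enum_fset B) xpredT beta.
move=> x; exact: (@cvgB R R _ (nbhs x) _ (fun=> 1)
  (fun y : pt R wseq => \sum_(b <- B) (y (beta b) : R)) _ _ (cvg_cst _) (h x)).
Qed.

Let W : set (pt R wseq) := [set x | geom R (Pcx r) x /\ coneA x != 0].

Lemma act_link_continuous : {within W, continuous (link : pt R wseq -> pt R wseq)}.
Proof.
apply: within_ptws => u; have [F hF] := vertices_fset r.
pose f (x : pt R wseq) : R :=
  \sum_(v <- F | (delta B v == u) && `[< Bcx B r v >]) (x v : R).
apply: (@within_eq _ _ _ (fun x : pt R wseq => (coneA x)^-1 * f x : R)).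
  move=> x [hx _]; have xF v : v \notin F -> x v = 0.
    by apply: realization_off hx => _ [s /hF hs <-].
  rewrite /act_link (simp_mapE _ _ (act_part_off A B xF)); congr (_ * _).
  by rewrite /f big_mkcondr.
apply/subspace_continuousP => x [hx m0]; apply: cvg_within_filter.
have cf : f y @[y --> x] --> f x := @continuous_sum R _ _ (enum_fset F) _ id x.
have cm : coneA y @[y --> x] --> coneA x := @act_mass_continuous x.
exact: (@cvgM R _ (nbhs x) _ (fun y : pt R wseq => (coneA y)^-1) f _ _
  (@cvgV R _ (nbhs x) _ coneA _ m0 cm) cf).
Qed.

(* Where [act_mass] vanishes, [act_link] is discontinuous; there the product is
   squeezed by [act_mass]. *)
Lemma act_term_continuous p : {within geom R (Pcx r),
  continuous (fun x : pt R wseq => coneA x * tau A (link x) p : R)}.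
Proof.
pose g (x : pt R wseq) : R := coneA x * tau A (link x) p.
apply/subspace_continuousP => x hx Q nQ.
have {}nQ : nbhs (g x) Q by [].
suff : nbhs x (fun z => geom R (Pcx r) z -> Q (g z)) by [].
have cm : coneA y @[y --> x] --> coneA x := @act_mass_continuous x.
have [m0|m0] := eqVneq (coneA x) 0.
  have gx : g x = 0 by rewrite /g m0 mul0r.
  move: nQ; rewrite gx => /nbhs_ballP[eps /= eps0 hQ].
  have : nbhs x (fun z => ball (0 : R) eps (coneA z)).
    by apply: cm; rewrite m0; exact: nbhsx_ballx.
  apply: filterS => z; rewrite /ball /= sub0r normrN => hz Pz; apply: hQ.
  rewrite /ball /= sub0r normrN /g; apply: le_lt_trans hz.
  have [mz|mz] := eqVneq (coneA z) 0; first by rewrite mz mul0r.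
  have hs := tau_act_link Pz mz; rewrite normrM ler_piMr // ger0_norm.
    exact: simplex_le1 hs.
  by case: hs.
have cg : {within W, continuous (fun z => tau A (link z) p : R)}.
  have [[tfun _ _] tc _] := htau.1 A.
  have ct : {within W, continuous (fun z => tau A (link z) : pt R nat)}.
    by apply: (within_comp act_link_continuous tc) => z [Pz mz]; exact: act_link_P.
  by apply: (within_comp ct (@within_coord _ _ setT p)).
move/subspace_continuousP: cg => /(_ x (conj hx m0)) cg.
have cg' : g z @[z --> within W (nbhs x)] --> g x.
  have cm' : coneA z @[z --> within W (nbhs x)] --> coneA x by exact: cvg_within_filter.
  have FW : Filter (within W (nbhs x)) by exact: within_filter.
  exact: (@cvgM R _ (within W (nbhs x)) FW coneA (fun z => tau A (link z) p) _ _ cm' cg).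
have h1 : nbhs x (fun z => W z -> Q (g z)) := cg' Q nQ.
have h2 : nbhs x (fun z => coneA z != 0).
  exact: (cvgr_neq0 _ cm).
by apply: filterS2 h1 h2 => z hz mz Pz; apply: hz.
Qed.

Lemma tau_join_continuous :
  {within geom R (Pcx r), continuous (th : pt R wseq -> pt R nat)}.
Proof.
apply: within_ptws => p.
apply: (@within_eq _ _ _ (fun x => coneA x * tau A (link x) p + tail x p : R)).
  by move=> x hx; rewrite tau_join_val.
have ct : {within geom R (Pcx r), continuous (fun x => tail x p : R)}.
  rewrite /pass_part; case: (p \in B); first exact: within_coord.
  exact: (continuous_subspaceT (@cst_continuous _ _ _)).
move/subspace_continuousP: ct => ct.
have /subspace_continuousP cg := @act_term_continuous p.
apply/subspace_continuousP => x hx.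
have FW : Filter (within (geom R (Pcx r)) (nbhs x)) by exact: within_filter.
exact: (@cvgD R R _ (within (geom R (Pcx r)) (nbhs x)) FW
  (fun z : pt R wseq => coneA z * tau A (link z) p) (fun z => tail z p) _ _
  (cg x hx) (ct x hx)).
Qed.

Lemma tau_join_bij : set_bij (geom R (Pcx r)) (simplex R U) th.
Proof. by split; [exact: tau_join_simplex|exact: tau_join_inj|exact: tau_join_surj]. Qed.

Lemma tau_join_homeo : homeo (geom R (Pcx r)) (simplex R U) th.
Proof.
apply: homeo_compact; [exact: geom_compact (@subset_refl _ _)|
  exact: tau_join_bij|exact: tau_join_continuous].
Qed.

End Fixed.
End TauJoin.

(** * Compatibility of the joined maps with faces *)

Section TauJoinFaces.


Variable R : realType.
Variable tau : {fset nat} -> pt R wseq -> pt R nat.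
Hypothesis htau : tau_family tau.

Lemma delta_delta (V W : {fset nat}) s :
  delta (W `\` V)%fset (delta V s) = delta (V `\` W)%fset (delta W s).
Proof.
rewrite /delta /=; congr ((_, _) :: _); apply/fsetP => p.
rewrite /Gof /= !inE.
by case: (p \in V); case: (p \in W); rewrite ?andbF.
Qed.

Lemma Bcx_delta (V W : {fset nat}) r v : (W `<=` finsupp r)%fset ->
  Bcx V r v -> Bcx (W `\` V)%fset (rc_del r V) (delta V v) <-> Bcx W r v.
Proof.
move=> sW hB; have /PcxP[A [L [h e]]] : Pcx r v by case: hB.
move: hB; rewrite e => /(Bcx_of_rounds _ h)[sV dV].
have hV := valid_del h dV; rewrite delta_valid //.
split=> [/(Bcx_of_rounds _ hV)[_ /disjP d]|/(Bcx_of_rounds _ h)[_ /disjP d]].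
  apply/(Bcx_of_rounds _ h); split=> //; apply/disjP => p pW pA.
  have [pV|pV] := boolP (p \in V); first by move/disjP/(_ p pV): dV.
  by apply: (d p) => //; rewrite inE pV.
apply/(Bcx_of_rounds _ hV); split; first by rewrite finsupp_del fsetSD.
by apply/disjP => p; rewrite inE => /andP[_ /d].
Qed.

Variables (A B V : {fset nat}).
Hypotheses (dAB : fdisjoint A B) (sV : (V `<=` A `|` B)%fset).
Let r := chi2 A B.
Let A' := (A `\` V)%fset.
Let B' := (B `\` V)%fset.

Let sVr : (V `<=` finsupp r)%fset. Proof. by rewrite finsupp_chi2. Qed.

Let er : rc_del r V = chi2 A' B'. Proof. exact: del_chi2. Qed.

Let dAB' : fdisjoint A' B'.
Proof.
apply/disjP => p; rewrite !inE => /andP[_ pA] /andP[_ pB].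
by move/disjP/(_ p pA): dAB.
Qed.

Let eVB : (A `\` A' = V `\` B)%fset.
Proof.
apply/fsetP => p; rewrite !inE negb_and negbK.
have := fsubsetP sV p; rewrite inE.
case pA : (p \in A); case pB : (p \in B); case: (p \in V) => //= h.
  by move/disjP/(_ p pA): dAB.
by move: (h isT).
Qed.

Lemma pass_vertex_face b : b \in B -> Bcx V r (pass_vertex A B b) <-> b \notin V.
Proof.
move=> bB; rewrite /pass_vertex -finsupp_chi2.
split=> [/(Bcx_of_rounds _ (valid_pass_vertex dAB bB))[_ /disjP d]|bV].
  by apply/negP => /d; apply; rewrite !inE eqxx.
apply/(Bcx_of_rounds _ (valid_pass_vertex dAB bB)); split=> //; apply/disjP => p pV.
by rewrite !inE orbF => /eqP e; rewrite -e pV in bV.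
Qed.

Lemma pass_vertex_delta b : b \notin V -> delta V (pass_vertex A B b) = pass_vertex A' B' b.
Proof.
move=> bV; rewrite /pass_vertex delta_of_rounds; last first.
  by apply/disjP => p pV; rewrite !inE orbF => /eqP e; rewrite -e pV in bV.
by rewrite fsetDUl.
Qed.

Variable x : pt R wseq.
Hypothesis hB : geom R (Bcx V r) x.
Let hx : geom R (Pcx r) x. Proof. exact: B_P hB. Qed.
Let x' := simp_map (delta V) x.
Let hx' : geom R (Pcx (chi2 A' B')) x'. Proof. by rewrite -er; exact: delta_P. Qed.

Lemma pass_part_face p : pass_part A' B' x' p = pass_part A B x p.
Proof.
rewrite /pass_part inE; case pB : (p \in B); rewrite ?andbF // andbT.
case pV : (p \in V) => /=.
  have [//|nx] := eqVneq (x (pass_vertex A B p)) 0.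
  by have /(pass_vertex_face pB) := B_supp sVr hB nx; rewrite pV.
have nV : p \notin V by rewrite pV.
by rewrite -(pass_vertex_delta nV) /x' (delta_val sVr hB) //; apply/pass_vertex_face.
Qed.

Lemma act_mass_face : act_mass A' B' x' = act_mass A B x.
Proof.
rewrite /act_mass; congr (_ - _).
transitivity (\sum_(b <- B') pass_part A' B' x' b).
  by apply: eq_big_seq => b bB; rewrite /pass_part bB.
transitivity (\sum_(b <- B) pass_part A' B' x' b).
  apply: big_fset_incl; first exact: fsubsetDl.
  by move=> b _ /negbTE bB; rewrite /pass_part bB.
by apply: eq_big_seq => b bB; rewrite pass_part_face /pass_part bB.
Qed.

Lemma act_part_face : act_part A' B' x' = simp_map (delta V) (act_part A B x).
Proof.
have [F xF] := geom_off (@subset_refl _ _) hx.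
apply/funext => u; rewrite (simp_mapE _ _ (act_part_off A B xF)) /act_part.
rewrite /x' (simp_mapE _ _ xF) (fun_if (fun t => t)).
rewrite big_mkcond [RHS]big_mkcond /=.
have E v : x v != 0 -> delta V v = u -> Bcx B' (chi2 A' B') u <-> Bcx B r v.
  move=> nv <-; rewrite -er; apply: Bcx_delta; first by rewrite finsupp_chi2 fsubsetUr.
  exact: B_supp nv.
case: asboolP => h.
  apply: eq_bigr => v _; case: eqP => // ev.
  have [x0|nv] := eqVneq (x v) 0; first by rewrite x0 if_same.
  by case: asboolP => // -[]; apply/(E v nv ev).
rewrite big1 // => v _; case: eqP => // ev.
have [x0|nv] := eqVneq (x v) 0; first by rewrite x0 if_same.
by case: asboolP => // /(E v nv ev).
Qed.

Lemma tau_join_face : tau_join tau A B x = tau_join tau A' B' x'.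
Proof.
apply/funext => p; rewrite !tau_joinE // act_mass_face pass_part_face; congr (_ + _).
have [->|m0] := eqVneq (act_mass A B x) 0; first by rewrite !mul0r.
congr (_ * _).
pose y : pt R wseq := fun v => (act_mass A B x)^-1 * act_part A B x v.
have hy : geom R (Bcx B r) y by exact: act_part_B.
have yV v : y v != 0 -> Bcx V r v.
  move=> nv; apply: (B_supp sVr hB); apply: contraNneq nv => x0.
  by rewrite /y /act_part x0 if_same mulr0.
have [F xF] := geom_off (@subset_refl _ _) hx.
have yF v : v \notin F -> y v = 0 by move=> /xF x0; rewrite /y /act_part x0 if_same mulr0.
have el : act_link A B x = simp_map (delta B) y by exact: act_link_delta.
have sA' : (A' `<=` A)%fset by exact: fsubsetDl.
(* The face condition on [tau] is applied to [A'] inside [A]; by [eVB], the elements deleted are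
   those of [V] outside [B]. *)
have hl : geom R (Bcx (A `\` A')%fset (chi1 A)) (act_link A B x).
  apply/B_full; first by rewrite finsupp_chi2 fsetU0 fsubsetDl.
  split; first exact: act_link_P.
  move=> u; rewrite el => /(delta_supp (@BU A B) hy)[v [Bv nv ->]].
  by rewrite eVB -(chi2_del dAB); apply/Bcx_delta => //; exact: yV.
rewrite (htau.2 A A' sA' _ hl); congr (tau A' _ p).
rewrite eVB el act_link_delta // act_part_face act_mass_face.
(* Both links are images of [y], once by deleting [B] and then the rest of [V], once by deleting [V]
   and then the rest of [B]. *)
have <- := @simp_mapZ R _ _ (delta V) (act_mass A B x)^-1 (act_part A B x) F.
  by rewrite !(simp_map_comp _ _ yF); apply: (simp_map_eq yF) => v _; exact: delta_delta.
exact: act_part_off.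
Qed.

End TauJoinFaces.

(** * The map to the simplex *)

Section Main.


Variable R : realType.
Variable tau : {fset nat} -> pt R wseq -> pt R nat.
Hypothesis htau : tau_family tau.
Implicit Types (r : round_counter) (A B S T V : {fset nat}).

Notation P r := (geom R (Pcx r)).
Notation X S r := (geom R (Xcx S r)).
Notation Bd V r := (geom R (Bcx V r)).
Notation gm S := (simp_map (gamma S)).
Notation dl V := (simp_map (delta V)).
Notation theta A B := (tau_join tau A B).
Notation simp A := (simplex R A).

(** A converse to [gamma_delta]: as [S] avoids [V], stripping [S] from the first round cannot hide
    an element of [V]. *)
Lemma Bcx_gamma S V r s : (S `<=` act r)%fset -> (V `<=` finsupp r)%fset ->
  fdisjoint S V -> Xcx S r s -> Bcx V (rc_dec r S) (gamma S s) -> Bcx V r s.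
Proof.
move=> sS sV /disjP dSV hX; have /PcxP[A [L [h e]]] : Pcx r s by case: hX.
move: hX; rewrite e => /(Xcx_of_rounds _ h) hX; have hS := valid_peel sS h hX.
rewrite gamma_valid // => /(Bcx_of_rounds _ hS)[_ /disjP dV].
apply/(Bcx_of_rounds _ h); split=> //; apply/disjP => p pV pA; apply: (dV p pV).
move: pA; rewrite !inE; case: (p \in A) => //=.
case: (L) => [|Q L'] //=; rewrite inE; case: ifP => [/eqP->|_ /=].
  by case/orP => // /dSV/(_ pV).
by rewrite !inE; have -> : p \notin S by apply/negP => /dSV; apply.
Qed.

Lemma B_gamma S V r (x : pt R wseq) : (S `<=` act r)%fset -> (V `<=` finsupp r)%fset ->
  fdisjoint S V -> X S r x -> Bd V (rc_dec r S) (gm S x) -> Bd V r x.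
Proof.
move=> sS sV dSV hX hB; apply/B_full => //; split; first exact: X_P hX.
move=> v nv; have Xv := X_supp sS hX nv; apply: (Bcx_gamma sS sV dSV Xv).
apply: B_supp hB _; first by rewrite finsupp_dec.
by rewrite (gamma_val sS hX Xv).
Qed.

Lemma simplex_mono A B y : (A `<=` B)%fset -> simp A y -> simp B y.
Proof.
move=> sAB [y0 [s sA h]]; split=> //; exists s => //.
exact: fsubset_trans sAB.
Qed.

(** * Transfer maps of a simplex *)

Section Transfer.
Variables A B : {fset nat}.
Hypothesis dAB : fdisjoint A B.
Let U := (A `|` B)%fset.
Let c := chi2 A B.

Lemma disjoint_dec S : fdisjoint (A `\` S)%fset (B `|` S)%fset.
Proof.
apply/disjP => p; rewrite !inE => /andP[/negbTE-> pA]; rewrite orbF.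
by move/disjP: dAB; apply.
Qed.

Lemma union_dec S : (S `<=` A)%fset -> ((A `\` S) `|` (B `|` S) = U)%fset.
Proof.
move=> sS; apply/fsetP => p; rewrite !inE; case pS : (p \in S).
  by rewrite (fsubsetP sS) //= !orbT.
by rewrite orbF.
Qed.

(** For the converse, bijectivity over the smaller simplex gives a point of [B_V] with the same
    image as [x], and injectivity identifies the two. *)
Lemma theta_face V x : (V `<=` U)%fset -> P c x ->
  Bd V c x <-> simp (U `\` V)%fset (theta A B x).
Proof.
move=> sV hx; have sV' : (V `<=` finsupp c)%fset by rewrite finsupp_chi2.
have dV : fdisjoint (A `\` V)%fset (B `\` V)%fset.
  apply/disjP => p; rewrite !inE => /andP[_ pA] /andP[_ pB].
  by move/disjP/(_ p pA): dAB.
rewrite /U fsetDUl; split=> [hB|hy].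
  rewrite (tau_join_face htau dAB sV hB); apply: (tau_join_simplex htau dV).
  by rewrite -del_chi2; exact: delta_P.
have [_ _ surj] := tau_join_bij htau dV; have [z hz ez] := surj _ hy.
have [_ _ dsurj] := @delta_bij R _ _ sV'.
have [x' hx' ex'] : (dl V @` Bd V c) z by apply: dsurj; rewrite del_chi2.
suff <- : x' = x by [].
apply: (tau_join_inj htau dAB); rewrite ?inE //; first exact: B_P hx'.
by rewrite (tau_join_face htau dAB sV hx') ex'.
Qed.

(* In terms of [Psi r = theta (act r) (pass r) \o Phi r], condition (2) says that
   on [X_S(r)] one has [Psi r = transfer S \o Psi (rc_dec r S) \o gamma S]. *)
Definition transfer S (y : pt R nat) : pt R nat :=
  theta A B (inv_on (X S c) (gm S)
    (inv_on (P (rc_dec c S)) (theta (A `\` S)%fset (B `|` S)%fset) y)).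

Variable S : {fset nat}.
Hypothesis sS : (S `<=` A)%fset.

Let sS' : (S `<=` act c)%fset. Proof. by rewrite act_chi2. Qed.

Let ec : rc_dec c S = chi2 (A `\` S)%fset (B `|` S)%fset. Proof. exact: dec_chi2. Qed.

Lemma theta_dec_bij : set_bij (P (rc_dec c S)) (simp U) (theta (A `\` S)%fset (B `|` S)%fset).
Proof. by rewrite ec -(union_dec sS); apply: tau_join_bij => //; exact: disjoint_dec. Qed.

(** With [transfer_ex], which lifts a point of the simplex to such a [w], this reduces identities
    between transfer maps to identities between [gamma] and [delta]. *)
Lemma transferE w : X S c w ->
  transfer S (theta (A `\` S)%fset (B `|` S)%fset (gm S w)) = theta A B w.
Proof.
move=> hw; have [_ inj _] := theta_dec_bij; have [_ ginj _] := @gamma_bij R _ _ sS'.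
by rewrite /transfer inv_onK ?inv_onK //; exact: gamma_P.
Qed.

Lemma transfer_ex y : simp U y ->
  exists2 w, X S c w & theta (A `\` S)%fset (B `|` S)%fset (gm S w) = y.
Proof.
have [_ _ surj] := theta_dec_bij => /surj[z hz <-].
by have [_ _ gsurj] := @gamma_bij R _ _ sS'; have [w hw <-] := gsurj _ hz; exists w.
Qed.

Lemma transfer_in y : simp U y -> simp U (transfer S y).
Proof.
move=> /transfer_ex[w hw <-]; rewrite transferE //.
by apply: (tau_join_simplex htau dAB); exact: X_P hw.
Qed.

Lemma transfer_inj y y' : simp U y -> simp U y' -> transfer S y = transfer S y' -> y = y'.
Proof.
move=> /transfer_ex[w hw <-] /transfer_ex[w' hw' <-]; rewrite !transferE // => e.
congr (theta _ _ (gm S _)); apply: (tau_join_inj htau dAB) => //.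
  by rewrite inE; exact: X_P hw.
by rewrite inE; exact: X_P hw'.
Qed.

Lemma transfer_continuous : {within simp U, continuous (transfer S : pt R nat -> pt R nat)}.
Proof.
have h1 : homeo (P (rc_dec c S)) (simp U) (theta (A `\` S)%fset (B `|` S)%fset).
  by rewrite ec -(union_dec sS); apply: tau_join_homeo => //; exact: disjoint_dec.
have h2 : homeo (X S c) (P (rc_dec c S)) (gm S).
  apply: homeo_compact; [exact: geom_compact (@X_le _ _)|
    exact: gamma_bij|exact: gamma_continuous].
have [b1 _ c1] := h1; have [b2 _ c2] := h2; have [_ c3 _] := tau_join_homeo htau dAB.
have c12 := within_comp c1 c2 (fun y hy => (inv_on_in b1 hy).1).
apply: (within_comp c12 c3) => y hy.
by apply: X_P; apply: (inv_on_in b2 _).1; exact: (inv_on_in b1 hy).1.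
Qed.

End Transfer.

(** * Relations between transfer maps *)

Section Compatibility.
Variables A B : {fset nat}.
Hypothesis dAB : fdisjoint A B.
Let U := (A `|` B)%fset.
Let c := chi2 A B.

Let ecS S : (S `<=` A)%fset -> rc_dec c S = chi2 (A `\` S)%fset (B `|` S)%fset.
Proof. exact: dec_chi2. Qed.

Let AU S : (S `<=` A)%fset -> (S `<=` U)%fset.
Proof. by move=> sS; apply: (fsubset_trans sS); exact: fsubsetUl. Qed.

Let BD T : (T `<=` A)%fset -> (B `\` T)%fset = B.
Proof.
move=> sT; apply/fsetDidPl; apply/eqP; apply/eqP/disjP => p pB /(fsubsetP sT) pA.
by move/disjP/(_ p pA): dAB.
Qed.

Lemma transfer0 y : simp U y -> transfer A B fset0 y = y.
Proof.
move=> hy; have [w hw <-] := transfer_ex dAB (fsub0set A) hy.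
rewrite transferE ?fsub0set //.
have [_ ->] := X_empty (X_P hw).
by rewrite fsetD0 fsetU0.
Qed.

(** Lift [y] to [w] in [X_S(c)]. As [y] lies on the face without [T], [gamma S] sends [w] into
    [B_T], so [w] is also in [X_T(c)]. By [X_cap], both sides are then the image of [w] under
    [tau_join tau A B]. *)
Lemma transfer_transfer S T y : (S `<=` A)%fset -> (T `<=` S)%fset -> T != S ->
  simp (U `\` T)%fset y ->
  transfer A B T (transfer (A `\` T)%fset B (S `\` T)%fset y) = transfer A B S y.
Proof.
move=> sS sT nT hy; have sTA := fsubset_trans sT sS.
have sS' : (S `<=` act c)%fset by rewrite act_chi2.
have [w hw ew] := transfer_ex dAB sS (simplex_mono (fsubsetDl _ _) hy).
have hg := gamma_P sS' hw.
have dS := disjoint_dec dAB S.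
have hB : Bd T (rc_dec c S) (gm S w).
  rewrite ecS // in hg *; apply/theta_face => //; first by rewrite union_dec ?AU.
  by rewrite union_dec // ew.
have hT : X T c w by apply/(X_sub sS').
have [hBT hXST eg] := X_cap sS' sT nT hw hT.
have dT := disjoint_dec dAB T.
have dAT : fdisjoint (A `\` T)%fset B.
  by apply/disjP => p; rewrite inE => /andP[_ pA]; move/disjP: dAB; apply.
have eA : (A `\` T `\` (S `\` T) = A `\` S `\` T)%fset.
  by apply/fsetP => p; rewrite !inE; case: (p \in T); case: (p \in S).
have eB : (B `|` (S `\` T) = (B `|` S) `\` T)%fset.
  by rewrite fsetDUl BD.
have eT : (A `\` T `\` T = A `\` T)%fset.
  by apply/fsetP => p; rewrite !inE; case: (p \in T).
have eBT : ((B `|` T) `\` T = B)%fset by rewrite fsetDUl fsetDv fsetU0 BD.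
have e1 : theta (A `\` T `\` (S `\` T))%fset (B `|` (S `\` T))%fset
    (dl T (gm S w)) = y.
  rewrite eA eB -ew; rewrite ecS // in hB.
  by rewrite (tau_join_face htau dS _ hB) ?union_dec ?AU.
have hc : rc_del c T = chi2 (A `\` T)%fset B by rewrite del_chi2 BD.
rewrite hc in hXST.
rewrite -{1}e1 -eg transferE // ?fsetSD //.
rewrite -ew transferE // -(transferE dAB sTA hT).
congr (transfer _ _ _ _); rewrite ecS // in hBT.
by rewrite (tau_join_face htau dT _ hBT) ?union_dec ?AU // eT eBT.
Qed.

(** The point over [y] lies in [B_A(c)], where there are no rounds and [gamma S] is the identity;
    the two maps being compared restrict to the same map on that face. *)
Lemma transfer_fix S y : (S `<=` A)%fset -> simp B y -> transfer A B S y = y.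
Proof.
move=> sS hy.
have eB : (U `\` A = B)%fset.
  by rewrite /U fsetDUl fsetDv fset0U BD.
have sA : (A `<=` U)%fset by exact: fsubsetUl.
have sA' : (A `<=` finsupp c)%fset by rewrite finsupp_chi2.
have sS' : (S `<=` act c)%fset by rewrite act_chi2.
have [_ _ surj] := tau_join_bij htau dAB.
have [w hw ew] : (theta A B @` P c) y.
  by apply: surj; apply: simplex_mono hy; exact: fsubsetUr.
have hB : Bd A c w by apply/theta_face => //; rewrite ew eB.
have sAA : (act c `<=` A)%fset by rewrite act_chi2.
have [hX eg hBS] := B_act sAA sA' sS' hB.
rewrite -{2}ew -(transferE dAB sS hX) eg; congr (transfer _ _ _ _).
have dS := disjoint_dec dAB S.
rewrite ecS // in hBS; rewrite (tau_join_face htau dS _ hBS) ?union_dec //.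
rewrite -ew (tau_join_face htau dAB sA hB).
have -> : (A `\` S `\` A = A `\` A)%fset.
  by apply/fsetP => p; rewrite !inE; case: (p \in A); rewrite ?andbF.
have -> // : ((B `|` S) `\` A = B `\` A)%fset.
apply/fsetP => p; rewrite !inE; case pS : (p \in S); rewrite ?orbF //.
by rewrite (fsubsetP sS).
Qed.

(** The lift of [y] to [X_S(c)] lies in [B_V(c)], because [S] avoids [V]; there [gamma S] and
    [delta V] commute. *)
Lemma transfer_face S V y : (S `<=` A)%fset -> (V `<=` U)%fset ->
  fdisjoint S V -> simp (U `\` V)%fset y ->
  transfer A B S y = transfer (A `\` V)%fset (B `\` V)%fset S y.
Proof.
move=> sS sV dSV hy.
have sS' : (S `<=` act c)%fset by rewrite act_chi2.
have sV' : (V `<=` finsupp c)%fset by rewrite finsupp_chi2.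
have [w hw ew] := transfer_ex dAB sS (simplex_mono (fsubsetDl _ _) hy).
have hg := gamma_P sS' hw.
have dS := disjoint_dec dAB S.
have hBg : Bd V (rc_dec c S) (gm S w).
  rewrite ecS // in hg *; apply/theta_face => //; first by rewrite union_dec.
  by rewrite union_dec // ew.
have hB := B_gamma sS' sV' dSV hw hBg.
have [_ hXV eg] := X_delta sS' sV' dSV hB hw.
have dV : fdisjoint (A `\` V)%fset (B `\` V)%fset.
  apply/disjP => p; rewrite !inE => /andP[_ pA] /andP[_ pB].
  by move/disjP/(_ p pA): dAB.
have sSV : (S `<=` A `\` V)%fset.
  apply/fsubsetP => p pS; rewrite inE (fsubsetP sS) // andbT.
  by apply/negP; move/disjP: dSV; apply.
rewrite -{1}ew transferE // (tau_join_face htau dAB sV hB).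
rewrite del_chi2 in hXV; rewrite -(transferE dV sSV hXV) eg.
congr (transfer _ _ _ _); rewrite ecS // in hBg.
rewrite -ew (tau_join_face htau dS _ hBg) ?union_dec //.
have -> : (A `\` S `\` V = A `\` V `\` S)%fset.
  by apply/fsetP => p; rewrite !inE; case: (p \in V); case: (p \in S).
have -> // : ((B `|` S) `\` V = B `\` V `|` S)%fset.
apply/fsetP => p; rewrite !inE; case pS : (p \in S); rewrite ?orbF // !orbT andbT.
by apply/negP; move/disjP: dSV; apply.
Qed.

End Compatibility.

(** * Recursive construction of the map to the simplex *)

Notation trans r S := (transfer (act r) (pass r) S).

Lemma simp_act r : simp (act r `|` pass r)%fset = simp (finsupp r).
Proof. by rewrite act_pass. Qed.

Lemma chi_id r : act r = fset0 -> chi r = r.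
Proof.
move=> a0; apply: rc_eqP => [|p]; first exact: finsupp_chi.
rewrite rval_chi2; have := in_act r p; rewrite a0 inE.
by case: (rval r p).
Qed.

Lemma weight_act0 r : weight r = 0%N -> act r = fset0.
Proof.
move=> w0; apply/eqP; apply/negPn/negP => nA.
by have := weight_dec (fsubset_refl (act r)) nA; rewrite w0.
Qed.

(** The default [act r] serves for points outside [P(r)]: if nonempty it still lowers the weight, so
    that [psi_fuel] holds as an equality of functions. *)
Definition chosen r (x : pt R wseq) : {fset nat} :=
  xget (act r) [set S | [/\ S != fset0, (S `<=` act r)%fset & X S r x]].

(* The first argument is fuel: it only has to be at least [weight r]. *)
Fixpoint psi n r (x : pt R wseq) : pt R nat :=
  if n is n'.+1 then
    if act r == fset0 then theta (act r) (pass r) x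
    else let S := chosen r x in trans r S (psi n' (rc_dec r S) (gm S x))
  else theta (act r) (pass r) x.

Definition Psi r := psi (weight r) r.

Lemma chosen_act r x : act r != fset0 ->
  chosen r x != fset0 /\ (chosen r x `<=` act r)%fset.
Proof.
rewrite /chosen => nA; case: xgetP => [S _ [? ? _]|_] //.
Qed.

Lemma psi_fuel n m r : (weight r <= n)%N -> (weight r <= m)%N -> psi n r = psi m r.
Proof.
have psi0 k r' : act r' = fset0 -> psi k r' = theta (act r') (pass r').
  by case: k => //= k ->; rewrite eqxx.
elim: n m r => [|n IH] [|m] r //.
- by rewrite leqn0 => /eqP/weight_act0 a0 _; rewrite !psi0.
- by move=> _; rewrite leqn0 => /eqP/weight_act0 a0; rewrite !psi0.
move=> hn hm; apply/funext => x /=; case: eqP => // /eqP nA.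
have [c0 cA] := chosen_act x nA.
have hw := weight_dec cA c0.
by rewrite (IH m) // -ltnS; apply: leq_trans hw _.
Qed.

Lemma Psi_act0 r : act r = fset0 -> Psi r = theta (act r) (pass r).
Proof. by rewrite /Psi; case: (weight r) => //= k ->; rewrite eqxx. Qed.

Lemma Psi_cover r x : act r != fset0 -> P r x ->
  exists S, [/\ S != fset0, (S `<=` act r)%fset, X S r x &
    Psi r x = trans r S (Psi (rc_dec r S) (gm S x))].
Proof.
move=> nA hx; have [S0 [S1 S2 _ S3]] : exists S, [/\ S != fset0, (S `<=` act r)%fset,
    fdisjoint S fset0 & X S r x].
  by apply: X_cover (B_empty hx); rewrite fsubset0.
have : [set S | [/\ S != fset0, (S `<=` act r)%fset & X S r x]] (chosen r x).
  by rewrite /chosen; case: xgetP => [S -> //|/(_ S0)[]].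
move=> [c0 cA cX]; exists (chosen r x); split=> //.
rewrite {1}/Psi; case e : (weight r) => [|n].
  by move/weight_act0: e nA => ->; rewrite eqxx.
rewrite /= (negbTE nA) (@psi_fuel n (weight (rc_dec r (chosen r x)))) //.
by rewrite -ltnS -e; exact: weight_dec.
Qed.

Lemma Psi_simplex r x : P r x -> simp (finsupp r) (Psi r x).
Proof.
move: {2}(weight r).+1 (ltnSn (weight r)) x => n.
elim: n r => // n IH r hw x hx; rewrite -simp_act.
have [a0|nA] := eqVneq (act r) fset0.
  rewrite Psi_act0 //; apply: (tau_join_simplex htau (pass_act_dis r)).
  by rewrite -/(chi r) chi_id.
have [S [S0 sS hX ->]] := Psi_cover nA hx.
apply: (transfer_in (pass_act_dis r) sS); rewrite simp_act -(finsupp_dec r S).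
apply: IH; last exact: gamma_P.
by rewrite -ltnS; apply: leq_trans hw; rewrite ltnS; exact: weight_dec.
Qed.

(** Conditions (2) and (1) after composition with [tau]. The second involves no transfer map, since
    the joined maps themselves restrict to faces. *)
Definition X_compat r := forall S x, (S `<=` act r)%fset -> X S r x ->
  Psi r x = trans r S (Psi (rc_dec r S) (gm S x)).

Definition B_compat r := forall V x, (V `<=` finsupp r)%fset -> Bd V r x ->
  Psi r x = Psi (rc_del r V) (dl V x).

Lemma pass_delD r T : (T `<=` act r)%fset -> pass (rc_del r T) = pass r.
Proof.
move=> sT; rewrite pass_del; apply/fsetDidPl/disjP => p pP /(fsubsetP sT) pA.
by move/disjP/(_ p pA): (pass_act_dis r).
Qed.

(* [gamma S] maps [X_S] and [X_T] intersected onto [B_T(rc_dec r S)], where both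
   sides are computed by [Psi] on [rc_del (rc_dec r S) T]. *)
Lemma X_compat_nested r S T x :
  (forall r', (weight r' < weight r)%N -> X_compat r' /\ B_compat r') ->
  (S `<=` act r)%fset -> (T `<=` S)%fset -> T != fset0 -> X S r x -> X T r x ->
  trans r S (Psi (rc_dec r S) (gm S x)) = trans r T (Psi (rc_dec r T) (gm T x)).
Proof.
move=> IH sS sT T0 hS hT; have [->//|nT] := eqVneq T S.
have sTA := fsubset_trans sT sS.
have S0 : S != fset0.
  by apply: contraNneq T0 => e; move: sT; rewrite e fsubset0.
have sTr := fsubset_trans sTA (act_sub r).
have [_ qS] := IH _ (weight_dec sS S0); have [_ qT] := IH _ (weight_dec sTA T0).
have [xT _] := IH _ (weight_del_act sTA T0).
have hBS : Bd T (rc_dec r S) (gm S x) by apply/(X_sub sS sT nT hS).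
have [hBT hXST eg] := X_cap sS sT nT hS hT.
have -> : Psi (rc_dec r S) (gm S x) = Psi (rc_del (rc_dec r S) T) (dl T (gm S x)).
  by apply: qS => //; rewrite finsupp_dec.
have -> : Psi (rc_dec r T) (gm T x) = Psi (rc_del (rc_dec r T) T) (dl T (gm T x)).
  by apply: qT => //; rewrite finsupp_dec.
rewrite del_dec (xT (S `\` T)%fset) //; last by rewrite act_del fsetSD.
rewrite eg act_del pass_delD // dec_delD.
rewrite (transfer_transfer (pass_act_dis r)) //.
rewrite act_pass -(finsupp_dec r S) -finsupp_del; apply: Psi_simplex.
by apply: delta_P => //; rewrite finsupp_dec.
Qed.

(* Two incomparable sets are compared through their union. *)
Lemma X_compat_step r :
  (forall r', (weight r' < weight r)%N -> X_compat r' /\ B_compat r') -> X_compat r.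
Proof.
(* For [S] empty the right-hand side refers to [Psi r] itself, so no induction applies; here [gamma]
   and [transfer] are identities. *)
move=> IH S x sS hS; have [->|S0] := eqVneq S fset0.
  have [_ ->] := X_empty (X_P hS).
  rewrite dec0 transfer0 //; first exact: pass_act_dis.
  by rewrite act_pass; apply: Psi_simplex; exact: X_P hS.
have nA : act r != fset0.
  by apply: contraNneq S0 => e; move: sS; rewrite e fsubset0.
have [S' [S'0 sS' hS' ->]] := Psi_cover nA (X_P hS).
have hU := X_union sS sS' hS hS'.
have sU : (S `|` S' `<=` act r)%fset by rewrite fsubUset sS.
rewrite -(X_compat_nested IH sU (fsubsetUl _ _) S0 hU hS).
by rewrite -(X_compat_nested IH sU (fsubsetUr _ _) S'0 hU hS').
Qed.

Lemma Psi_compat r : X_compat r /\ B_compat r.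
Proof.
move: {2}(weight r).+1 (ltnSn (weight r)) => n; elim: n r => // n IH r hw.
(* Deleting [V] need not lower the weight, yet (1) for [r] uses (2) for [rc_del r V]. So (2) is
   first obtained for every counter of weight at most that of [r], from the induction hypothesis
   alone. *)
have XC r' : (weight r' <= weight r)%N -> X_compat r'.
  move=> hr; apply: X_compat_step => r'' h; apply: IH.
  exact: leq_trans h (leq_trans hr hw).
split; first exact: XC.
move=> V x sV hB.
(* If [V] contains [act r], no nonempty [S] in [act r] avoids [V]. Then [S = act r] is used: on
   [B_V] there are no rounds, and the transfer map fixes the passive face. *)
have [sA|nA] := boolP (act r `<=` V)%fset.
  have aV : act (rc_del r V) = fset0.
    by rewrite act_del; apply/eqP; rewrite fsetD_eq0.
  have [a0|a0] := eqVneq (act r) fset0.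
    rewrite !Psi_act0 // act_del pass_del.
    apply: (tau_join_face htau (pass_act_dis r)); first by rewrite act_pass.
    by rewrite -/(chi r) chi_id.
  have [hX eg hBS] := B_act sA sV (fsubset_refl _) hB.
  rewrite (XC r _ (act r)) // eg.
  have [_ qS] := IH _ (leq_trans (weight_dec (fsubset_refl _) a0) hw).
  rewrite (qS V) // ?finsupp_dec //.
  have -> : rc_del (rc_dec r (act r)) V = rc_del r V.
    apply: rc_eqP => [|p]; first by rewrite !finsupp_del finsupp_dec.
    rewrite !rval_del rval_dec; case pV: (p \in V) => //.
    by case pA : (p \in act r); rewrite ?subn0 //; rewrite (fsubsetP sA) in pV.
  apply: (transfer_fix (pass_act_dis r)) => //.
  have h := Psi_simplex (delta_P sV hB).
  apply: simplex_mono h; rewrite finsupp_del -act_pass.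
  apply/fsubsetP => p; rewrite in_fsetD in_fsetU => /andP[pV /orP[|//]].
  by move=> /(fsubsetP sA) pV'; rewrite pV' in pV.
(* With [S] disjoint from [V], stripping and deletion commute, and the transfer map restricts to the
   face. *)
have [S [S0 sS dSV hX]] := X_cover nA hB.
have [hBg hXd eg] := X_delta sS sV dSV hB hX.
have [_ qS] := IH _ (leq_trans (weight_dec sS S0) hw).
rewrite (XC r _ S) //.
have -> : Psi (rc_dec r S) (gm S x) = Psi (rc_del (rc_dec r S) V) (dl V (gm S x)).
  by apply: qS => //; rewrite finsupp_dec.
have sSV : (S `<=` act (rc_del r V))%fset.
  rewrite act_del; apply/fsubsetP => p pS; rewrite in_fsetD (fsubsetP sS) // andbT.
  by apply/negP; move/disjP: dSV; apply.
rewrite (XC (rc_del r V) (weight_del _ _) S) // dec_del eg act_del pass_del.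
apply: (transfer_face (pass_act_dis r)) => //; first by rewrite act_pass.
rewrite act_pass -(finsupp_dec r S) -finsupp_del; apply: Psi_simplex.
by apply: delta_P => //; rewrite finsupp_dec.
Qed.

Lemma Psi_X r S x : (S `<=` act r)%fset -> X S r x ->
  Psi r x = trans r S (Psi (rc_dec r S) (gm S x)).
Proof. by have [h _] := Psi_compat r; exact: h. Qed.

Lemma Psi_B r V x : (V `<=` finsupp r)%fset -> Bd V r x ->
  Psi r x = Psi (rc_del r V) (dl V x).
Proof. by have [_ h] := Psi_compat r; exact: h. Qed.

(** * Continuity and bijectivity *)

Lemma within_cover (T U : topologicalType) (I : eqType) (l : seq I)
    (Y : I -> set T) (f : T -> U) :
  (forall i, i \in l -> closed (Y i)) ->
  (forall i, i \in l -> {within Y i, continuous f}) ->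
  closed [set x | exists2 i, i \in l & Y i x] /\
  {within [set x | exists2 i, i \in l & Y i x], continuous f}.
Proof.
elim: l => [|i l IH] hc hf.
  have -> : [set x | exists2 i, i \in [::] & Y i x] = set0.
    by rewrite predeqE => x; split=> // -[].
  by split; [exact: closed0|exact: continuous_subspace0].
have -> : [set x | exists2 j, j \in i :: l & Y j x] =
    Y i `|` [set x | exists2 j, j \in l & Y j x].
  rewrite predeqE => x; split=> [[j]|[hi|[j jl hj]]].
  - by rewrite inE => /orP[/eqP->|jl hj]; [left|right; exists j].
  - by exists i; rewrite // mem_head.
  - by exists j; rewrite // inE jl orbT.
have [c1 f1] := IH (fun j jl => hc j (mem_behead (s := i :: l) jl))
    (fun j jl => hf j (mem_behead (s := i :: l) jl)).
have ci := hc i (mem_head _ _); have fi := hf i (mem_head _ _).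
by split; [exact: closedU|exact: withinU_continuous].
Qed.

Lemma Psi_continuous r : {within P r, continuous (Psi r : pt R wseq -> pt R nat)}.
Proof.
move: {2}(weight r).+1 (ltnSn (weight r)) => n; elim: n r => // n IH r hw.
have [a0|nA] := eqVneq (act r) fset0.
  rewrite Psi_act0 //; have := tau_join_continuous htau (pass_act_dis r).
  by rewrite -/(chi r) chi_id.
pose l := [seq S <- fpowerset (act r) | S != fset0].
have lP S : S \in l -> S != fset0 /\ (S `<=` act r)%fset.
  by rewrite mem_filter fpowersetE => /andP[].
have cS S : S \in l -> {within X S r, continuous (Psi r : pt R wseq -> pt R nat)}.
  move=> /lP[S0 sS].
  apply: (@within_eq _ _ _ (fun x => trans r S (Psi (rc_dec r S) (gm S x)) : pt R nat)).
    by move=> x hX; rewrite (Psi_X sS hX).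
  have c1 := IH _ (leq_trans (weight_dec sS S0) hw).
  have c2 := within_comp (@gamma_continuous R S r) c1 (@gamma_P R S r sS).
  apply: (within_comp c2 (transfer_continuous (pass_act_dis r) sS)) => x hX.
  by rewrite act_pass -(finsupp_dec r S); apply/Psi_simplex/gamma_P.
have [_] := within_cover (fun S _ => geom_closed (@X_le S r)) cS.
suff -> : P r = [set x | exists2 S, S \in l & X S r x] by [].
rewrite predeqE => x; split=> [hx|[S _]]; last exact: X_P.
have [S [S0 sS hX _]] := Psi_cover nA hx.
by exists S => //; rewrite mem_filter S0 fpowersetE.
Qed.

(** The argument of [theta_face]. Bijectivity is a hypothesis because the lemma is used within the
    induction that proves it. *)
Lemma Psi_face_bij r V x : set_bij (P r) (simp (finsupp r)) (Psi r) ->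
  set_bij (P (rc_del r V)) (simp (finsupp (rc_del r V))) (Psi (rc_del r V)) ->
  (V `<=` finsupp r)%fset -> P r x ->
  Bd V r x <-> simp (finsupp r `\` V)%fset (Psi r x).
Proof.
move=> [_ inj _] [_ _ surj] sV hx; rewrite -finsupp_del; split=> [hB|hy].
  by rewrite (Psi_B sV hB); apply/Psi_simplex/delta_P.
have [u hu eu] := surj _ hy.
have [_ _ dsurj] := @delta_bij R _ _ sV; have [u' hu' eu'] := dsurj _ hu.
suff <- : u' = x by [].
by apply: inj; rewrite ?inE; [exact: B_P hu'|exact: hx|rewrite (Psi_B sV hu') eu'].
Qed.

Lemma Psi_bij r : set_bij (P r) (simp (finsupp r)) (Psi r).
Proof.
move: {2}(weight r).+1 (ltnSn (weight r)) => n; elim: n r => // n IH r hw'.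
have dr := pass_act_dis r.
have [a0|nA] := eqVneq (act r) fset0.
  rewrite Psi_act0 //; have := tau_join_bij htau (pass_act_dis r).
  by rewrite -/(chi r) chi_id // act_pass.
have [thin thinj thsurj] := tau_join_bij htau dr.
rewrite -/(chi r) act_pass in thin thinj thsurj.
have IHS S : S != fset0 -> (S `<=` act r)%fset ->
    set_bij (P (rc_dec r S)) (simp (finsupp r)) (Psi (rc_dec r S)).
  move=> S0 sS; rewrite -(finsupp_dec r S); apply: IH.
  exact: leq_trans (weight_dec sS S0) hw'.
have fS S y : (S `<=` act r)%fset -> S != fset0 -> simp (finsupp r) y ->
    exists w, [/\ X S r w, Psi (rc_dec r S) (gm S w) = y & Psi r w = trans r S y].
  move=> sS S0 hy; have [_ _ surj] := IHS S S0 sS.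
  have [z hz <-] := surj _ hy.
  have [_ _ gsurj] := gamma_bij R sS; have [w hw <-] := gsurj _ hz.
  by exists w; split=> //; exact: Psi_X.
(* Membership of [x] in [X_S(r)] passes to the point [z] of [P(chi r)] with the same image: the
   point of [X_S(chi r)] through which [transfer] computes the image must be [z]. *)
have eS S (x z : pt R wseq) : (S `<=` act r)%fset -> X S r x -> P (chi r) z ->
    Psi r x = theta (act r) (pass r) z ->
    X S (chi r) z /\ theta (act r `\` S)%fset (pass r `|` S)%fset (gm S z) =
      Psi (rc_dec r S) (gm S x).
  move=> sS hX hz; rewrite (Psi_X sS hX).
  have hy : simp (act r `|` pass r)%fset (Psi (rc_dec r S) (gm S x)).
    by rewrite act_pass -(finsupp_dec r S); apply/Psi_simplex/gamma_P.
  have [w hw <-] := transfer_ex dr sS hy.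
  rewrite transferE // => e; suff <- : w = z by [].
  by apply: thinj; rewrite ?inE //; exact: X_P hw.
have injS S (w1 w2 : pt R wseq) : S != fset0 -> (S `<=` act r)%fset ->
    X S r w1 -> X S r w2 -> Psi r w1 = Psi r w2 -> w1 = w2.
  move=> S0 sS h1 h2; rewrite (Psi_X sS h1) (Psi_X sS h2) => e.
  have [_ ginj _] := gamma_bij R sS; have [_ pinj _] := IHS S S0 sS.
  apply: ginj; rewrite ?inE //; apply: pinj; rewrite ?inE; try exact: gamma_P.
  apply: (transfer_inj dr sS _ _ e); rewrite act_pass -(finsupp_dec r S);
    by apply/Psi_simplex/gamma_P.
(* A point [w] of the larger piece [X_T(r)] with the image of [x] equals [x]. Since [z] lies in both
   pieces of [P(chi r)], the image of [gamma T w] lies on the face without [S]; as the weight has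
   dropped, this puts [gamma T w] in [B_S], hence [w] in [X_S(r)]. *)
have key S T (x w z : pt R wseq) :
    S != fset0 -> (S `<=` T)%fset -> (T `<=` act r)%fset ->
    X S r x -> X T r w -> P (chi r) z -> Psi r w = Psi r x ->
    Psi r x = theta (act r) (pass r) z -> w = x.
  move=> S0 sST sT hx hw hz ewx ex; have sS := fsubset_trans sST sT.
  apply: (injS S) => //; have [->//|nST] := eqVneq S T.
  have T0 : T != fset0.
    by apply: contraNneq S0 => e; move: sST; rewrite e fsubset0.
  have [zS _] := eS S x z sS hx hz ex.
  have [zT eT] := eS T w z sT hw hz (etrans ewx ex).
  have sT' : (T `<=` act (chi r))%fset by rewrite act_chi.
  have hBz : Bd S (rc_dec (chi r) T) (gm T z) by apply/(X_sub sT' sST nST zT).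
  apply/(X_sub sT sST nST hw).
  have sSU : (S `<=` finsupp (rc_dec r T))%fset.
    by rewrite finsupp_dec (fsubset_trans sS) // act_sub.
  have hy : simp (finsupp (rc_del (rc_dec r T) S)) (Psi (rc_dec r T) (gm T w)).
    rewrite -eT finsupp_del finsupp_dec -act_pass -(union_dec _ sT).
    have hBz' := hBz; rewrite dec_chi2 // in hBz'.
    apply/(theta_face (disjoint_dec dr T)) => //; last exact: B_P hBz'.
    by rewrite union_dec // act_pass -(finsupp_dec r T).
  have wd : (weight (rc_del (rc_dec r T) S) < n)%N.
    apply: leq_ltn_trans (weight_del _ _) _.
    exact: leq_trans (weight_dec sT T0) hw'.
  apply/(Psi_face_bij _ (IH _ wd) sSU (gamma_P sT hw)); last by rewrite -finsupp_del.
  by rewrite finsupp_dec; exact: IHS.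
split.
- by move=> x; exact: Psi_simplex.
- move=> x y; rewrite !inE => hx hy exy.
  have [z hz ez] := thsurj _ (Psi_simplex hx).
  have [S [S0 sS hS _]] := Psi_cover nA hx.
  have [T [T0 sT hT _]] := Psi_cover nA hy.
  have sU : (S `|` T `<=` act r)%fset by rewrite fsubUset sS.
  have [zS _] := eS S x z sS hS hz (esym ez).
  have [zT _] := eS T y z sT hT hz (etrans (esym exy) (esym ez)).
  have U0 : (S `|` T)%fset != fset0.
    by apply: contraNneq S0 => e; rewrite -fsubset0 -e fsubsetUl.
  have sS' : (S `<=` act (chi r))%fset by rewrite act_chi.
  have sT' : (T `<=` act (chi r))%fset by rewrite act_chi.
  have zU := X_union sS' sT' zS zT.
  (* The value that [Psi (rc_dec r (S + T))], with [S + T] the union, must take for the lift [w] to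
     have the image of [z]; [x] and [y] are then each compared with [w]. *)
  pose t := theta (act r `\` (S `|` T))%fset (pass r `|` (S `|` T))%fset
    (gm (S `|` T)%fset z).
  have ht : simp (finsupp r) t.
    have [h _ _] := theta_dec_bij dr sU; rewrite -act_pass; apply: h.
    by apply: gamma_P zU; rewrite act_chi.
  have [w [hw _ ew]] := fS _ t sU U0 ht.
  have {}ew : Psi r w = theta (act r) (pass r) z by rewrite ew transferE.
  rewrite -(key S _ x w z S0 (fsubsetUl _ _) sU hS hw hz _ (esym ez)) ?ew //.
  rewrite -(key T _ y w z T0 (fsubsetUr _ _) sU hT hw hz _ _) //.
    by rewrite ew ez exy.
  by rewrite -exy ez.
- move=> y hy; have [z hz ez] := thsurj _ hy.
  have [S [S0 sS _ hS]] : exists S, [/\ S != fset0, (S `<=` act (chi r))%fset,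
      fdisjoint S fset0 & X S (chi r) z].
    by apply: X_cover (B_empty hz); rewrite fsubset0 act_chi.
  rewrite act_chi in sS.
  have ht : simp (finsupp r) (theta (act r `\` S)%fset (pass r `|` S)%fset (gm S z)).
    have [h _ _] := theta_dec_bij dr sS; rewrite -act_pass; apply: h.
    by apply: gamma_P hS; rewrite act_chi.
  have [w [hw _ ew]] := fS _ _ sS S0 ht.
  by exists w; [exact: X_P hw|rewrite ew transferE].
Qed.

Lemma Psi_homeo r : homeo (P r) (simp (finsupp r)) (Psi r).
Proof.
apply: homeo_compact; [exact: geom_compact (@subset_refl _ _)|
  exact: Psi_bij|exact: Psi_continuous].
Qed.

Lemma Psi_face r V x : (V `<=` finsupp r)%fset -> P r x ->
  Bd V r x <-> simp (finsupp r `\` V)%fset (Psi r x).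
Proof. by apply: Psi_face_bij; exact: Psi_bij. Qed.

(** * Return to [Phi], and the two conditions of the theorem *)

Definition Phi r (x : pt R wseq) : pt R wseq :=
  inv_on (P (chi r)) (theta (act r) (pass r)) (Psi r x).

Let chi_bij r : set_bij (P (chi r)) (simp (finsupp r)) (theta (act r) (pass r)).
Proof. by rewrite -act_pass; exact: (tau_join_bij htau (pass_act_dis r)). Qed.

Lemma Phi_chi r x : P r x ->
  P (chi r) (Phi r x) /\ theta (act r) (pass r) (Phi r x) = Psi r x.
Proof. by move=> hx; apply: inv_on_in (chi_bij r) _; exact: Psi_simplex. Qed.

Lemma Phi_eq r x z : P (chi r) z -> theta (act r) (pass r) z = Psi r x -> Phi r x = z.
Proof. by move=> hz e; rewrite /Phi -e inv_onK //; case: (chi_bij r). Qed.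

Lemma Phi_homeo r : homeo (P r) (P (chi r)) (Phi r).
Proof.
apply: homeo_compact; first exact: geom_compact (@subset_refl _ _).
  have [pin pinj psurj] := Psi_bij r; have [cin _ _] := chi_bij r; split.
  - by move=> x /Phi_chi[].
  - move=> x y; rewrite !inE => hx hy e; apply: pinj; rewrite ?inE //.
    by have [_ <-] := Phi_chi hx; have [_ <-] := Phi_chi hy; rewrite e.
  - move=> z hz; have [x hx ex] := psurj _ (cin _ hz).
    by exists x => //; exact: Phi_eq.
have [_ _ ci] := tau_join_homeo htau (pass_act_dis r); rewrite act_pass in ci.
exact: (within_comp (@Psi_continuous r) ci (@Psi_simplex r)).
Qed.

Lemma Phi_B r V x : (V `<=` finsupp r)%fset -> Bd V r x ->
  Phi r x = inv_on (Bd V (chi r)) (dl V) (Phi (rc_del r V) (dl V x)).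
Proof.
move=> sV hB; have [hP eP] := Phi_chi (B_P hB).
have sV' : (V `<=` act r `|` pass r)%fset by rewrite act_pass.
have hBc : Bd V (chi r) (Phi r x).
  apply/(theta_face (pass_act_dis r) sV' hP); rewrite eP act_pass.
  by apply/Psi_face => //; exact: B_P hB.
have sVc : (V `<=` finsupp (chi r))%fset by rewrite finsupp_chi.
have -> : Phi (rc_del r V) (dl V x) = dl V (Phi r x).
  apply: Phi_eq; first by rewrite -del_chi; exact: delta_P.
  by rewrite -Psi_B // -eP act_del pass_del (tau_join_face htau (pass_act_dis r) sV').
by rewrite inv_onK //; case: (@delta_bij R _ _ sVc).
Qed.

Lemma Phi_X r S x : (S `<=` act r)%fset -> X S r x ->
  Phi r x = inv_on (X S (chi r)) (gm S)
    (tau_change tau (chi (rc_dec r S)) (rc_dec (chi r) S) (Phi (rc_dec r S) (gm S x))).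
Proof.
move=> sS hX; have hg := gamma_P sS hX; have dr := pass_act_dis r.
have hy : simp (act r `|` pass r)%fset (Psi (rc_dec r S) (gm S x)).
  by rewrite act_pass -(finsupp_dec r S); exact: Psi_simplex.
have [w hw ew] := transfer_ex dr sS hy.
have sSc : (S `<=` act (chi r))%fset by rewrite act_chi.
have -> : Phi r x = w.
  by apply: Phi_eq (X_P hw) _; rewrite (Psi_X sS hX) -ew transferE.
(* [tau_change] reads its sets off the counters. For the target these are the sets used in
   [transfer]; for the source, its first map cancels the inverse in [Phi (rc_dec r S)]. *)
have ea : act (rc_dec (chi r) S) = (act r `\` S)%fset by rewrite dec_chi2 // act_chi2.
have ep : pass (rc_dec (chi r) S) = (pass r `|` S)%fset.
  rewrite dec_chi2 // pass_chi2; apply/fsetDidPl; apply/eqP; apply/eqP.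
  by apply/disjP => p p1 p2; move/disjP: (disjoint_dec dr S) => /(_ p p2 p1).
rewrite /tau_change act_chi pass_chi ea ep; have [_ ->] := Phi_chi hg.
have [_ tinj _] := theta_dec_bij dr sS; have [_ ginj _] := gamma_bij R sSc.
by rewrite -ew inv_onK ?inv_onK //; exact: gamma_P.
Qed.

(** The inverse of [Psi r] serves: by [Psi_face], the face on [C] corresponds to [B_V] for the
    complement [V] of [C]. *)
Lemma simplex_homeo r : exists phi : pt R nat -> pt R wseq,
  homeo (simp (finsupp r)) (P r) phi /\
  forall C : {fset nat}, (C `<=` finsupp r)%fset ->
    exists2 L : set wseq, subcomplex L r & phi @` simp C = geom R L.
Proof.
have hb := Psi_bij r; have [_ inj _] := hb; have [_ _ ci] := Psi_homeo r.
exists (inv_on (P r) (Psi r)); split.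
  apply: homeo_compact => //; first exact: simplex_compact.
  exact: bijpinv_bij hb.
move=> C sC; set V := (finsupp r `\` C)%fset.
have sV : (V `<=` finsupp r)%fset by exact: fsubsetDl.
have eC : (finsupp r `\` V)%fset = C.
  apply/fsetP => p; rewrite !inE negb_and negbK andb_orl.
  by have := fsubsetP sC p; case: (p \in C) => [/(_ isT)->|_] //=; rewrite andNb.
exists (Bcx V r); first exact: Bcx_subcomplex.
rewrite predeqE => x; split=> [[y hy <-]|hB].
  have [h1 h2] := inv_on_in hb (simplex_mono sC hy).
  by apply/Psi_face => //; rewrite h2 eC.
exists (Psi r x); last by rewrite inv_onK //; exact: B_P hB.
by rewrite -eC; apply/Psi_face => //; exact: B_P hB.
Qed.

End Main.

Theorem theorem6p18 (R : realType)
    (tau : {fset nat} -> pt R wseq -> pt R nat) (htau : tau_family tau) :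
  (exists Phi : round_counter -> pt R wseq -> pt R wseq,
    forall r : round_counter,
    [/\ homeo (geom R (Pcx r)) (geom R (Pcx (chi r))) (Phi r),
        forall V : {fset nat}, (V `<` finsupp r)%fset ->
          forall x : pt R wseq, geom R (Bcx V r) x ->
            Phi r x =
            inv_on (geom R (Bcx V (chi r))) (simp_map (delta V))
              (Phi (rc_del r V) (simp_map (delta V) x))
      & forall S : {fset nat}, (S `<=` act r)%fset ->
          forall x : pt R wseq, geom R (Xcx S r) x ->
            Phi r x =
            inv_on (geom R (Xcx S (chi r))) (simp_map (gamma S))
              (tau_change tau (chi (rc_dec r S)) (rc_dec (chi r) S)
                (Phi (rc_dec r S) (simp_map (gamma S) x)))]) /\
  (forall r : round_counter,
    exists phi : pt R nat -> pt R wseq,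
      homeo (simplex R (finsupp r)) (geom R (Pcx r)) phi /\
      forall C : {fset nat}, (C `<=` finsupp r)%fset ->
        exists2 L : set wseq, subcomplex L r &
          (phi @` simplex R C)%classic = geom R L).
Proof.
split; last by move=> r; exact: (simplex_homeo htau).
exists (Phi tau) => r; split; first exact: Phi_homeo.
  by move=> V /fproper_sub sV x; exact: Phi_B.
by move=> S sS x; exact: Phi_X.
Qed.
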